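(* Let $t$ be a prime power and $q=t^2$. Let $X\subset\mathbb{P}^3(\mathbb{F}_q)$ be the hermitian surface $x_0^{t+1}+x_1^{t+1}+x_2^{t+1}+x_3^{t+1}=0$, and let $C_2(X)$ be the functional code of forms of degree $2$ on $X$. The number of codewords of second weight of $C_2(X)$ is $$\frac{1}{2}(t^2-1)(t^5+t^3+t^2+1)(3t^2-t+1)t^2 .$$
   Context: Points of $X$ mean $\mathbb{F}_q$-rational points, and $|X|$ is their number. Let $\mathcal{F}$ be the $\mathbb{F}_q$-vector space of forms (homogeneous polynomials) of degree $2$ in $x_0,\dots,x_3$ over $\mathbb{F}_q$ (including $0$). Every point of $\mathbb{P}^3(\mathbb{F}_q)$ is represented by its unique coordinate vector whose first nonzero coordinate equals $1$. The code $C_2(X)\subset\mathbb{F}_q^{|X|}$ is the image of the linear map $c:\mathcal{F}\to\mathbb{F}_q^{|X|}$, $c(f)=(f(x))_{x\in X}$, where $f$ is evaluated at this representative. The weight of a codeword is its number of nonzero coordinates; the second weight is the second smallest among the distinct weights of nonzero codewords. *)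

(* Defs.v *)
From HB Require Import structures.
From mathcomp Require Import all_boot all_order all_algebra.
From mathcomp Require Import mpoly.

Set Implicit Arguments.
Unset Strict Implicit.
Unset Printing Implicit Defensive.

Import GRing.Theory.
Local Open Scope ring_scope.

Definition prime_power (t : nat) : Prop :=
  exists p k : nat, [/\ prime p, (0 < k)%N & t = (p ^ k)%N].

(* Some coordinate of v is nonzero, and the first such coordinate is 1. *)
Definition normalized (F : finFieldType) (n : nat) (v : 'rV[F]_n.+1) : bool :=
  [exists i, (v 0 i == 1) && [forall j : 'I_n.+1, (j < i)%N ==> (v 0 j == 0)]].

(* P^n(F), each point being identified with its normalized representative. *)
Definition proj_point (F : finFieldType) (n : nat) : finType :=
  {v : 'rV[F]_n.+1 | normalized v}.

Definition hermitian_surface (F : finFieldType) (t : nat) :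
    {set proj_point F 3} :=
  [set x : proj_point F 3 | \sum_(i < 4) val x 0 i ^+ t.+1 == 0].

(* Words are functions I -> F on a finite index type I of coordinates; F^o is F
   seen as a vector space over itself. *)
Definition hweight (F : finFieldType) (I : finType) (w : {ffun I -> F^o}) : nat :=
  #|[set i | w i != 0]|.

Definition code_weights (F : finFieldType) (I : finType)
    (C : {vspace {ffun I -> F^o}}) : seq nat :=
  sort leq (undup
    [seq hweight w | w : {ffun I -> F^o} in [pred w | (w \in C) && (w != 0)]]).

(* Meaningful only when code_weights C has at least two entries; otherwise 0. *)
Definition second_weight (F : finFieldType) (I : finType)
    (C : {vspace {ffun I -> F^o}}) : nat :=
  nth 0%N (code_weights C) 1.

Definition second_weight_words (F : finFieldType) (I : finType)
    (C : {vspace {ffun I -> F^o}}) : {set {ffun I -> F^o}} :=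
  [set w : {ffun I -> F^o} | (w \in C) && (hweight w == second_weight C)].

Section FunctionalCode.
Variables (F : finFieldType) (n d : nat) (X : {set proj_point F n}).

Definition eval_form (f : dhomog n.+1 F d) :
    {ffun {x : proj_point F n | x \in X} -> F^o} :=
  [ffun x : {x : proj_point F n | x \in X} =>
     (mpoly_of_dhomog f).@[fun i => val (val x) 0 i] : F^o].

Lemma eval_form_is_linear : linear eval_form.
Proof.
by move=> a f g; apply/ffunP => x; rewrite !ffunE /= mevalD mevalZ.
Qed.

HB.instance Definition _ :=
  GRing.isLinear.Build F (dhomog n.+1 F d)
    {ffun {x : proj_point F n | x \in X} -> F^o} _ eval_form eval_form_is_linear.

Definition functional_code : {vspace {ffun {x : proj_point F n | x \in X} -> F^o}} :=
  limg (linfun eval_form).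

End FunctionalCode.

Arguments functional_code {F n} d X.

(* Main.v *)
(* Work with vectors of F^4 and the hermitian form h. Let V(f) be the quadric
   of a nonzero form f and N the number of points of V(f) on the hermitian
   surface X.
   - If V(f) contains no line of X, counting incidences of points and lines of
     X gives N <= 2 (t^3 + 1), as each line meets V(f) in at most two points.
   - If V(f) contains a line L of X, the planes through L are the planes p^perp
     with p on L. Unless f vanishes on p^perp, it is the product there of the
     equations of L and of a second line M_p, and p^perp meets X in the t + 1
     lines through p. So p contributes t, t^2 or 0 new points according as M_p
     avoids p, is another line of X through p, or neither. That M_p contains p
     is a sesquilinear equation in p, with at most t + 1 solutions unless it
     vanishes. If f vanishes on no plane, N <= 2 t^3 + t^2 + 1, with equality
     iff L meets t + 1 other lines of X in V(f).
   - If f vanishes on a plane, f(x) = h(x, u) h(x, v). If u is isotropic, the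
     same sum gives N = 2 t^3 + t^2 + 1 iff u is orthogonal to v, with u and v
     independent; the only larger value of N is 2 t^3 + 2 t^2 - t + 1. If
     neither u nor v is isotropic, V(f) contains no line of X.
   Products of linear forms are counted by pairs (u, v). In the extremal case
   without planes, the lines of X in V(f) form a complete bipartite graph
   K_(t+1,t+1), and f is a multiple of x1 x3 + x2 x4 in a hyperbolic basis;
   such forms are counted by pairs (f, basis). *)

Require Import Defs.
From HB Require Import structures.
From mathcomp Require Import all_boot all_order all_algebra.
From mathcomp Require Import mpoly.
From mathcomp Require Import finfield.
From mathcomp Require Import ring zify.

Set Implicit Arguments.
Unset Strict Implicit.
Unset Printing Implicit Defensive.

Import GRing.Theory.
Local Open Scope ring_scope.

(** Forms are treated as functions with a bilinear polarisation, so that characteristic 2 needs no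
    separate argument: vanishing on the span of x and y means f x = f y = pol f x y = 0. The
    difficulty lies with quadrics containing no plane. Instead of classifying quadrics, the proof
    uses tangency along one line L of X in V(f): M_p contains p exactly when p^perp is tangent to
    V(f) at p. In the extremal case there are t + 1 >= 3 tangent points on L, so a hyperbolic basis
    can be scaled until three of them are e1, e2 and e1 + e2; this is what produces x1 x3 + x2 x4.
    For a given f and a given pair of opposite lines, such bases differ by scalar multiples of
    invertible matrices over the field of t elements. In the result, 3 t^2 - t + 1 is the sum of 2
    t^2 - t + 1 from products and t^2 from the other forms; the factor 1/2 reflects the swap of two
    isotropic factors in the one case and the two classes of K_(t+1,t+1) in the other. Evaluation on
    X is injective, so counting forms counts words. *)

Section Counting.
Local Open Scope nat_scope.

(** * Counting by pairs, bijections and fibres *)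

Lemma card_pair_sum (A B : finType) (P : pred A) (Q : A -> pred B) :
  #|[set p : A * B | P p.1 && Q p.1 p.2]| = \sum_(x | P x) #|[set y | Q x y]|.
Proof.
rewrite -sum1dep_card -(pair_big_dep P Q (fun _ _ => 1)).
by apply: eq_bigr => x _; rewrite sum1dep_card.
Qed.

Lemma card_pair_const (A B : finType) (P : pred A) (Q : A -> pred B) n :
  (forall x, P x -> #|[set y | Q x y]| = n) ->
  #|[set p : A * B | P p.1 && Q p.1 p.2]| = #|[set x | P x]| * n.
Proof.
move=> h; rewrite card_pair_sum (eq_bigr (fun=> n)) //.
by rewrite sum_nat_const cardsE.
Qed.

Lemma card_pair_swap (A B : finType) (P : pred A) (Q : A -> pred B)
    (P' : pred B) (Q' : B -> pred A) :
  (forall x y, P x && Q x y = P' y && Q' y x) ->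
  #|[set p : A * B | P p.1 && Q p.1 p.2]| =
  #|[set p : B * A | P' p.1 && Q' p.1 p.2]|.
Proof.
move=> h; rewrite -(card_imset _ (f := fun p : A * B => (p.2, p.1))); last first.
  by move=> [x y] [x' y'] [-> ->].
apply: eq_card => -[y x]; rewrite inE /=; apply/imsetP/idP => /=.
  by case=> -[x' y']; rewrite inE /= h => H [-> ->].
by move=> H; exists (x, y); rewrite // inE /= h.
Qed.

Lemma double_count (A B : finType) (P : pred A) (Q : A -> pred B)
    (P' : pred B) (Q' : B -> pred A) m n :
  (forall x y, P x && Q x y = P' y && Q' y x) ->
  (forall x, P x -> #|[set y | Q x y]| = m) ->
  (forall y, P' y -> #|[set x | Q' y x]| = n) ->
  #|[set x | P x]| * m = #|[set y | P' y]| * n.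
Proof.
move=> h hm hn; rewrite -(card_pair_const hm) -(card_pair_const hn).
exact: card_pair_swap.
Qed.

Lemma card_bij (A B : finType) (S : {set A}) (T : {set B}) (f : A -> B) (g : B -> A) :
  (forall x, x \in S -> f x \in T /\ g (f x) = x) ->
  (forall y, y \in T -> g y \in S /\ f (g y) = y) ->
  #|S| = #|T|.
Proof.
move=> hf hg; rewrite -(card_in_imset (f := f) (D := S)); last first.
  by move=> x y xS yS e; rewrite -(proj2 (hf _ xS)) e (proj2 (hf _ yS)).
apply: eq_card => y; apply/imsetP/idP => [[x xS ->]|yT]; first by case: (hf _ xS).
by case: (hg _ yT) => gS e; exists (g y).
Qed.

(** Upper bounds on the target and on the fibres whose product is the size of the source must both
    be attained. For trace and norm the bounds are degrees of polynomials, and equality yields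
    surjectivity together with the exact fibre sizes. *)
Lemma card_fibre_extremal (A B : finType) (S : {set A}) (T : {set B})
    (f : A -> B) m k :
  0 < m -> #|S| = m * k -> #|T| <= k ->
  (forall x, x \in S -> f x \in T) ->
  (forall y, y \in T -> #|[set x in S | f x == y]| <= m) ->
  #|T| = k /\ forall y, y \in T -> #|[set x in S | f x == y]| = m.
Proof.
move=> m0 cS cT fT fib.
have sumE : #|S| = \sum_(y in T) #|[set x in S | f x == y]|.
  rewrite -sum1_card (partition_big f (mem T)) //=.
  apply: eq_bigr => y yT; rewrite sum1dep_card; apply: eq_card => x.
  by rewrite !inE.
have le : \sum_(y in T) #|[set x in S | f x == y]| <= \sum_(y in T) m.
  by apply: leq_sum => y yT; apply: fib.
have cTk : #|T| = k.
  apply/eqP; rewrite eqn_leq cT /= -(leq_pmul2l m0) -cS sumE (leq_trans le) //.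
  by rewrite sum_nat_const mulnC.
split=> // y yT; apply/eqP; rewrite eqn_leq fib //= leqNgt; apply/negP => lt.
suff : #|S| < \sum_(y in T) m by rewrite sum_nat_const cTk cS mulnC ltnn.
rewrite sumE (bigD1 y) //= [X in _ < X](bigD1 y) //=.
rewrite -addSn leq_add // leq_sum // => z /andP[zT _]; exact: fib.
Qed.

End Counting.

Lemma card_roots_le (F : finFieldType) (p : {poly F}) (A : {set F}) :
  p != 0 -> (forall x, x \in A -> p.[x] = 0) -> (#|A| < size p)%N.
Proof.
move=> p0 hA; rewrite cardE; apply: max_poly_roots => //; last exact: enum_uniq.
by apply/allP => x; rewrite mem_enum => /hA /eqP.
Qed.

Lemma card_imset_fibres (A B : finType) (f : A -> B) (S : {set A}) m :
  (forall x, x \in S -> #|[set y in S | f y == f x]| = m) ->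
  (#|f @: S| * m = #|S|)%N.
Proof.
move=> H; rewrite -[RHS]sum1_card (partition_big_imset f) /= -sum_nat_const.
apply: eq_bigr => y /imsetP[x xS ->].
by rewrite -(H x xS) -sum1dep_card.
Qed.

Lemma second_smallest (s : seq nat) a b : uniq s -> a \in s -> b \in s -> (a < b)%N ->
  (forall x, x \in s -> x = a \/ (b <= x)%N) ->
  (1 < size (sort leq s))%N /\ nth 0%N (sort leq s) 1 = b.
Proof.
move=> us sa sb ab H.
have bs : b \in rem a s by rewrite mem_rem_uniq // !inE sb andbT neq_ltn ab orbT.
suff -> : sort leq s = [:: a, b & sort leq (rem b (rem a s))] by [].
apply: (sorted_eq leq_trans anti_leq); first exact: (sort_sorted leq_total).
  rewrite /= ltnW //= (path_sortedE leq_trans) (sort_sorted leq_total) andbT.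
  apply/allP => x; rewrite mem_sort => /mem_rem; rewrite mem_rem_uniq // !inE.
  by case/andP => xa /H[] // e; rewrite e eqxx in xa.
rewrite perm_sort (perm_trans (perm_to_rem sa)) // perm_cons.
by rewrite (perm_trans (perm_to_rem bs)) // perm_cons perm_sym perm_sort.
Qed.

(** * Quadratic functions and their polar forms *)

Section Quadratic.
Variables (F : finFieldType) (V : finLmodType F).

Definition pol (f : V -> F) x y := f (x + y) - f x - f y.

(** Homogeneity of degree 2 and a polarisation linear in its first argument, hence bilinear by
    symmetry. This is meaningful in characteristic 2, where [pol] does not determine f. Boolean
    quantifiers over the finite module allow sets of forms to be counted. *)
Definition quad (f : V -> F) := [forall a, forall x, forall y, forall z,
  (f (a *: x) == a ^+ 2 * f x) && (pol f (a *: x + y) z == a * pol f x z + pol f y z)].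

Lemma quadP f : reflect
  ((forall a x, f (a *: x) = a ^+ 2 * f x) /\
   (forall a x y z, pol f (a *: x + y) z = a * pol f x z + pol f y z)) (quad f).
Proof.
apply: (iffP forallP) => [H|[H1 H2] a].
  split=> a x; last move=> y z.
    by move/forallP: (H a) => /(_ x) /forallP/(_ x) /forallP/(_ x) /andP[/eqP].
  by move/forallP: (H a) => /(_ x) /forallP/(_ y) /forallP/(_ z) /andP[_ /eqP].
by apply/forallP => x; apply/forallP => y; apply/forallP => z; rewrite H1 H2 !eqxx.
Qed.

Variable f : V -> F.
Hypothesis qf : quad f.

Lemma quadZ a x : f (a *: x) = a ^+ 2 * f x.
Proof. by have [H _] := quadP _ qf; apply: H. Qed.
Lemma quad0 : f 0 = 0.
Proof. by rewrite -(scale0r 0) quadZ expr0n mul0r. Qed.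
Lemma quadD x y : f (x + y) = f x + f y + pol f x y.
Proof. by rewrite /pol; ring. Qed.
Lemma polC x y : pol f x y = pol f y x.
Proof. by rewrite /pol [x + y]addrC addrAC. Qed.
Lemma polDl x y z : pol f (x + y) z = pol f x z + pol f y z.
Proof. by have [_ H] := quadP _ qf; rewrite -[x]scale1r H scale1r mul1r. Qed.
Lemma pol0l z : pol f 0 z = 0.
Proof. by rewrite /pol add0r quad0 subr0 subrr. Qed.
Lemma polZl a x z : pol f (a *: x) z = a * pol f x z.
Proof. by have [_ H] := quadP _ qf; rewrite -[a *: x]addr0 H pol0l addr0. Qed.
Lemma polDr x y z : pol f z (x + y) = pol f z x + pol f z y.
Proof. by rewrite polC polDl !(polC z). Qed.
Lemma polZr a x z : pol f z (a *: x) = a * pol f z x.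
Proof. by rewrite polC polZl polC. Qed.
Lemma polNl x z : pol f (- x) z = - pol f x z.
Proof. by rewrite -scaleN1r polZl mulN1r. Qed.
Lemma polNr x z : pol f z (- x) = - pol f z x.
Proof. by rewrite polC polNl polC. Qed.
Lemma polxx x : pol f x x = f x + f x.
Proof.
rewrite /pol (_ : x + x = (1 + 1) *: x); last by rewrite scalerDl scale1r.
by rewrite quadZ; ring.
Qed.
Definition quadE := (quadZ, quadD, polDl, polDr, polZl, polZr, polNl, polNr).

End Quadratic.

Section HermitianSurface.
Variables (F : finFieldType) (t : nat).
Hypotheses (t_pp : prime_power t) (card_F : #|F| = (t ^ 2)%N).

Local Notation V := 'rV[F]_4.

(** * Conjugation on the field of t^2 elements *)

Definition bar (x : F) : F := x ^+ t.

Lemma t_gt1 : (1 < t)%N.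
Proof.
case: t_pp => p [k [p_pr k0 ->]].
by rewrite -(exp1n k) ltn_exp2r // prime_gt1.
Qed.

Lemma t_gt0 : (0 < t)%N. Proof. exact: ltnW t_gt1. Qed.

Lemma t2B1_gt0 : (0 < t ^ 2 - 1)%N.
Proof. by rewrite subn_gt0 -{1}(exp1n 2) ltn_exp2r // t_gt1. Qed.

Lemma barD x y : bar (x + y) = bar x + bar y.
Proof.
case: t_pp => p [k [p_pr k0 e]]; rewrite /bar; apply: exprDn_pchar.
have pF : p \in [pchar F].
  by apply: (@card_finPcharP F p (k * 2)) => //; rewrite card_F e expnM.
rewrite (eq_pnat _ (pcharf_eq pF)) e pnatX pnat_id //.
Qed.

Lemma barM x y : bar (x * y) = bar x * bar y. Proof. exact: exprMn. Qed.
Lemma barK x : bar (bar x) = x.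
Proof. by rewrite /bar -exprM mulnn -card_F expf_card. Qed.
Lemma bar0 : bar 0 = 0. Proof. by rewrite /bar expr0n; case: (t) t_gt0. Qed.
Lemma bar1 : bar 1 = 1. Proof. exact: expr1n. Qed.
Lemma barN x : bar (- x) = - bar x.
Proof. by apply/eqP; rewrite -subr_eq0 opprK -barD addNr bar0. Qed.
Lemma barB x y : bar (x - y) = bar x - bar y.
Proof. by rewrite barD barN. Qed.
Lemma barV x : bar x^-1 = (bar x)^-1. Proof. exact: exprVn. Qed.
Lemma bar_eq0 x : (bar x == 0) = (x == 0).
Proof. by rewrite /bar expf_eq0 t_gt0. Qed.

Definition barE := (barB, barD, barM, barN, barK, bar0, bar1).

(** The fixed elements are roots of X^t - X and the fibre over y consists of roots of X^t + X - y,
    so there are at most t of each; as F has t^2 elements, both bounds are attained. *)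
Lemma trace_fibres :
  #|[set s | bar s == s]| = t /\
  (forall c, bar c = c -> #|[set s | s + bar s == c]| = t).
Proof.
have := @card_fibre_extremal F F setT [set s | bar s == s] (fun s => s + bar s) t t.
case; first exact: t_gt0.
- by rewrite cardsT card_F -mulnn.
- have sz : size ('X^t - 'X : {poly F}) = t.+1.
    by rewrite size_polyDl ?size_polyXn // size_polyN size_polyX ltnS t_gt1.
  rewrite -ltnS -sz; apply: card_roots_le; first by rewrite -size_poly_gt0 sz.
  by move=> x; rewrite inE !(hornerD, hornerN, hornerXn, hornerX, hornerC) /bar => /eqP->;
    rewrite subrr.
- by move=> x _; rewrite inE !barE addrC.
- move=> y _; have sz : size ('X^t + ('X - y%:P) : {poly F}) = t.+1.
    by rewrite size_polyDl ?size_polyXn // size_XsubC ltnS t_gt1.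
  rewrite -ltnS -sz; apply: card_roots_le; first by rewrite -size_poly_gt0 sz.
  move=> x; rewrite !inE !(hornerD, hornerN, hornerXn, hornerX, hornerC) /bar => /eqP<-; ring.
move=> h1 h2; split=> // c hc; rewrite -(h2 c) ?inE ?hc //.
by apply: eq_card => x; rewrite !inE.
Qed.

Lemma card_fixed : #|[set s | bar s == s]| = t.
Proof. by case: trace_fibres. Qed.

Lemma card_trace c : bar c = c -> #|[set s | s + bar s == c]| = t.
Proof. by case: trace_fibres => _; apply. Qed.

Lemma trace_surj c : bar c = c -> exists s, s + bar s = c.
Proof.
move=> hc; have : (0 < #|[set s | (s + bar s == c)%R]|)%N.
  by rewrite card_trace // t_gt0.
by case/card_gt0P => s; rewrite inE => /eqP <-; exists s.
Qed.

Lemma card_nonzero : #|[set s : F | s != 0]| = (t ^ 2 - 1)%N.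
Proof.
have := cardC1 (0 : F); rewrite card_F subn1 => <-.
by apply: eq_card => x; rewrite !inE.
Qed.

Lemma card_fixed_nonzero : #|[set s | (s != 0) && (bar s == s)]| = (t - 1)%N.
Proof.
rewrite -card_fixed (cardsD1 0 [set s | bar s == s]) inE bar0 eqxx add1n subn1 /=.
by apply: eq_card => x; rewrite !inE.
Qed.

(** The same extremal count on nonzero elements: t - 1 of them are fixed, a fibre lies among the
    roots of X^(t+1) - y, and t^2 - 1 is (t + 1)(t - 1). *)
Lemma card_norm c : c != 0 -> bar c = c -> #|[set s | s * bar s == c]| = t.+1.
Proof.
move=> c0 hc.
have := @card_fibre_extremal F F [set s | s != 0] [set s | (s != 0) && (bar s == s)]
  (fun s => s * bar s) t.+1 (t - 1).
case=> //.
- rewrite card_nonzero; have := t_gt0; nia.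
- by rewrite card_fixed_nonzero.
- by move=> x; rewrite !inE mulf_eq0 negb_or bar_eq0 => ->; rewrite !barE mulrC /=.
- move=> y _; have sz : size ('X^(t.+1) - y%:P : {poly F}) = t.+2.
    rewrite size_polyDl ?size_polyXn // size_polyN.
    by rewrite (leq_ltn_trans (size_polyC_leq1 _)).
  rewrite -ltnS -sz; apply: card_roots_le; first by rewrite -size_poly_gt0 sz.
  by move=> x; rewrite !inE !(hornerD, hornerN, hornerXn, hornerX, hornerC) /bar exprS =>
    /andP[_ /eqP<-]; rewrite subrr.
move=> _ h; rewrite -(h c) ?inE ?hc ?c0 //=.
apply: eq_card => x; rewrite !inE; case: eqP => [e|]; last by rewrite andbF.
by rewrite andbT; apply/esym; apply: contraNneq c0 => x0; rewrite -e x0 mul0r.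
Qed.

Lemma two_norm_m1 : exists x y : F, [/\ x * bar x = -1, y * bar y = -1 & x != y].
Proof.
have h : #|[set s : F | s * bar s == -1]| = t.+1.
  by apply: card_norm; rewrite ?oppr_eq0 ?oner_eq0 // !barE.
have : (1 < #|[set s : F | (s * bar s == -1)%R]|)%N by rewrite h ltnS t_gt0.
case/card_gt1P => x [y [hx hy ne]]; exists x, y.
by move: hx hy; rewrite !inE => /eqP-> /eqP->.
Qed.

Lemma card_lin2 (a b : F) : (a, b) != (0, 0) ->
  #|[set x : F * F | (x != (0, 0)) && (x.1 * a + x.2 * b == 0)]| = (t ^ 2 - 1)%N.
Proof.
rewrite xpair_eqE => ab; rewrite -card_nonzero.
apply/esym/(card_bij (f := fun s => (s * b, - (s * a)))
  (g := fun x => if b == 0 then - x.2 / a else x.1 / b)).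
  move=> s; rewrite !inE /= !xpair_eqE oppr_eq0 !mulf_eq0 => s0.
  rewrite (negbTE s0) /= [(b == 0) && _]andbC ab; split; first by rewrite /=; apply/eqP; ring.
  case: (eqVneq b 0) => [b0|b0]; last by rewrite mulfK.
  by move: ab; rewrite b0 eqxx andbT => a0; rewrite opprK mulfK.
case=> x y; rewrite !inE !xpair_eqE /= => /andP[xy /eqP e].
case: (eqVneq b 0) => [b0|b0].
  move: ab e; rewrite b0 eqxx andbT mulr0 addr0 => a0 /eqP.
  rewrite mulf_eq0 (negbTE a0) orbF => /eqP x0; move: xy; rewrite x0 eqxx /= => y0.
  rewrite mulf_eq0 oppr_eq0 invr_eq0 negb_or y0 a0; split=> //.
  by rewrite mulr0 divfK // opprK.
have ey : y = - (x / b * a).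
  apply: (mulIf b0); rewrite -[RHS](addKr (x * a)) -[X in _ = _ + X]addr0 -e.
  by field.
rewrite divfK // -ey; split=> //.
rewrite mulf_eq0 invr_eq0 (negbTE b0) orbF.
by apply: contraNneq xy => x0; rewrite ey x0 !mul0r oppr0 eqxx.
Qed.

Lemma card_pairs_nonzero :
  #|[set x : F * F | x != (0, 0)]| = (t ^ 4 - 1)%N.
Proof.
have := cardC1 (0 : F, 0 : F); rewrite card_prod card_F -expnD -subn1 => <-.
by apply: eq_card => x; rewrite !inE.
Qed.

(** * The hermitian form *)

Definition h (x y : V) : F := \sum_(i < 4) x 0 i * bar (y 0 i).

Lemma hDl x y z : h (x + y) z = h x z + h y z.
Proof. by rewrite -big_split; apply: eq_bigr => i _; rewrite mxE mulrDl. Qed.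
Lemma hZl a x z : h (a *: x) z = a * h x z.
Proof. by rewrite mulr_sumr; apply: eq_bigr => i _; rewrite mxE mulrA. Qed.
Lemma hC x y : bar (h x y) = h y x.
Proof.
rewrite /h (big_morph bar barD bar0); apply: eq_bigr => i _.
by rewrite !barE mulrC.
Qed.
Lemma hDr x y z : h z (x + y) = h z x + h z y.
Proof. by rewrite -hC hDl barD !hC. Qed.
Lemma hZr a x z : h z (a *: x) = bar a * h z x.
Proof. by rewrite -hC hZl barM hC. Qed.
Lemma hNl x z : h (- x) z = - h x z.
Proof. by rewrite -scaleN1r hZl mulN1r. Qed.
Lemma hNr x z : h z (- x) = - h z x.
Proof. by rewrite -hC hNl barN hC. Qed.
Lemma h0l z : h 0 z = 0. Proof. by rewrite -(scale0r 0) hZl mul0r. Qed.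
Lemma h0r z : h z 0 = 0. Proof. by rewrite -hC h0l bar0. Qed.
Definition hE := (hDl, hDr, hZl, hZr, hNl, hNr, h0l, h0r).

Lemma h_sym0 x y : (h x y == 0) = (h y x == 0).
Proof. by rewrite -hC bar_eq0. Qed.

Lemma h_sym x y c : h x y = c -> h y x = bar c.
Proof. by move<-; rewrite hC. Qed.

Lemma h_nondeg x : (forall y, h y x = 0) -> x = 0.
Proof.
move=> hx; apply/rowP => i; rewrite mxE; apply/eqP; rewrite -bar_eq0.
rewrite -(hx (delta_mx 0 i)) /h (bigD1 i) //= big1 ?addr0.
  by rewrite mxE !eqxx mul1r.
by move=> j ji; rewrite mxE eqxx (negbTE ji) mul0r.
Qed.

Lemma h_dual x : x != 0 -> exists y, h y x = 1.
Proof.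
move=> x0; case: (pickP (fun y => h y x != 0)) => [y hy|no].
  by exists ((h y x)^-1 *: y); rewrite hZl mulVf.
by case/eqP: x0; apply: h_nondeg => y; apply/eqP; rewrite -[_ == _]negbK no.
Qed.

(** With h w x = 1, every z is a vector of x^perp plus a multiple of w. So y - a x is orthogonal to
    everything once it is orthogonal to w, which fixes a. *)
Lemma perp_sub x y : x != 0 -> (forall z, h z x = 0 -> h z y = 0) ->
  exists a, y = a *: x.
Proof.
move=> /h_dual [w hw] H; exists (bar (h w y)).
apply/eqP; rewrite -subr_eq0; apply/eqP/h_nondeg => z.
rewrite !hE barK; have := H (z - h z x *: w).
rewrite !hE hw mulr1 subrr => /(_ erefl)/eqP; rewrite subr_eq0 => /eqP ->.
by rewrite mulrC subrr.
Qed.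

(** * Independent vectors and hyperbolic bases *)

Definition indep (x y : V) := (x != 0) && [forall a, y != a *: x].

Lemma indepP x y : reflect (forall a b, a *: x + b *: y = 0 -> a = 0 /\ b = 0)
  (indep x y).
Proof.
apply: (iffP andP) => [[x0 /forallP H] a b e|H].
  case: (eqVneq b 0) => [b0|b0].
    move: e; rewrite b0 scale0r addr0 => /eqP; rewrite scaler_eq0 (negbTE x0) orbF.
    by move/eqP.
  case/eqP: (H (- (b^-1 * a))); apply: (scalerI b0).
  rewrite scalerA mulrN mulrA mulfV // mul1r scaleNr.
  by apply/eqP; rewrite -addr_eq0 addrC e.
split.
  apply/eqP => x0; have [] := H 1 0; first by rewrite x0 scaler0 scale0r addr0.
  by move/eqP; rewrite oner_eq0.
apply/forallP => a; apply/eqP => e; have [] := H a (-1).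
  by rewrite e scaleN1r subrr.
by move=> _ /eqP; rewrite oppr_eq0 oner_eq0.
Qed.

Lemma indepC x y : indep x y = indep y x.
Proof.
by apply/indepP/indepP => H a b e; have [] := H b a; rewrite 1?addrC.
Qed.

Lemma indep_neq0l x y : indep x y -> x != 0. Proof. by case/andP. Qed.
Lemma indep_neq0r x y : indep x y -> y != 0. Proof. by rewrite indepC => /andP[]. Qed.

Lemma indepN x y : x != 0 -> ~~ indep x y -> exists a, y = a *: x.
Proof.
by rewrite /indep => -> /= /forallPn[a]; rewrite negbK => /eqP; exists a.
Qed.

(** Otherwise y^perp lies in x^perp, and [perp_sub] makes x a multiple of y. *)
Lemma indep_dual x y : indep x y -> exists z, h z x = 1 /\ h z y = 0.
Proof.
move=> xy; case: (pickP (fun z => (h z y == 0) && (h z x != 0))) => [z|no].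
  case/andP => /eqP zy zx; exists ((h z x)^-1 *: z).
  by rewrite !hE mulVf // zy mulr0.
have [a e] : exists a, x = a *: y.
  apply: perp_sub; first exact: indep_neq0r xy.
  move=> z zy; apply/eqP; have := no z; rewrite zy eqxx /=.
  by move/negbFE.
by move: xy; rewrite indepC => /andP[_ /forallP/(_ a)]; rewrite e eqxx.
Qed.

(* a hyperbolic basis: (e1, e3) and (e2, e4) are orthogonal hyperbolic pairs *)
Definition hyp (e1 e2 e3 e4 : V) := [&& h e1 e1 == 0, h e2 e2 == 0, h e3 e3 == 0,
  h e4 e4 == 0, h e1 e2 == 0, h e1 e3 == 1, h e1 e4 == 0, h e2 e3 == 0, h e2 e4 == 1
  & h e3 e4 == 0].

Lemma hypE e1 e2 e3 e4 : hyp e1 e2 e3 e4 ->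
  (h e1 e1 = 0) * (h e1 e2 = 0) * (h e1 e3 = 1) * (h e1 e4 = 0) *
  (h e2 e1 = 0) * (h e2 e2 = 0) * (h e2 e3 = 0) * (h e2 e4 = 1) *
  (h e3 e1 = 1) * (h e3 e2 = 0) * (h e3 e3 = 0) * (h e3 e4 = 0) *
  (h e4 e1 = 0) * (h e4 e2 = 1) * (h e4 e3 = 0) * (h e4 e4 = 0).
Proof.
case/and5P=> /eqP E1 /eqP E2 /eqP E3 /eqP E4.
case/and5P=> /eqP E5 /eqP E6 /eqP E7 /eqP E8 /andP[/eqP E9 /eqP E10].
rewrite -[h e2 e1]hC -[h e3 e1]hC -[h e3 e2]hC -[h e4 e1]hC.
by rewrite -[h e4 e2]hC -[h e4 e3]hC E1 E2 E3 E4 E5 E6 E7 E8 E9 E10 bar0 bar1.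
Qed.

(** The coefficient at a basis vector is the product with its hyperbolic partner. This makes the map
    from F^4 to V injective, and equality of cardinalities makes it onto. *)
Lemma hyp_coord e1 e2 e3 e4 x : hyp e1 e2 e3 e4 ->
  x = h x e3 *: e1 + h x e4 *: e2 + h x e1 *: e3 + h x e2 *: e4.
Proof.
move=> /hypE H.
pose f (p : F * F * F * F) := p.1.1.1 *: e1 + p.1.1.2 *: e2 + p.1.2 *: e3 + p.2 *: e4.
have f_inj : injective f.
  move=> [[[a b] c] d] [[[a' b'] c'] d'] e.
  have := (f_equal (h^~ e3) e, f_equal (h^~ e4) e, f_equal (h^~ e1) e, f_equal (h^~ e2) e).
  rewrite /f /= !hE !H.
  by rewrite !(mulr0, mulr1, addr0, add0r) => -[[[-> ->] ->] ->].
have /codomP [[[[a b] c] d] ->] : x \in codom f.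
  apply: inj_card_onto => //.
  by rewrite !card_prod card_mx card_F; rewrite -!expnD -!expnM.
rewrite /f /= !hE !H.
by rewrite !(mulr0, mulr1, addr0, add0r).
Qed.

(** An ordered basis of a line contained in X; lines are counted through these pairs. *)
Definition isopair x y := [&& h x x == 0, h y y == 0, h x y == 0 & indep x y].

Lemma hyp_swap e1 e2 e3 e4 : hyp e1 e2 e3 e4 -> hyp e3 e4 e1 e2.
Proof. by move=> /hypE H; rewrite /hyp !H !eqxx. Qed.

Lemma hyp_isopair e1 e2 e3 e4 : hyp e1 e2 e3 e4 -> isopair e1 e2.
Proof.
move=> /hypE H; rewrite /isopair !H !eqxx /=; apply/indepP => a b e.
move: (f_equal (h^~ e3) e) (f_equal (h^~ e4) e).
by rewrite !hE !H !(mulr0, mulr1, addr0, add0r) => -> ->.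
Qed.

(** Nondegeneracy gives vectors dual to e1 and e2. Adding a multiple of e1 to the first, and
    multiples of e1 and e2 to the second, makes them isotropic and mutually orthogonal: a
    self-product is fixed by [bar], hence cancelled by a suitable trace. *)
Lemma isopair_extend e1 e2 : isopair e1 e2 -> exists e3 e4, hyp e1 e2 e3 e4.
Proof.
case/and4P => /eqP h11 /eqP h22 /eqP h12 ind.
have h21 : h e2 e1 = 0 by rewrite -hC h12 bar0.
have [y3 [h31 h32]] := indep_dual ind.
have [y4 [h42 h41]] : exists z, h z e2 = 1 /\ h z e1 = 0.
  by apply: indep_dual; rewrite indepC.
have [|s hs] := @trace_surj (- h y3 y3); first by rewrite barN hC.
have [e3 e3E] : exists e, e = y3 + s *: e1 by eexists.
have h13' := h_sym h31; have h23' := h_sym h32.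
have h24' := h_sym h42; have h14' := h_sym h41.
have h33 : h e3 e3 = 0.
  rewrite e3E !hE h31 h13' h11 bar1.
  by rewrite !(mulr0, mulr1, addr0, add0r) -addrA [bar s + s]addrC hs subrr.
have h13 : h e1 e3 = 1 by rewrite e3E !hE h13' h11 bar1 mulr0 addr0.
have h23 : h e2 e3 = 0 by rewrite e3E !hE h23' h21 bar0 mulr0 addr0.
have [z4 z4E] : exists z, z = y4 - h y4 e3 *: e1 by eexists.
have z43 : h z4 e3 = 0 by rewrite z4E !hE h13 mulr1 subrr.
have z41 : h z4 e1 = 0 by rewrite z4E !hE h41 h11 mulr0 subr0.
have z42 : h z4 e2 = 1 by rewrite z4E !hE h42 h12 mulr0 subr0.
have [|s' hs'] := @trace_surj (- h z4 z4); first by rewrite barN hC.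
exists e3, (z4 + s' *: e2).
have z14 := h_sym z41; have z24 := h_sym z42; have z34 := h_sym z43.
have h32' := h_sym h23; have h31' := h_sym h13.
rewrite /hyp !hE h11 h22 h12 h13 h23 h33 z14 z24 z34 z42 h32' !bar0 !bar1.
rewrite !(mulr0, mulr1, addr0, add0r) !eqxx /= !andbT.
by rewrite -addrA [bar s' + s']addrC hs' subrr.
Qed.

Lemma hyp_exists : exists e1 e2 e3 e4, hyp e1 e2 e3 e4.
Proof.
have [x [y [hx hy ne]]] := two_norm_m1.
have [e1 [e2 ip]] : exists e1 e2, isopair e1 e2; last first.
  by have [e3 [e4]] := isopair_extend ip; exists e1, e2, e3, e4.
pose mk (a b c d : F) : V := \row_i (nth 0 [:: a; b; c; d] i).
(* Isotropic because 1 + x bar x = 0, orthogonal because the supports are disjoint. *)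
exists (mk 1 x 0 0), (mk 0 0 1 x).
have H a b c d a' b' c' d' : h (mk a b c d) (mk a' b' c' d') =
    a * bar a' + b * bar b' + c * bar c' + d * bar d'.
  by rewrite /h !big_ord_recl big_ord0 !mxE /= addr0 !addrA.
rewrite /isopair !H !hx bar0 bar1.
rewrite !(mulr0, mul0r, mulr1, addr0, add0r, subrr) !eqxx /=.
apply/indepP => a b /rowP e; have := e (inord 2); have := e (inord 0).
by rewrite !mxE !inordK //= !(mulr0, mulr1, addr0, add0r) => -> ->.
Qed.

(** Any line of X meets p^perp. If it does so in a point x other than p, then p and x span a line of
    X; otherwise p lies on the chosen line, and one of its basis vectors is independent of p. *)
Lemma isotropic_extend p : p != 0 -> h p p = 0 -> exists y, isopair p y.
Proof.
move=> p0 hp; have [e1 [e2 [e3 [e4 /hyp_isopair]]]] := hyp_exists.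
case/and4P => /eqP h11 /eqP h22 /eqP h12 ind.
have h21 : h e2 e1 = 0 by rewrite -hC h12 bar0.
have iso2 a b : h (a *: e1 + b *: e2) (a *: e1 + b *: e2) = 0.
  by rewrite !hE h11 h22 h12 h21 !(mulr0, addr0).
case: (boolP (indep p e1 || indep p e2)) => [/orP|].
  have [a [b [ab e]]] : exists a b : F, (a, b) != (0, 0) /\ a * h e1 p + b * h e2 p = 0.
    case: (eqVneq (h e1 p) 0) => [e|ne].
      exists 1, 0; rewrite e mulr0 mul0r addr0; split=> //.
      by rewrite xpair_eqE oner_eq0.
    exists (h e2 p), (- h e1 p); split; last by ring.
    by rewrite xpair_eqE oppr_eq0 (negbTE ne) andbF.
  pose x := a *: e1 + b *: e2.
  have x0 : x != 0.
    apply: contra ab => /eqP /(elimT (indepP _ _) ind)[-> ->]; exact: eqxx.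
  have xp : h x p = 0 by rewrite /x !hE.
  case: (boolP (indep x p)) => [ixp _|nind].
    by exists x; rewrite /isopair hp iso2 -hC xp bar0 !eqxx indepC.
  have [c pE] := indepN x0 nind.
  have ep i : i = e1 \/ i = e2 -> h p i = 0.
    by rewrite pE /x !hE; case=> ->; rewrite ?h11 ?h12 ?h22 ?h21 !(mulr0, addr0).
  case=> ind'; [exists e1 | exists e2].
    by rewrite /isopair hp h11 (ep e1) ?eqxx //; left.
  by rewrite /isopair hp h22 (ep e2) ?eqxx //; right.
rewrite negb_or => /andP[/(indepN p0)[a ea] /(indepN p0)[b eb]].
have [|_ /eqP] := elimT (indepP _ _) ind b (- a).
  by rewrite ea eb !scalerA mulNr mulrC scaleNr subrr.
rewrite oppr_eq0 => /eqP a0.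
by move: (indep_neq0l ind); rewrite ea a0 scale0r eqxx.
Qed.

(** * Numbers of isotropic vectors, isotropic pairs and hyperbolic bases *)

Lemma card_trace_scaled a c : a != 0 -> bar c = c ->
  #|[set x | x * a + bar (x * a) == c]| = t.
Proof.
move=> a0 hc; apply: etrans (card_trace hc).
apply: (card_bij (f := fun x => x * a) (g := fun x => x / a)) => x; rewrite !inE.
  by move=> H; rewrite mulfK.
by move=> H; rewrite divfK.
Qed.

(** The nonzero isotropic vectors of a hyperbolic plane, in coordinates: t + 1 points. First
    coordinate 0 leaves t^2 - 1 vectors; every other value leaves the t solutions of a trace
    equation. *)
Lemma card_trace_pairs :
  #|[set x : F * F | (x != (0, 0)) && (x.1 * bar x.2 + x.2 * bar x.1 == 0)]| =
  (t.+1 * (t ^ 2 - 1))%N.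
Proof.
pose Q (x y : F) := ((x, y) != (0, 0)) && (x * bar y + y * bar x == 0).
rewrite [LHS](_ : _ = #|[set x | predT x.1 && Q x.1 x.2]|); last first.
  by apply: eq_card => -[x y]; rewrite !inE.
rewrite (card_pair_sum predT Q) (bigD1 0) //= (eq_bigr (fun=> t)) => [|x /= x0]; last first.
  apply: (etrans _ (@card_trace_scaled (bar x) 0 _ _)); rewrite ?bar_eq0 ?bar0 //.
  apply: eq_card => y; rewrite !inE /Q xpair_eqE (negbTE x0) /=.
  by rewrite barM barK addrC [bar y * _]mulrC.
rewrite sum_nat_cond_const.
have -> : #|[set i : F | i != 0]| = (t ^ 2 - 1)%N by exact: card_nonzero.
rewrite mulSn [(t * _)%N]mulnC; congr (_ + _)%N.
rewrite -(card_nonzero); apply: eq_card => y.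
by rewrite !inE /Q xpair_eqE eqxx /= bar0 mul0r mulr0 addr0 eqxx andbT.
Qed.

(** In p^perp the coordinate along p is free, and those along e2 and e4 form a nonzero isotropic
    vector of a hyperbolic plane. Up to scalars the latter has t + 1 choices, the lines of X through
    p. *)
Lemma card_isopair_l p : p != 0 -> h p p = 0 ->
  #|[set y | isopair p y]| = (t.+1 * (t ^ 4 - t ^ 2))%N.
Proof.
move=> p0 hp; have [e2 ip] := isotropic_extend p0 hp.
have [e3 [e4 hy]] := isopair_extend ip; have H := hypE hy.
have -> : (t.+1 * (t ^ 4 - t ^ 2) =
  #|[set: F]| * (t.+1 * (t ^ 2 - 1)))%N.
  by rewrite cardsT card_F mulnCA; congr (_ * _)%N; rewrite mulnBr muln1 -expnD.
rewrite -card_trace_pairs -cardsX.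
apply: (card_bij (f := fun y => (h y e3, (h y e4, h y e2)))
  (g := fun x => x.1 *: p + x.2.1 *: e2 + x.2.2 *: e4)).
  move=> y; rewrite !inE /= => /and4P[_ /eqP hyy /eqP hyp /indepP ind].
  have hyp' := h_sym hyp; rewrite bar0 in hyp'.
  have e := hyp_coord y hy; rewrite hyp' scale0r addr0 in e.
  split=> //; move: hyy; rewrite {1 2}e !hE !H.
  rewrite !(mulr0, mulr1, addr0, add0r) => ->.
  rewrite eqxx andbT; apply/eqP => -[e4' e2'].
  have [|_ /eqP] := ind (- h y e3) 1.
    by rewrite {2}e e4' e2' !scale0r !addr0 scale1r scaleNr addNr.
  by rewrite oner_eq0.
case=> a [b c]; rewrite !inE /= => /andP[ne /eqP e].
rewrite /isopair !hE !H !(mulr0, mulr1, addr0, add0r) eqxx /=.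
split=> //; rewrite e eqxx /=.
apply/indepP => k l E; have := (f_equal (h^~ e3) E, f_equal (h^~ e4) E, f_equal (h^~ e2) E).
rewrite !hE !H !(mulr0, mulr1, addr0, add0r) => -[[E1 /eqP E2] /eqP E3].
suff l0 : l = 0 by move: E1; rewrite l0 mul0r addr0.
apply/eqP; move: ne E2 E3; rewrite xpair_eqE !mulf_eq0.
by case: (l == 0) => //= /negbTE ne eb ec; move: ne; rewrite eb ec.
Qed.

(** In hyperbolic coordinates isotropy says that a bar c + b bar d has trace 0. All pairs (a, b)
    satisfy this when c = d = 0, and t^3 of them otherwise. *)
Lemma card_isotropic :
  #|[set z : V | (z != 0) && (h z z == 0)]| = ((t ^ 4 - 1) * (t ^ 3 + 1))%N.
Proof.
have [e1 [e2 [e3 [e4 hy]]]] := hyp_exists; have H := hypE hy.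
pose Q (x y : F * F) := y.1 * bar x.1 + y.2 * bar x.2 + bar (y.1 * bar x.1 + y.2 * bar x.2)
  == 0.
have : #|[set z : V | h z z == 0]| = (t ^ 4 + (t ^ 4 - 1) * t ^ 3)%N.
  transitivity #|[set x : (F * F) * (F * F) | predT x.1 && Q x.1 x.2]|.
    apply: (card_bij (f := fun z => ((h z e1, h z e2), (h z e3, h z e4)))
      (g := fun x => x.2.1 *: e1 + x.2.2 *: e2 + x.1.1 *: e3 + x.1.2 *: e4)).
      move=> z; rewrite !inE /= -(hyp_coord z hy) => /eqP e; split=> //.
      move: e; rewrite {1 2}(hyp_coord z hy) !hE !H /Q /=.
      rewrite !(mulr0, mulr1, addr0, add0r) !barE => <-; apply/eqP; ring.
    move=> [[c d] [a b]]; rewrite !inE /Q /= => /eqP e.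
    rewrite !hE !H !(mulr0, mulr1, addr0, add0r); split=> //.
    by move: e; rewrite !barE => <-; apply/eqP; ring.
  rewrite (card_pair_sum predT Q) (bigD1 (0, 0)) //= (eq_bigr (fun=> (t ^ 3)%N)).
    rewrite sum_nat_cond_const; congr (_ + _ * _)%N; last exact: (card_pairs_nonzero).
    rewrite -[RHS](_ : #|[set: F * F]| = _).
      by apply: eq_card => y; rewrite !inE /Q /= bar0 !mulr0 addr0 bar0 addr0 eqxx.
    by rewrite cardsT card_prod card_F -expnD.
  have key (u v w : F) : u != 0 -> v + bar v = w ->
      #|[set x | x * u + v + bar (x * u + v) == 0]| = t.
    move=> u0 e; apply: (etrans _ (@card_trace_scaled u (- w) _ _)) => //.
      apply: eq_card => x; rewrite !inE -[RHS]subr_eq0 opprK -e !barE; congr (_ == 0); ring.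
    by rewrite -e !barE addrC.
  case=> a b; rewrite xpair_eqE => ab.
  case: (eqVneq a 0) ab => [->|a0] /= => [b0|_].
    pose R (_ z : F) := z * bar b + bar (z * bar b) == 0.
    rewrite [LHS](_ : _ = #|[set y | predT y.1 && R y.1 y.2]|); last first.
      by apply: eq_card => y; rewrite !inE /Q /= bar0 mulr0 add0r.
    rewrite (card_pair_const (P := predT) (Q := R) (n := t)) => [|x _].
      by rewrite -[X in (X * _)%N](_ : #|F| = _) ?cardsE // card_F -expnSr.
    by rewrite card_trace_scaled ?bar_eq0 ?bar0.
  pose R (y z : F) := z * bar a + y * bar b + bar (z * bar a + y * bar b) == 0.
  transitivity #|[set y | predT y.1 && R y.1 y.2]|.
    by apply: (card_bij (f := fun y => (y.2, y.1)) (g := fun y => (y.2, y.1)));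
     case=> x y; rewrite !inE.
  rewrite (card_pair_const (P := predT) (Q := R) (n := t)) => [|x _].
    by rewrite -[X in (X * _)%N](_ : #|F| = _) ?cardsE // card_F -expnSr.
  by rewrite (key _ _ (x * bar b + bar (x * bar b))) ?bar_eq0.
rewrite (cardsD1 0) inE h0l eqxx /= => e.
have -> : [set z : V | (z != 0) && (h z z == 0)] = [set z | h z z == 0] :\ 0.
  by apply/setP => z; rewrite !inE.
have := t_gt0 => t0; have : (1 <= t ^ 4)%N by rewrite expn_gt0 t0.
move: e; rewrite add1n; move: #|_| => n e; nia.
Qed.

(** Relative to one completion (e3, e4), the others are e3 + a e1 - bar c e2 and e4 + c e1 + d e2
    with c arbitrary and a, d of trace 0. *)
Lemma card_hyp_completions e1 e2 : isopair e1 e2 ->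
  #|[set y : V * V | hyp e1 e2 y.1 y.2]| = (t ^ 4)%N.
Proof.
move=> ip; have [e3 [e4 hy]] := isopair_extend ip; have H := hypE hy.
have tr0 : #|[set s : F | s + bar s == 0]| = t by exact: (card_trace bar0).
have -> : (t ^ 4 = #|[set: F]| * (t * t))%N by rewrite cardsT card_F mulnn -expnD.
rewrite -[X in (_ * X)%N](f_equal2 muln tr0 tr0) -!cardsX.
apply: (card_bij
  (f := fun y => (h y.2 e3, (h y.1 e3, h y.2 e4)))
  (g := fun x => (e3 + x.2.1 *: e1 - bar x.1 *: e2, e4 + x.1 *: e1 + x.2.2 *: e2))).
  move=> [y3 y4]; rewrite !inE /= => hy'; have H' := hypE hy'.
  have E3 := hyp_coord y3 hy; have E4 := hyp_coord y4 hy.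
  rewrite !H' !(scale0r, scale1r, addr0) in E3 E4.
  have e : h y3 e4 = - bar (h y4 e3).
    have : h y3 y4 = 0 by rewrite H'.
    rewrite {1}E3 E4 !hE !H ?H' !(mulr0, mulr1, addr0, add0r).
    by move/eqP; rewrite addr_eq0 => /eqP.
  split; last first.
    congr (_, _); first by rewrite [RHS]E3 e scaleNr -addrA addrC.
    by rewrite [RHS]E4 -addrA addrC.
  apply/andP; split.
    have : h y3 y3 = 0 by rewrite H'.
    by rewrite {1 2}E3 !hE !H ?H' !(mulr0, mulr1, addr0, add0r) => ->.
  have : h y4 y4 = 0 by rewrite H'.
  by rewrite {1 2}E4 !hE !H ?H' !(mulr0, mulr1, addr0, add0r) => ->.
move=> [c [a d]]; rewrite !inE /= => /andP[/eqP ea /eqP ed].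
rewrite /hyp !hE !H !barE !(mulr0, mul0r, mulr1, mul1r, addr0, add0r, subr0, oppr0).
rewrite !eqxx; split=> //=.
by rewrite [bar a + _]addrC ea [bar d + _]addrC ed subrr !eqxx.
Qed.

(** * Forms without isotropic lines *)

Definition isozeros (f : V -> F) := [set z : V | [&& z != 0, h z z == 0 & f z == 0]].

(** The three equations say that f vanishes on the whole span of x and y. *)
Definition noline (f : V -> F) := forall x y,
  isopair x y -> f x = 0 -> f y = 0 -> pol f x y = 0 -> False.

Lemma isopairC x y : isopair x y = isopair y x.
Proof.
rewrite /isopair indepC; case: (h x x == 0); rewrite ?andbF //=.
by rewrite -[h y x]hC bar_eq0.
Qed.

Lemma isopair_shear x y b : isopair x y -> isopair (x + b *: y) y.
Proof.
case/and4P=> /eqP hx /eqP hy /eqP hxy /indepP ind.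
have hyx : h y x = 0 by rewrite -hC hxy bar0.
rewrite /isopair !hE hx hy hxy hyx !(mulr0, addr0) eqxx /=.
apply/indepP => k l e; have [|k0 e'] := ind k (k * b + l).
  by rewrite scalerDl addrA -scalerA -scalerDr.
by split=> //; move: e'; rewrite k0 mul0r add0r.
Qed.

(** On the span of x and y, f is a binary quadratic form with affine coordinate b and point at
    infinity y. A zero at y lowers the degree in b, so there are at most two zeros in all. *)
Lemma card_binary_roots (f : V -> F) x y : quad f ->
  ~ [/\ f x = 0, f y = 0 & pol f x y = 0] ->
  (#|[set b : F | f (x + b *: y)%R == 0%R]| + (f y == 0%R) <= 2)%N.
Proof.
move=> qf no.
pose p : {poly F} := (f x)%:P + pol f x y *: 'X + f y *: 'X^2.
have pE b : p.[b] = f (x + b *: y).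
  rewrite /p !(hornerD, hornerC, hornerZ, hornerX, hornerXn) !(quadE qf).
  by rewrite [b ^+ 2 * _]mulrC; ring.
have p0 : p != 0.
  apply/eqP => e; case: no; split.
  - by have := coef0 F 0; rewrite -e /p !coefD coefC !coefZ coefX coefXn /= !mulr0 !addr0.
  - by have := coef0 F 2; rewrite -e /p !coefD coefC !coefZ coefX coefXn /= !(mulr0, mulr1,
    add0r).
  by have := coef0 F 1; rewrite -e /p !coefD coefC !coefZ coefX coefXn /= !(mulr0, mulr1,
    add0r, addr0).
have lt : (#|[set b : F | f (x + b *: y)%R == 0%R]| < size p)%N.
  by apply: card_roots_le => // b; rewrite inE pE => /eqP.
have s2 : (size ((f x)%:P + pol f x y *: 'X)%R <= 2)%N.
  rewrite (leq_trans (size_polyD _ _)) // geq_max.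
  by rewrite (leq_trans (size_polyC_leq1 _)) //= (leq_trans (size_scale_leq _ _)) ?size_polyX.
case: eqP => fy.
  have : (size p <= 2)%N by rewrite /p fy scale0r addr0.
  by move=> /= s; have := leq_trans lt s; rewrite ltnS addn1.
rewrite addn0 -ltnS (leq_trans lt) // (leq_trans (size_polyD _ _)) // geq_max.
by rewrite (leq_trans s2) //= (leq_trans (size_scale_leq _ _)) ?size_polyXn.
Qed.

Lemma card_isopairs : #|[set p : V * V | isopair p.1 p.2]| =
  ((t ^ 4 - 1) * (t ^ 3 + 1) * (t.+1 * (t ^ 4 - t ^ 2)))%N.
Proof.
rewrite -(card_isotropic) -(card_pair_const (Q := isopair)).
  apply: eq_card => -[x y]; rewrite !inE /=; apply/idP/andP => [ip|[]] //.
  by case/and4P: (ip) => -> _ _ /indep_neq0l ->.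
by move=> x /andP[x0 /eqP hx]; apply: card_isopair_l.
Qed.

Lemma card_isopairs_zero (f : V -> F) :
  #|[set p : V * V | isopair p.1 p.2 && (f p.1 == 0%R)]| =
  (#|isozeros f| * (t.+1 * (t ^ 4 - t ^ 2)))%N.
Proof.
rewrite -(card_pair_const (Q := isopair)).
  apply: eq_card => -[x y]; rewrite !inE /=.
  apply/andP/andP => [[ip /eqP fx]|[/and3P[_ _ ->] ->]] //.
  by case/and4P: (ip) => -> _ _ /indep_neq0l ->; rewrite fx eqxx.
by move=> x /and3P[x0 /eqP hx _]; apply: card_isopair_l.
Qed.

(* Double counting over isotropic lines: each meets V(f) in at most two points. *)
Lemma noline_bound (f : V -> F) : quad f -> noline f ->
  (#|isozeros f| <= 2 * (t ^ 2 - 1) * (t ^ 3 + 1))%N.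
Proof.
move=> qf no; set c := (t.+1 * (t ^ 4 - t ^ 2))%N.
set W := [set p : V * V | isopair p.1 p.2].
have A_E := card_isopairs_zero f; rewrite -/c in A_E.
set A := #|_| in A_E.
have t1 := t_gt1.
(* The pair (x + b y, y) spans the same line, so this substitution permutes the isotropic pairs.
   Together with [swap], all t^2 + 1 positions on a line contribute the same number [A]. *)
have shear b : #|[set p in W | f (p.1 + b *: p.2) == 0]| = A.
  apply: (card_bij (f := fun p => (p.1 + b *: p.2, p.2)) (g := fun p => (p.1 - b *: p.2,
    p.2))).
    move=> [x y]; rewrite !inE /= => /andP[ip ->]; rewrite isopair_shear //.
    by rewrite addrK.
  move=> [x y]; rewrite !inE /= subrK => /andP[ip ->].
  by rewrite -scaleNr isopair_shear.
have swap : #|[set p in W | f p.2 == 0]| = A.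
  by apply: (card_bij (f := fun p => (p.2, p.1)) (g := fun p => (p.2, p.1)));
    case=> x y; rewrite !inE /= isopairC.
have : (\sum_(p in W) (#|[set b : F | f (p.1 + b *: p.2)%R == 0%R]| + (f p.2 == 0%R))
    <= \sum_(p in W) 2)%N.
  apply: leq_sum => -[x y]; rewrite inE /= => ip.
  by apply: card_binary_roots => // -[fx fy fxy]; apply: (no x y).
rewrite sum_nat_const big_split /=.
have -> : (\sum_(p in W) (f p.2 == 0%R) = A)%N.
  by rewrite -swap -sum1dep_card big_mkcondr.
have -> : (\sum_(p in W) #|[set b : F | f (p.1 + b *: p.2)%R == 0%R]| = t ^ 2 * A)%N.
  rewrite (eq_bigr (fun p => \sum_b (f (p.1 + b *: p.2)%R == 0%R)))%N => [|p _].
    rewrite exchange_big /= (eq_bigr (fun=> A)) => [|b _].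
      by rewrite sum_nat_const card_F.
    by rewrite -(shear b) -sum1dep_card big_mkcondr.
  by rewrite -sum1dep_card big_mkcond.
rewrite card_isopairs -/c A_E {A_E}.
have : (0 < c)%N by rewrite /c muln_gt0 /= subn_gt0 ltn_exp2l.
move: c => c; move: #|isozeros f| => n c0.
rewrite -[(t ^ 4)%N]/(t ^ (2 * 2))%N expnM.
have : (1 < t ^ 2)%N by rewrite -[1%N](exp1n 2) ltn_exp2r.
move: (t ^ 2)%N (t ^ 3)%N => q r q1 H.
have {}H : (c * ((q + 1) * n) <= c * ((q + 1) * (2 * (q - 1) * (r + 1))))%N.
  have -> : (c * ((q + 1) * (2 * (q - 1) * (r + 1))) = (q ^ 2 - 1) * (r + 1) * c * 2)%N.
    have -> : (q ^ 2 - 1 = (q + 1) * (q - 1))%N by rewrite -[RHS]mulnC -[1%N in LHS](exp1n 2)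
      subn_sqr.
    by ring.
  by apply: leq_trans H; rewrite leq_eqVlt; apply/orP; left; apply/eqP; ring.
by move: H; rewrite !leq_pmul2l // addn1.
Qed.

(** * Isotropic lines *)

(** The orthogonal complement of the pair. For an isotropic pair it coincides with the span, so
    membership is decided by two equations. *)
Definition line x y : {set V} := [set z | (h z x == 0) && (h z y == 0)].
Definition lines : {set {set V}} := [set line p.1 p.2 | p in [set p | isopair p.1 p.2]].

Lemma lineP x y z : isopair x y ->
  reflect (exists a b, z = a *: x + b *: y) (z \in line x y).
Proof.
move=> ip; rewrite inE; apply: (iffP andP) => [[/eqP zx /eqP zy]|[a [b ->]]].
  have [e3 [e4 hy]] := isopair_extend ip; exists (h z e3), (h z e4).
  by rewrite [LHS](hyp_coord z hy) zx zy !scale0r !addr0.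
case/and4P: ip => /eqP hx /eqP hy /eqP hxy _.
have hyx : h y x = 0 by rewrite -hC hxy bar0.
by rewrite !hE hx hy hxy hyx !mulr0 addr0 eqxx.
Qed.

Lemma line_mem x y a b : isopair x y -> a *: x + b *: y \in line x y.
Proof. by move=> ip; apply/(lineP _ ip); exists a, b. Qed.

Lemma line_l x y : isopair x y -> x \in line x y.
Proof. by move=> ip; apply/(lineP _ ip); exists 1, 0; rewrite scale1r scale0r addr0. Qed.

Lemma line_r x y : isopair x y -> y \in line x y.
Proof. by move=> ip; apply/(lineP _ ip); exists 0, 1; rewrite scale1r scale0r add0r. Qed.

Lemma card_line x y : isopair x y -> #|line x y| = (t ^ 4)%N.
Proof.
move=> ip; have [e3 [e4 hy]] := isopair_extend ip; have H := hypE hy.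
transitivity #|[set: F * F]|; last by rewrite cardsT card_prod card_F -expnD.
apply: (card_bij (f := fun z => (h z e3, h z e4)) (g := fun a => a.1 *: x + a.2 *: y)).
  move=> z /(lineP _ ip)[a [b ->]]; rewrite !hE !H.
  by rewrite !(mulr0, mulr1, addr0, add0r) inE.
move=> [a b] _; rewrite line_mem // !hE !H.
by rewrite !(mulr0, mulr1, addr0, add0r).
Qed.

Lemma mem_lines x y : isopair x y -> line x y \in lines.
Proof. by move=> ip; apply/imsetP; exists (x, y); rewrite ?inE. Qed.

Lemma linesP L : L \in lines -> exists x y, isopair x y /\ L = line x y.
Proof. by case/imsetP => -[x y]; rewrite inE => ip ->; exists x, y. Qed.

Lemma lines_lin L a b x y : L \in lines -> x \in L -> y \in L -> a *: x + b *: y \in L.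
Proof.
case/linesP => u [v [ip ->]]; rewrite !inE => /andP[/eqP x1 /eqP x2] /andP[/eqP y1 /eqP y2].
by rewrite !hE x1 x2 y1 y2 !mulr0 addr0 eqxx.
Qed.

Lemma lines0 L : L \in lines -> 0 \in L.
Proof. by case/linesP => u [v [ip ->]]; rewrite !inE !hE eqxx. Qed.

Lemma linesZ L a x : L \in lines -> x \in L -> a *: x \in L.
Proof. by move=> Ll xL; rewrite -[a *: x]addr0 -(scale0r 0) lines_lin // lines0. Qed.

Lemma lines_perp L x y : L \in lines -> x \in L -> y \in L -> h x y = 0.
Proof.
case/linesP => u [v [ip ->]]; rewrite inE => /andP[/eqP x1 /eqP x2].
by case/(lineP _ ip) => a [b ->]; rewrite !hE x1 x2 !mulr0 addr0.
Qed.

Lemma lines_isopair L x y : L \in lines -> x \in L -> y \in L -> indep x y -> isopair x y.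
Proof. by move=> Ll xL yL ind; rewrite /isopair ind !(lines_perp Ll) // !eqxx. Qed.

Lemma card_lines L : L \in lines -> #|L| = (t ^ 4)%N.
Proof. by case/linesP => x [y [ip ->]]; exact: card_line. Qed.

(** A line of X lies in the orthogonal complement of any two of its vectors, and both sets have t^4
    elements. *)
Lemma lines_eq L x y : L \in lines -> x \in L -> y \in L -> indep x y -> L = line x y.
Proof.
move=> Ll xL yL ind; have ip := lines_isopair Ll xL yL ind.
apply/eqP; rewrite eqEcard card_line // card_lines // leqnn andbT.
by apply/subsetP => z zL; rewrite inE !(lines_perp Ll) // !eqxx.
Qed.

Lemma lines_basis L p : L \in lines -> p \in L -> p != 0 ->
  exists y, [/\ y \in L, isopair p y & L = line p y].
Proof.
move=> Ll pL p0; have [u [v [ip LE]]] := linesP Ll.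
have /(lineP _ ip)[a [b pE]] : p \in line u v by rewrite -LE.
have uL : u \in L by rewrite LE line_l.
have vL : v \in L by rewrite LE line_r.
have [w wL ind] : exists2 w, w \in L & indep p w.
  case/and4P: ip => _ _ _ ind.
  case: (boolP (indep p v)) => [i|/(indepN p0)[c vE]]; first by exists v.
  case: (boolP (indep p u)) => [i|/(indepN p0)[d uE]]; first by exists u.
  have [|_ /eqP] := elimT (indepP _ _) ind c (- d).
    by rewrite uE vE !scalerA mulNr mulrC scaleNr subrr.
  rewrite oppr_eq0 => /eqP d0.
  by move: (indep_neq0l ind); rewrite uE d0 scale0r eqxx.
by exists w; rewrite -(lines_eq Ll pL wL) // (lines_isopair Ll).
Qed.

Lemma lines_meet L M x y : L \in lines -> M \in lines -> L != M ->
  x \in L -> y \in L -> x \in M -> y \in M -> ~~ indep x y.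
Proof.
move=> Ll Ml ne xL yL xM yM; apply: contra ne => ind.
by rewrite (lines_eq Ll xL yL ind) (lines_eq Ml xM yM ind).
Qed.

Definition vanishes (f : V -> F) (L : {set V}) := [forall x in L, f x == 0].

Lemma vanishesP f (L : {set V}) : reflect (forall x, x \in L -> f x = 0) (vanishes f L).
Proof. by apply: (iffP forall_inP) => H x /H /eqP. Qed.

Lemma vanishes_line f x y : quad f -> isopair x y ->
  vanishes f (line x y) <-> [/\ f x = 0, f y = 0 & pol f x y = 0].
Proof.
move=> qf ip; split=> [/vanishesP H|[fx fy fxy]].
  have fx : f x = 0 by rewrite H ?line_l.
  have fy : f y = 0 by rewrite H ?line_r.
  split=> //; rewrite /pol fx fy !subr0; apply: H.
  by apply/(lineP _ ip); exists 1, 1; rewrite !scale1r.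
by apply/vanishesP => z /(lineP _ ip)[a [b ->]]; rewrite !(quadE qf) fx fy fxy !mulr0 !addr0.
Qed.

(** * Zeros in the planes through a line of X *)

Definition perpzeros f (L : {set V}) p := [set z in isozeros f :\: L | h z p == 0].

(** A vector outside L is orthogonal to exactly one point of L, since L^perp = L. So every zero
    outside L occurs in [perpzeros f L p] for exactly t^2 - 1 vectors p. *)
Lemma line_sum f L : L \in lines -> vanishes f L ->
  ((t ^ 2 - 1) * #|isozeros f| =
   (t ^ 2 - 1) * (t ^ 4 - 1) + \sum_(p in L :\ 0%R) #|perpzeros f L p|)%N.
Proof.
move=> Ll /vanishesP fL.
rewrite -(cardsID L (isozeros f)) mulnDr; congr (_ + _)%N.
  rewrite (_ : _ :&: _ = L :\ 0).
    by rewrite -(card_lines Ll) (cardsD1 0 L) (lines0 Ll) [(true + _)%N]addnC addnK.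
  apply/setP => z; rewrite !inE; case zL: (z \in L); rewrite ?andbF //.
  by rewrite (lines_perp Ll zL zL) fL // !eqxx !andbT.
pose Q (p z : V) := h z p == 0.
have [u [v [ip LE]]] := linesP Ll.
transitivity #|[set x | (x.1 \in isozeros f :\: L) && ((x.2 \in L :\ 0) && Q x.2 x.1)]|.
  rewrite (card_pair_const (P := mem (isozeros f :\: L))
    (Q := fun z p => (p \in L :\ 0) && Q p z) (n := (t ^ 2 - 1)%N)); last first.
    move=> z; rewrite !inE => /and4P[zL z0 _ _].
    rewrite -(@card_lin2 (h u z) (h v z)); last first.
      apply: contra zL => /eqP[/eqP e1 /eqP e2]; rewrite LE inE.
      by rewrite h_sym0 e1 h_sym0 e2.
    apply/esym; have [e3 [e4 hy]] := isopair_extend ip; have H := hypE hy.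
    apply: (card_bij (f := fun a => a.1 *: u + a.2 *: v) (g := fun z => (h z e3, h z e4))).
      move=> [a b]; rewrite !inE /Q /= LE line_mem // andbT => /andP[ne /eqP e].
      rewrite h_sym0 !hE e eqxx !H !(mulr0, mulr1, addr0, add0r); split=> //.
      rewrite andbT; apply: contra ne => /eqP.
      by case/and4P: ip => _ _ _ /indepP ind /ind[-> ->].
    move=> p; rewrite !inE /Q /= LE => /andP[/andP[p0 /(lineP _ ip)[a [b pE]]] hzp].
    move: hzp p0; rewrite h_sym0 pE !hE !H !(mulr0, mulr1, addr0, add0r) => -> p0.
    split=> //; rewrite andbT; apply: contra p0 => /eqP[-> ->].
    by rewrite !scale0r addr0.
  by rewrite mulnC; congr (_ * _)%N; apply: eq_card => z; rewrite !inE.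
rewrite (card_pair_swap (P := mem (isozeros f :\: L)) (Q := fun z p => (p \in L :\ 0) && Q p z)
    (P' := mem (L :\ 0)) (Q' := fun p z => (z \in isozeros f :\: L) && Q p z)); last first.
  by move=> x y /=; rewrite andbCA.
rewrite (card_pair_sum (mem (L :\ 0)) (fun p z => (z \in isozeros f :\: L) && Q p z)) /=.
by apply: eq_bigr => p _; apply: eq_card => z; rewrite !inE.
Qed.

(** Vectors of e1^perp off the line of e1 and e2 are scalars times x1 e1 + x2 e2 + e4. The first
    equation is isotropy; the second is that of the residual line M_p for p = e1, with coefficients
    b1, b2, b4. It passes through p exactly when b1 = 0. *)
Definition perp_count (b1 b2 b4 : F) :=
  #|[set x : F * F | (x.2 + bar x.2 == 0) && (x.1 * b1 + x.2 * b2 + b4 == 0)]|.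

Lemma card_perpzeros f e1 e2 e3 e4 : quad f -> hyp e1 e2 e3 e4 ->
  vanishes f (line e1 e2) ->
  #|perpzeros f (line e1 e2) e1| =
  ((t ^ 2 - 1) * perp_count (pol f e1 e4) (pol f e2 e4) (f e4))%N.
Proof.
move=> qf hy; have ip := hyp_isopair hy; have H := hypE hy.
case/(vanishes_line qf ip) => f1 f2 f12.
have fv a b c : f (a *: e1 + b *: e2 + c *: e4) =
    c * (a * pol f e1 e4 + b * pol f e2 e4 + c * f e4).
  by rewrite !(quadE qf) f1 f2 f12; ring.
rewrite -(card_nonzero) -cardsX.
apply: (card_bij (f := fun z => (h z e2, (h z e3 / h z e2, h z e4 / h z e2)))
  (g := fun x => x.1 *: (x.2.1 *: e1 + x.2.2 *: e2 + e4))).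
  move=> z; rewrite !inE /= => /andP[/andP[zL /and3P[z0 /eqP hz /eqP fz]] /eqP hz1].
  have zE := hyp_coord z hy; rewrite hz1 scale0r addr0 in zE.
  have z2 : h z e2 != 0 by apply: contra zL => ->; rewrite hz1 eqxx.
  rewrite z2 /=; split; last first.
    by rewrite !scalerDr !scalerA ![h z e2 * _]mulrC !divfK // -zE.
  move: hz; rewrite {1 2}zE !hE !H !(mulr0, mulr1, addr0, add0r) => hz.
  move: fz; rewrite {1}zE fv => /eqP; rewrite mulf_eq0 (negbTE z2) /= => fz.
  apply/andP; split.
    rewrite !barE barV -(inj_eq (mulfI z2)) -(inj_eq (@mulfI _ (bar (h z e2)) _)) ?bar_eq0 //.
    rewrite !mulr0 -[X in _ == X]hz; apply/eqP; field.
    by rewrite z2 bar_eq0 z2.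
  rewrite -(inj_eq (mulfI z2)) mulr0 -(eqP fz); apply/eqP; field.
  by rewrite z2.
move=> [s [x1 x2]]; rewrite !inE /= => /and3P[s0 /eqP e1' /eqP e2'].
rewrite !hE !H !(mulr0, mulr1, addr0, add0r) eqxx /= andbT.
rewrite ![s * _ / s]mulrAC !divff // !mul1r; split=> //; rewrite s0 /=.
rewrite -[X in f X](_ : (s * x1) *: e1 + (s * x2) *: e2 + s *: e4 = _).
  rewrite fv; apply/and3P; split.
  - apply/eqP => /(f_equal (h^~ e2)).
    rewrite !hE !H !(mulr0, mulr1, addr0, add0r) => /eqP; exact/negP.
  - rewrite -[X in X == 0](_ : s * bar s * (x2 + bar x2) = _); last by ring.
    by rewrite e1' mulr0.
  have -> : s * (s * x1 * pol f e1 e4 + s * x2 * pol f e2 e4 + s * f e4) =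
    s * s * (x1 * pol f e1 e4 + x2 * pol f e2 e4 + f e4) by ring.
  by rewrite e2' mulr0.
by rewrite !scalerDr !scalerA.
Qed.

Lemma perp_count1 b1 b2 b4 : b1 != 0 -> perp_count b1 b2 b4 = t.
Proof.
move=> b0; apply: etrans (card_trace bar0).
apply: (card_bij (f := fun x : F * F => x.2) (g := fun x => (- (x * b2 + b4) / b1, x))).
  move=> [x y]; rewrite !inE /= => /andP[-> /eqP e]; split=> //; congr (_, _).
  by apply: (mulIf b0); rewrite divfK //; apply/eqP; rewrite eq_sym -addr_eq0 addrA e.
by move=> y; rewrite !inE /= => ->; rewrite divfK // -addrA addNr eqxx.
Qed.

(** The residual line passes through e1 and forces x2 = - b4 / b2. It lies on X exactly when this
    value has trace 0, and then x1 is free. *)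
Lemma perp_count0 b2 b4 : b2 != 0 ->
  perp_count 0 b2 b4 = if b4 / b2 + bar (b4 / b2) == 0 then (t ^ 2)%N else 0%N.
Proof.
move=> b0; have -> : perp_count 0 b2 b4 =
    #|setX [set: F] [set x | (x + bar x == 0) && (x == - (b4 / b2))]|.
  apply: eq_card => -[x y]; rewrite !inE /= mulr0 add0r; congr (_ && _).
  by rewrite -[RHS](inj_eq (mulIf b0)) mulNr divfK // addr_eq0.
rewrite cardsX cardsT card_F.
case: eqP => e.
  rewrite (_ : [set x | _] = [set - (b4 / b2)]) ?cards1 ?muln1 //.
  apply/setP => x; rewrite !inE; case: (x =P - _) => [->|]; rewrite ?andbF //.
  by rewrite barN -opprD e oppr0 eqxx.
rewrite (_ : [set x | _] = set0) ?cards0 ?muln0 //.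
apply/setP => x; rewrite !inE; apply/negbTE; apply: contra_notN e => /andP[/eqP e /eqP xE].
by move: e; rewrite xE barN -opprD => /eqP; rewrite oppr_eq0 => /eqP.
Qed.

(** The residual line is L itself, which has no point off L, unless b4 = 0 and the form vanishes on
    the whole plane. *)
Lemma perp_count00 b4 : perp_count 0 0 b4 = if b4 == 0 then (t ^ 3)%N else 0%N.
Proof.
have -> : perp_count 0 0 b4 = #|[set x : F * F | (x.2 + bar x.2 == 0) && (b4 == 0)]|.
  by apply: eq_card => -[x y]; rewrite !inE /= !mulr0 !add0r.
case: eqP => _; last by apply: eq_card0 => x; rewrite !inE andbF.
transitivity #|setX [set: F] [set x | x + bar x == 0]|.
  by apply: eq_card => x; rewrite !inE andbT.
by rewrite cardsX cardsT card_F (card_trace bar0) -expnSr.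
Qed.

(** Since [bar] is the t-th power, s = x1 / x2 is a root of a polynomial of degree at most t + 1.
    The point (1, 0) is a zero only if k11 = 0, and then the degree is at most t. *)
Lemma card_sesqui_zeros (k11 k12 k21 k22 : F) :
  [|| k11 != 0, k12 != 0, k21 != 0 | k22 != 0] ->
  (#|[set x : F * F | (x != (0, 0)%R) && (k11 * (x.1 * bar x.1) + k12 * (x.1 * bar x.2)
     + k21 * (x.2 * bar x.1) + k22 * (x.2 * bar x.2) == 0)%R]| <= t.+1 * (t ^ 2 - 1))%N.
Proof.
move=> kn0; have t1 := t_gt1.
pose p : {poly F} := k11 *: 'X^(t.+1) + k21 *: 'X^t + k12 *: 'X + k22%:P.
have p0 : p != 0.
  apply/eqP => e; move: kn0; have co i : p`_i = 0 by rewrite e coef0.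
  move: (co t.+1) (co t) (co 1%N) (co 0%N).
  rewrite /p !coefD !coefZ !coefXn !coefX !coefC !eqxx.
  (* The exponents 0, 1, t and t + 1 are distinct since t > 1, so the four coefficients can be read
     off separately. *)
  have -> : (t == 0)%N = false by case: (t) t1.
  have -> : (0 == t)%N = false by case: (t) t1.
  have -> : (t == 1)%N = false by case: (t) t1 => [|[]].
  have -> : (1 == t)%N = false by case: (t) t1 => [|[]].
  have -> : (1 == t.+1)%N = false by case: (t) t1 => [|[]].
  have -> : (t == t.+1)%N = false by apply/negbTE; rewrite neq_ltn ltnSn.
  have -> : (t.+1 == t)%N = false by apply/negbTE; rewrite neq_ltn ltnSn orbT.
  have -> : (t.+1 == 1)%N = false by case: (t) t1 => [|[]].
  rewrite /= !(mulr0, mulr1, addr0, add0r) => -> -> -> ->.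
  by rewrite !eqxx.
pose Z1 := [set s | p.[s] == 0].
have sz1 : (#|Z1| < size p)%N by apply: card_roots_le => // s; rewrite inE => /eqP.
have Z1_le : (#|Z1| + (k11 == 0%R) <= t.+1)%N.
  have s1 : (size (k12 *: 'X + k22%:P)%R <= 2)%N.
    rewrite (leq_trans (size_polyD _ _)) // geq_max.
    by rewrite (leq_trans (size_scale_leq _ _)) ?size_polyX // (leq_trans (size_polyC_leq1 _)).
  have s2 : (size (k21 *: 'X^t + k12 *: 'X + k22%:P)%R <= t.+1)%N.
    rewrite -addrA (leq_trans (size_polyD _ _)) // geq_max.
    rewrite (leq_trans (size_scale_leq _ _)) ?size_polyXn // (leq_trans s1) //; exact: ltnW.
  case: (eqVneq k11 0) => k0.
    rewrite /= addn1; apply: (leq_trans sz1); apply: leq_trans s2.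
    by rewrite /p k0 scale0r add0r.
  rewrite addn0 -ltnS; apply: (leq_trans sz1).
  rewrite /p -!addrA (leq_trans (size_polyD _ _)) // geq_max addrA (leq_trans s2) // andbT.
  by rewrite (leq_trans (size_scale_leq _ _)) ?size_polyXn.
apply: (@leq_trans ((#|Z1| + (k11 == 0%R)) * (t ^ 2 - 1)));
  last by rewrite leq_mul2r Z1_le orbT.
rewrite mulnDl -(card_nonzero).
set S := [set x | _].
rewrite -(cardsID [set x : F * F | x.2 == 0] S) addnC leq_add //.
  rewrite -cardsX; apply: (@leq_trans #|[set (y.1 * y.2, y.2) | y in setX Z1 [set s : F | s
    != 0]]|);
    last exact: leq_imset_card.
  apply: subset_leq_card; apply/subsetP => -[x y]; rewrite !inE /= => /and3P[y0 _ /eqP e].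
  apply/imsetP; exists (x / y, y); rewrite ?divfK //= !inE /= y0 andbT.
  have yb0 : bar y != 0 by rewrite bar_eq0.
  rewrite /p !(hornerD, hornerZ, hornerXn, hornerX, hornerC) exprS.
  rewrite -/(bar (x / y)) barM barV -(inj_eq (mulfI y0)) -(inj_eq (mulfI yb0)) !mulr0 -[X in
    _ == X]e.
  by apply/eqP; field; rewrite y0 yb0.
case: (eqVneq k11 0) => k0; last first.
  rewrite mul0n leqn0 cards_eq0; apply/eqP/setP => -[x y]; rewrite !inE /= xpair_eqE.
  apply/negbTE/negP => /andP[/andP[ne e] y0]; move: ne e; rewrite y0 andbT (eqP y0).
  rewrite bar0 !(mulr0, mul0r, addr0) !mulf_eq0 bar_eq0 (negbTE k0) /= orbb.
  by move/negP.
rewrite mul1n; apply: (@leq_trans #|[set (y, 0 : F) | y in [set s : F | s != 0]]|);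
    last exact: leq_imset_card.
apply: subset_leq_card; apply/subsetP => -[x y]; rewrite !inE /= xpair_eqE.
case/andP=> /andP[ne _] /eqP y0; move: ne; rewrite y0 eqxx andbT => x0.
by apply/imsetP; exists x; rewrite ?inE.
Qed.

(* the plane p^perp is tangent to the quadric V(f) at p, or contained in it *)
Definition tang (f : V -> F) p := [forall z, (h z p == 0) ==> (pol f p z == 0)].

Definition hasplane (f : V -> F) :=
  [exists u, (u != 0) && [forall z, (h z u == 0) ==> (f z == 0)]].

Definition flines f := [set M in lines | vanishes f M].

Lemma flinesP f M : reflect (M \in lines /\ vanishes f M) (M \in flines f).
Proof. by rewrite inE; apply: andP. Qed.

(** * Tangent points and neighbouring lines when no plane is contained in V(f) *)

Section FixedForm.
Variable f : V -> F.
Hypothesis qf : quad f.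

Lemma tangE e1 e2 e3 e4 : hyp e1 e2 e3 e4 -> vanishes f (line e1 e2) ->
  tang f e1 = (pol f e1 e4 == 0).
Proof.
move=> hy; have H := hypE hy; case/(vanishes_line qf (hyp_isopair hy)) => f1 f2 f12.
apply/forallP/eqP => [/(_ e4)|e z]; first by rewrite H eqxx => /eqP.
apply/implyP => /eqP z1; rewrite (hyp_coord z hy) z1.
rewrite scale0r addr0 !(quadE qf) (polxx qf) f1 f12 e.
by rewrite !(mulr0, addr0).
Qed.

(** With p = a e1 + b e2, the plane p^perp is spanned by the line and - bar b e3 + bar a e4. As pol
    f p vanishes on the line, only its value at the extra vector matters, and this is the expression
    displayed. *)
Lemma tang_sesqui e1 e2 e3 e4 a b : hyp e1 e2 e3 e4 -> vanishes f (line e1 e2) ->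
  (a, b) != (0, 0) ->
  tang f (a *: e1 + b *: e2) =
  (pol f e1 e4 * (a * bar a) + (- pol f e1 e3) * (a * bar b) +
   pol f e2 e4 * (b * bar a) + (- pol f e2 e3) * (b * bar b) == 0).
Proof.
move=> hy; have H := hypE hy; case/(vanishes_line qf (hyp_isopair hy)) => f1 f2 f12 ab.
apply/forallP/eqP => [/(_ (- bar b *: e3 + bar a *: e4))|e z].
  have -> : h (- bar b *: e3 + bar a *: e4) (a *: e1 + b *: e2) = 0.
    by rewrite !hE !H; ring.
  rewrite eqxx /= => /eqP.
  by rewrite !(quadE qf) => <-; ring.
apply/implyP; rewrite (hyp_coord z hy); set x1 := h z e3; set x2 := h z e4.
set x3 := h z e1; set x4 := h z e2.
rewrite !hE !H !(mulr0, mulr1, addr0, add0r) => /eqP e'.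
have f21 : pol f e2 e1 = 0 by rewrite polC.
rewrite !(quadE qf) !(polxx qf) f1 f2 f12 f21 !(mulr0, addr0, add0r).
case: (eqVneq b 0) ab e e' => [->|b0].
  rewrite xpair_eqE eqxx andbT bar0 !(mulr0, mul0r, addr0) => a0 /eqP.
  rewrite 2!mulf_eq0 bar_eq0 (negbTE a0) !orbF => /eqP -> /eqP.
  rewrite mulf_eq0 bar_eq0 (negbTE a0) orbF => /eqP ->.
  by rewrite !(mulr0, mul0r, addr0).
move=> _ e e'; have bb0 : bar b != 0 by rewrite bar_eq0.
have x4E : x4 = - (bar a * x3) / bar b.
  by apply: (mulIf bb0); rewrite divfK // -[RHS]addr0 -e'; ring.
rewrite -(inj_eq (mulfI bb0)) mulr0 -(mulr0 (- x3)) -e x4E.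
by apply/eqP; field.
Qed.

(** The coefficients of the tangency equation are, up to sign, the values of [pol f] between the
    line and e3, e4. If all four vanish, L lies in the radical of the polar form. *)
Lemma card_tang L : L \in flines f ->
  (#|[set p in L :\ 0%R | tang f p]| <= t.+1 * (t ^ 2 - 1))%N \/
  (forall p, p \in L -> forall z, pol f p z = 0).
Proof.
case/flinesP => Ll; have [e1 [e2 [ip ->]]] := linesP Ll => fL.
have [e3 [e4 hy]] := isopair_extend ip; have H := hypE hy.
case: (boolP [|| pol f e1 e4 != 0, (- pol f e1 e3) != 0, pol f e2 e4 != 0 | - pol f e2 e3 !=
  0]).
  move/card_sesqui_zeros => le; left; apply: leq_trans le.
  rewrite leq_eqVlt; apply/orP; left; apply/eqP.
  apply: (card_bij (f := fun p => (h p e3, h p e4)) (g := fun x => x.1 *: e1 + x.2 *: e2)).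
    move=> p; case/setIdP => /setD1P[p0 /(lineP _ ip)[a [b pE]]].
    have ab : (a, b) != (0, 0).
      by apply: contra p0 => /eqP[a0 b0]; rewrite pE a0 b0 !scale0r addr0.
    rewrite pE (tang_sesqui hy fL ab) !hE !H !(mulr0, mulr1, addr0, add0r) => e.
    by rewrite inE ab.
  move=> [a b]; rewrite !inE => /= /andP[ab e].
  rewrite (tang_sesqui hy fL ab) e !hE !H !(mulr0, mulr1, addr0, add0r) eqxx !andbT.
  split=> //; apply: contra ab => /eqP.
  by case/and4P: ip => _ _ _ /indepP ind /ind[-> ->].
rewrite !negb_or !negbK !oppr_eq0 => /and4P[/eqP f14 /eqP f13 /eqP f24 /eqP f23].
right=> p /(lineP _ ip)[a [b ->]] z.
case/(vanishes_line qf ip): fL => f1 f2 f12.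
have f21 : pol f e2 e1 = 0 by rewrite polC.
rewrite (hyp_coord z hy) !(quadE qf) !(polxx qf) f1 f2 f12 f21 f14 f13 f24 f23.
by rewrite !(mulr0, addr0).
Qed.

Definition second L p := [set M in flines f | (M != L) && (p \in M)].

(** The lines of X through e1 other than the given one are spanned by e1 and e4 + s e2 with s of
    trace 0; the two equations in f say that f vanishes on such a line. *)
Lemma second_line e1 e2 e3 e4 M : hyp e1 e2 e3 e4 -> vanishes f (line e1 e2) ->
  reflect (exists s, [/\ M = line e1 (e4 + s *: e2), pol f e1 e4 = 0,
             s * pol f e2 e4 + f e4 = 0 & s + bar s = 0])
          (M \in second (line e1 e2) e1).
Proof.
move=> hy fL; have H := hypE hy; have ip := hyp_isopair hy.
have [f1 f2 f12] := (vanishes_line qf ip).1 fL.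
have Ll : line e1 e2 \in lines by exact: mem_lines.
have e10 : e1 != 0 by case/and4P: ip => _ _ _ /indep_neq0l.
apply: (iffP setIdP) => [[/flinesP[Ml fM] /andP[ML e1M]]|[s [-> b1 b24 str]]].
  have [w [wM ipw ME]] := lines_basis Ml e1M e10.
  move: fM; rewrite ME => /(vanishes_line qf ipw)[_ fw f1w].
  have we1 : h w e1 = 0 by apply: (lines_perp Ml).
  have wE := hyp_coord w hy; rewrite we1 scale0r addr0 in wE.
  have w4 : h w e2 != 0.
    apply: contra ML => /eqP w4; rewrite w4 scale0r addr0 in wE.
    rewrite ME eq_sym; apply/eqP/lines_eq => //; first exact: line_l.
      by rewrite wE; apply: line_mem.
    by case/and4P: ipw.
  have ww : h w w = 0 by apply: (lines_perp Ml).
  set s := h w e4 / h w e2; exists s.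
  have wE' : w = h w e3 *: e1 + h w e2 *: (e4 + s *: e2).
    by rewrite {1}wE scalerDr scalerA [_ * s]mulrC divfK // [X in _ = _ + X]addrC addrA.
  have b1 : pol f e1 e4 = 0.
    apply: (mulfI w4); rewrite mulr0 -f1w {2}wE !(quadE qf) (polxx qf) f1 f12.
    by rewrite !(mulr0, addr0, add0r).
  split=> //.
  - apply: lines_eq; rewrite -?ME //.
    + have <- : (h w e2)^-1 *: (w + (- h w e3) *: e1) = e4 + s *: e2.
        by rewrite [X in _ *: (X + _)]wE' addrAC scaleNr subrr add0r scalerK.
      by rewrite (linesZ _ Ml) // -[X in X + _]scale1r (lines_lin _ _ Ml).
    apply/indepP => k l; rewrite scalerDr scalerA => /(f_equal (fun z => (h z e3, h z e2))).
    by rewrite !hE !H !(mulr0, mulr1, addr0, add0r) => -[-> ->].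
  - apply: (mulfI w4); apply: (mulfI w4); rewrite !mulr0 -fw [X in _ = f X]wE.
    by rewrite !(quadE qf) f1 f2 f12 b1 /s; field.
  have wb : bar (h w e2) != 0 by rewrite bar_eq0.
  have {}ww : h (h w e3 *: e1 + h w e4 *: e2 + h w e2 *: e4)
               (h w e3 *: e1 + h w e4 *: e2 + h w e2 *: e4) = 0 by rewrite -wE.
  apply: (mulfI w4); apply: (mulfI wb); rewrite !mulr0 -ww !hE !H barM barV /s.
  by field; rewrite w4 wb.
have ips : isopair e1 (e4 + s *: e2).
  rewrite /isopair !hE !H !(mulr0, mulr1, addr0, add0r).
  rewrite [bar s + s]addrC str eqxx /=.
  apply/indepP => k l; rewrite scalerDr scalerA => /(f_equal (fun z => (h z e3, h z e2))).
  by rewrite !hE !H !(mulr0, mulr1, addr0, add0r) => -[-> ->].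
have sl : line e1 (e4 + s *: e2) \in lines by apply: mem_lines.
split; last first.
  rewrite line_l // andbT; apply/eqP => e.
  have : e4 + s *: e2 \in line e1 e2 by rewrite -e line_r.
  by rewrite inE !hE !H !(mulr0, addr0) oner_eq0 andbF.
apply/flinesP; split=> //; apply/(vanishes_line qf ips); split=> //.
  by rewrite !(quadE qf) f2 [pol f e4 _]polC mulr0 addr0 addrC b24.
by rewrite !(quadE qf) b1 f12 mulr0 addr0.
Qed.

(** As f does not vanish on p^perp, its zeros there are L and one residual line. So at most one
    further line of X in V(f) passes through p, and only at a tangent point. A tangent point without
    such a line contributes 0. *)
Lemma perpzeros_second L p : ~~ hasplane f -> L \in flines f -> p \in L :\ 0 ->
  #|perpzeros f L p| =
    ((t ^ 2 - 1) * (if tang f p then t ^ 2 * #|second L p| else t))%N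
  /\ (#|second L p| <= tang f p)%N.
Proof.
move=> np /flinesP[Ll fL] /setD1P[p0 pL].
have [e2 [e2L ip LE]] := lines_basis Ll pL p0; move: fL; rewrite LE => fL {L Ll LE pL e2L}.
have [e3 [e4 hy]] := isopair_extend ip; have H := hypE hy.
have [f1 f2 f12] := (vanishes_line qf ip).1 fL.
rewrite (card_perpzeros qf hy fL) (tangE hy fL).
have sE M := second_line M hy fL.
have sec0 : (forall s, [/\ pol f p e4 = 0, s * pol f e2 e4 + f e4 = 0 & s + bar s = 0] ->
  False) ->
    #|second (line p e2) p| = 0%N.
  move=> no; apply: eq_card0 => M; apply/negbTE/negP => /sE[s [_ ? ? ?]].
  exact: (no s).
case: (eqVneq (pol f p e4) 0) => b1; last first.
  by rewrite perp_count1 // sec0 // => s [/eqP]; rewrite (negbTE b1).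
rewrite b1; case: (eqVneq (pol f e2 e4) 0) => b2.
  rewrite b2 perp_count00 //; case: eqP => b4.
    case/negP: np; apply/existsP; exists p; rewrite p0; apply/forallP => z.
    apply/implyP => /eqP z1; rewrite (hyp_coord z hy) z1 scale0r addr0.
    by rewrite !(quadE qf) f1 f2 f12 b1 b2 b4 !(mulr0, addr0).
  by rewrite sec0 ?muln0 // => s [_]; rewrite b2 mulr0 add0r.
rewrite perp_count0 //; case: eqP => str; last first.
  rewrite sec0 ?muln0 // => s [_ e1 e2']; case: str.
  have -> : f e4 / pol f e2 e4 = - s.
    by apply: (mulIf b2); rewrite divfK // mulNr; apply/eqP; rewrite -addr_eq0 addrC e1.
  by rewrite barN -opprD e2' oppr0.
suff -> : second (line p e2) p = [set line p (e4 - (f e4 / pol f e2 e4) *: e2)].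
  by rewrite cards1 muln1.
apply/setP => M; rewrite in_set1; apply/(sE M)/eqP => [[s [-> _ e _]]|->].
  congr (line _ (_ + _)); rewrite -scaleNr; congr (_ *: _).
  by apply: (mulIf b2); rewrite mulNr divfK //; apply/eqP; rewrite -addr_eq0 e.
exists (- (f e4 / pol f e2 e4)); rewrite scaleNr b1 mulNr divfK // addNr.
by split=> //; rewrite barN -opprD str oppr0.
Qed.

Definition nb L := [set M in flines f | (M != L) && [exists p, [&& p != 0, p \in L & p \in
  M]]].

(** A line other than L that meets L shares exactly one point with it, that is t^2 - 1 nonzero
    vectors. *)
Lemma sum_second L : L \in flines f ->
  (\sum_(p in L :\ 0%R) #|second L p| = (t ^ 2 - 1) * #|nb L|)%N.
Proof.
case/flinesP => Ll fL.
pose Q (p : V) (M : {set V}) := M \in second L p.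
rewrite (eq_bigr (fun p => #|[set M | Q p M]|)); last first.
  by move=> p _; apply: eq_card => M; rewrite [RHS]inE.
rewrite -(card_pair_sum (mem (L :\ 0)) Q).
rewrite (card_pair_swap (P := mem (L :\ 0)) (Q := Q) (P' := mem (nb L))
  (Q' := fun (M : {set V}) p => [&& p != 0, p \in L & p \in M])).
  rewrite (card_pair_const (P := mem (nb L))
    (Q := fun (M : {set V}) p => [&& p != 0, p \in L & p \in M]) (n := (t ^ 2 - 1)%N)).
    by rewrite mulnC; congr (_ * _)%N; apply: eq_card => M; rewrite !inE.
  move=> M /setIdP[/flinesP[Ml _] /andP[ML /existsP[p /and3P[p0 pL pM]]]].
  rewrite eq_sym in ML.
  rewrite -(card_nonzero); apply/esym.
  rewrite -(card_imset _ (f := fun s => s *: p)); last first.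
    move=> s s' /eqP; rewrite -subr_eq0 -scalerBl scaler_eq0 (negbTE p0) orbF.
    by rewrite subr_eq0 => /eqP.
  apply: eq_card => z; apply/imsetP/idP => [[s]|].
    by rewrite !inE => s0 ->; rewrite (linesZ _ Ll) // (linesZ _ Ml) // scaler_eq0 negb_or s0
      p0.
  rewrite inE => /and3P[z0 zL zM].
  have [s zE] := indepN p0 (lines_meet Ll Ml ML pL zL pM zM).
  exists s; rewrite // inE; apply: contra z0 => /eqP s0.
  by rewrite zE s0 scale0r.
move=> p M; rewrite /Q !inE; apply/idP/idP.
  case/andP=> /andP[p0 pL] /andP[-> /andP[-> pM]] /=; rewrite p0 pL pM !andbT.
  by apply/existsP; exists p; rewrite p0 pL.
by case/andP => /andP[-> /andP[-> _]] /and3P[-> -> ->].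
Qed.

(** Points of L that are not tangent contribute t each, tangent ones t^2 or 0. The tangent term
    stands on the left instead of being subtracted on the right. *)
Lemma noplane_card L : ~~ hasplane f -> L \in flines f ->
  (#|isozeros f| + t * #|[set p in L :\ 0%R | tang f p]| =
     t ^ 4 - 1 + t ^ 2 * ((t ^ 2 - 1) * #|nb L|) + t * (t ^ 4 - 1))%N
  /\ ((t ^ 2 - 1) * #|nb L| <= #|[set p in L :\ 0%R | tang f p]|)%N.
Proof.
move=> np LT; have [Ll fL] := flinesP _ _ LT; have t0 := t_gt0.
have e := line_sum Ll fL.
pose R := [set p in L :\ 0 | tang f p]; pose N := [set p in L :\ 0 | ~~ tang f p].
have cRN : (#|R| + #|N| = t ^ 4 - 1)%N.
  have <- : #|L :\ 0| = (t ^ 4 - 1)%N.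
    by rewrite -(card_lines Ll) (cardsD1 0 L) (lines0 Ll) [(true + _)%N]addnC addnK.
  rewrite -(cardsID R (L :\ 0)); congr (_ + _)%N; apply: eq_card => p; rewrite !inE.
    by case: (p != 0); case: (p \in L).
  by case: (p != 0); case: (p \in L); rewrite ?andbF ?andbT.
split; last first.
  rewrite -(sum_second LT) -sum1dep_card big_mkcondr leq_sum // => p pL.
  by have [_] := perpzeros_second np LT pL; case: tang.
have eS : (\sum_(p in L :\ 0%R) #|perpzeros f L p| =
    (t ^ 2 - 1) * (t ^ 2 * ((t ^ 2 - 1) * #|nb L|) + t * #|N|))%N.
  rewrite -(sum_second LT) -sum1dep_card.
  rewrite [X in (_ + _ * X)%N]big_mkcondr !big_distrr -big_split big_distrr.
  apply: eq_bigr => p pL /=; have [-> le] := perpzeros_second np LT pL.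
  case: tang le => /=; first by rewrite muln0 addn0.
  by rewrite leqn0 => /eqP ->; rewrite !muln0 muln1.
have q0 := t2B1_gt0.
move: e; rewrite eS -mulnDr => /eqP; rewrite eqn_pmul2l // => /eqP ->.
by rewrite -cRN; ring.
Qed.

(* As isozeros counts vectors, this stands for 2 t^3 + t^2 + 1 points. *)
Definition second_isozeros := ((t ^ 2 - 1) * (2 * t ^ 3 + t ^ 2 + 1))%N.

(** In points, with r tangent points on L and d neighbours, N = (t^2 + 1)(t + 1) - t r + t^2 d.
    Outside the radical case d <= r <= t + 1, and since t^2 > t the maximum requires d = t + 1,
    hence r = t + 1. In the radical case r = t^2 + 1 and d = 0, so N is only t^2 + 1. *)
Lemma noplane_bound L : ~~ hasplane f -> L \in flines f ->
  (#|isozeros f| <= second_isozeros)%N /\ (#|isozeros f| = second_isozeros <-> #|nb L| =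
    t.+1) /\
  (#|nb L| = t.+1 -> #|[set p in L :\ 0%R | tang f p]| = (t.+1 * (t ^ 2 - 1))%N).
Proof.
move=> np LT; have [e le] := noplane_card np LT; have t1 := t_gt1.
have t4 : (t ^ 4 - 1 = (t ^ 2 - 1) * (t ^ 2 + 1))%N.
  by rewrite -[(t ^ 4)%N]/(t ^ (2 * 2))%N expnM -[1%N in LHS](exp1n 2) subn_sqr.
have q0 := t2B1_gt0.
have : (#|[set p in L :\ 0%R | tang f p]| <= t.+1 * (t ^ 2 - 1))%N \/
    (#|nb L| = 0%N /\ #|[set p in L :\ 0%R | tang f p]| = (t ^ 4 - 1)%N).
  case: (card_tang LT) => [|H]; first by left.
  have [Ll fL] := flinesP _ _ LT; right; split.
    (* With L in the radical, a second line through p would give f e4 = 0, and then f would vanish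
       on the plane p^perp. *)
    apply: eq_card0 => M; apply/negP => /setIdP[MT /andP[ML /existsP[p /and3P[p0 pL pM]]]].
    have [e2 [e2L ip LE]] := lines_basis Ll pL p0.
    have [e3 [e4 hy]] := isopair_extend ip.
    have : M \in second L p by rewrite inE MT ML.
    rewrite LE; case/(second_line _ hy); rewrite -?LE // => s [_ b1].
    rewrite (H e2) // mulr0 add0r => f4 _; case/negP: np; apply/existsP; exists p.
    rewrite p0; apply/forallP => z; apply/implyP => /eqP z1.
    rewrite (hyp_coord z hy) z1 scale0r addr0 !(quadE qf) !(H e2) // f4 b1.
    move: fL; rewrite LE => /(vanishes_line qf ip)[-> -> ->].
    by rewrite !(mulr0, addr0).
  have <- : #|L :\ 0| = (t ^ 4 - 1)%N.
    by rewrite -(card_lines Ll) (cardsD1 0 L) (lines0 Ll) [(true + _)%N]addnC addnK.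
  apply: eq_card => p; rewrite [LHS]inE; case pL: (p \in L :\ 0) => //=.
  apply/forallP => z; apply/implyP => _; rewrite H //.
  by case/setD1P: pL.
move: e le; rewrite t4 /second_isozeros;
  move: #|isozeros f| #|nb L| #|[set p in L :\ 0 | tang f p]| => Z d r.
move: q0; set q1 := (t ^ 2 - 1)%N => q0 e le hr.
have hd : (d <= t.+1)%N.
  case: hr => [hr|[-> _]] //.
  by rewrite -(leq_pmul2l q0) (leq_trans le) // mulnC.
have t2 : (t ^ 2 = t * t)%N by rewrite mulnn.
have t3 : (t ^ 3 = t * t * t)%N by rewrite !expnS expn0 muln1 mulnA.
rewrite ?t2 ?t3 in e hr *; clear t2 t3 t4.
case: hr => [hr|[d0 hr]]; last first.
  rewrite d0 hr in e *.
  have ZE : Z = (q1 * (t * t + 1))%N by move: e; rewrite !muln0 addn0 => /addIn.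
  rewrite ZE; split; first by rewrite leq_pmul2l //; nia.
  split; last by [].
  by split=> // /eqP; rewrite eqn_pmul2l // => /eqP; nia.
have ZE : (Z <= q1 * (t * t + 1) * (t + 1) + (t * t - t) * (q1 * d))%N.
  have tr : (t * (q1 * d) <= t * r)%N by rewrite leq_mul2l le orbT.
  have td : (t * (q1 * d) <= t * t * (q1 * d))%N by rewrite leq_mul2r leq_pmulr ?orbT // ltnW.
  rewrite mulnBl addnBA // leq_subRL; last by apply: (leq_trans td); rewrite leq_addl.
  by move: e tr td; clear; lia.
have ZE2 : (q1 * (t * t + 1) * (t + 1) + t * t * (q1 * d) - t * (t.+1 * q1) <= Z)%N.
  have : (t * r <= t * (t.+1 * q1))%N by rewrite leq_mul2l hr orbT.
  move: e; clear; lia.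
have -> : (q1 * (2 * (t * t * t) + t * t + 1) =
    q1 * (t * t + 1) * (t + 1) + (t * t - t) * (q1 * t.+1))%N.
  transitivity (q1 * ((t * t + 1) * (t + 1) + (t * t - t) * t.+1))%N.
    by congr (_ * _)%N; nia.
  by rewrite mulnDr mulnA; congr (_ + _)%N; exact: mulnCA.
split.
  by apply: leq_trans ZE _; rewrite leq_add2l !leq_mul2l hd !orbT.
split; last by move=> dE; apply/eqP; rewrite eqn_leq hr /= mulnC -dE.
split=> [ZE'|dE]; last first.
  apply/eqP; rewrite dE in ZE ZE2; rewrite eqn_leq ZE /= (leq_trans _ ZE2) //.
  by rewrite mulnBl [(t.+1 * q1)%N]mulnC addnBA // leq_mul2r leq_pmulr ?orbT // ltnW.
have tt0 : (0 < t * t - t)%N by rewrite subn_gt0 -{1}[t]muln1 ltn_pmul2l // ltnW.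
move: ZE; rewrite ZE' leq_add2l leq_pmul2l // leq_pmul2l // => td.
by apply/eqP; rewrite eqn_leq hd td.
Qed.

End FixedForm.

(** The points of the line are y and the x + s y, each with t^2 - 1 nonzero multiples. *)
Lemma sum_line x y (G : V -> nat) : isopair x y ->
  (forall c p, c != 0 -> G (c *: p) = G p) ->
  (\sum_(p in line x y :\ 0%R) G p =
   (t ^ 2 - 1) * (G y + \sum_(s : F) G (x + s *: y)%R))%N.
Proof.
move=> ip GZ; have [e3 [e4 hy]] := isopair_extend ip; have H := hypE hy.
rewrite (reindex_onto (fun a : F * F => a.1 *: x + a.2 *: y) (fun z => (h z e3, h z e4))) /=;
  last first.
  move=> p /setD1P[_ /(lineP _ ip)[a [b ->]]].
  by rewrite !hE !H !(mulr0, mulr1, addr0, add0r).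
rewrite (eq_bigl (fun a => a != (0, 0))); last first.
  move=> [a b]; rewrite !hE !H !(mulr0, mulr1, addr0, add0r) eqxx andbT in_setD1 /=.
  have -> : a *: x + b *: y \in line x y by apply/(lineP _ ip); exists a, b.
  rewrite andbT; apply/idP/idP; apply: contra => /eqP.
    by case=> -> ->; rewrite !scale0r addr0.
  by case/and4P: ip => _ _ _ /indepP ind /ind[-> ->].
rewrite (bigID (fun a : F * F => a.1 == 0)) /= mulnDr; congr (_ + _)%N.
  rewrite (reindex_onto (fun b : F => (0, b)) snd) /=; last first.
    by move=> [a b] /andP[_ /eqP /= ->].
  rewrite (eq_bigl (fun b => b != 0)); last first.
    by move=> b; rewrite !eqxx !andbT xpair_eqE eqxx.
  rewrite (eq_bigr (fun=> G y)) => [|b b0]; last by rewrite scale0r add0r GZ.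
  rewrite sum_nat_cond_const -(card_nonzero); congr (_ * _)%N.
rewrite (eq_bigl (fun a : F * F => (a.1 != 0) && true)); last first.
  by move=> [a b]; rewrite xpair_eqE /=; case: (a == 0); rewrite ?andbF.
rewrite -(pair_big_dep (fun a => a != 0) (fun _ _ => true) (fun a b => G (a *: x + b *: y)))
  /=.
rewrite (eq_bigr (fun=> \sum_(s : F) G (x + s *: y)%R)%N) => [|a a0].
  rewrite sum_nat_cond_const -(card_nonzero); congr (_ * _)%N.
rewrite (reindex_inj (mulfI a0)) /=; apply: eq_bigr => s _.
by rewrite -scalerA -scalerDr GZ.
Qed.

(** * Products of two linear forms *)

Definition prodf u v (x : V) : F := h x u * h x v.

Lemma prodf_pol u v x y : pol (prodf u v) x y = h x u * h y v + h y u * h x v.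
Proof. by rewrite /pol /prodf !hE; ring. Qed.

Lemma prodf_quad u v : quad (prodf u v).
Proof.
apply/quadP; split=> [a x|a x y z]; first by rewrite /prodf !hE; ring.
by rewrite !prodf_pol !hE; ring.
Qed.

Lemma prodfC u v : prodf u v =1 prodf v u.
Proof. by move=> x; rewrite /prodf mulrC. Qed.

Lemma prodf_hasplane u v : u != 0 -> hasplane (prodf u v).
Proof.
move=> u0; apply/existsP; exists u; rewrite u0; apply/forallP => z.
by apply/implyP => /eqP zu; rewrite /prodf zu mul0r.
Qed.

Lemma h_riesz (g : V -> F) : (forall a x y, g (a *: x + y) = a * g x + g y) ->
  exists v, forall z, g z = h z v.
Proof.
move=> gl; have g0 : g 0 = 0.
  by have := gl (-1) 0 0; rewrite scaler0 addr0 mulN1r addNr.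
have gZ a x : g (a *: x) = a * g x by rewrite -[a *: x]addr0 gl g0 addr0.
have gD x y : g (x + y) = g x + g y by rewrite -[x]scale1r gl scale1r mul1r.
have [e1 [e2 [e3 [e4 hy]]]] := hyp_exists; have H := hypE hy.
exists (bar (g e3) *: e1 + bar (g e4) *: e2 + bar (g e1) *: e3 + bar (g e2) *: e4) => z.
rewrite {1}(hyp_coord z hy) !gD !gZ !hE !barK; ring.
Qed.

(** Split z along a vector w with h w u = 1. As f vanishes on u^perp, only the mixed term and the
    square term remain, and both contain h z u. The cofactor is linear in z, hence of the form h z
    v. *)
Lemma hasplane_prodf f : quad f -> hasplane f -> exists u v, u != 0 /\ f =1 prodf u v.
Proof.
move=> qf /existsP[u /andP[u0 /forallP fu]].
have [w wu] := h_dual u0.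
have [v vE] : exists v, forall z, pol f z w - h z u * f w = h z v.
  by apply: h_riesz => a x y; rewrite !(quadE qf) !hE; ring.
exists u, v; split=> // z; rewrite /prodf -vE.
have zE : z = (z - h z u *: w) + h z u *: w by rewrite subrK.
have /eqP f0 : f (z - h z u *: w) == 0.
  by apply: (implyP (fu _)); rewrite !hE wu mulr1 subrr.
by rewrite [X in f X]zE quadD f0 !(quadE qf) (polxx qf); ring.
Qed.

Lemma isozeros_eq (f g : V -> F) : f =1 g -> isozeros f = isozeros g.
Proof. by move=> e; apply/setP => z; rewrite !inE e. Qed.

Lemma perpzerosZ f L c p : c != 0 -> perpzeros f L (c *: p) = perpzeros f L p.
Proof.
by move=> c0; apply/setP => z; rewrite !inE !hE mulf_eq0 bar_eq0 (negbTE c0).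
Qed.

Lemma perpzeros_prodf x u v e3 e4 : hyp x u e3 e4 ->
  #|perpzeros (prodf u v) (line x u) x| =
  ((t ^ 2 - 1) * perp_count (h x v) (h u v) (h e4 v))%N.
Proof.
move=> hy; have H := hypE hy.
rewrite (card_perpzeros (prodf_quad u v) hy); last first.
  apply/(vanishes_line (prodf_quad _ _) (hyp_isopair hy)).
  by rewrite prodf_pol /prodf !H !mul0r addr0.
by rewrite !prodf_pol /prodf !H !mul0r !mul1r !add0r.
Qed.

Lemma prodf_line_vanishes x u v : isopair x u -> vanishes (prodf u v) (line x u).
Proof.
move=> ip; apply/(vanishes_line (prodf_quad _ _) ip).
case/and4P: ip => /eqP hx /eqP hu /eqP hxu _.
by rewrite prodf_pol /prodf hu hxu !mul0r addr0.
Qed.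

Lemma isopair_shear_r x u s : isopair x u -> isopair (x + s *: u) u /\
  line (x + s *: u) u = line x u.
Proof.
move=> ip; have ips := isopair_shear s ip; split=> //.
apply/esym/lines_eq; first exact: mem_lines; last by case/and4P: ips.
  by apply/(lineP _ ip); exists 1, s; rewrite scale1r.
exact: line_r.
Qed.

Lemma perpzeros_shear x u v s : isopair x u -> exists e4, h e4 u = 1 /\
  #|perpzeros (prodf u v) (line x u) (x + s *: u)| =
  ((t ^ 2 - 1) * perp_count (h x v + s * h u v)%R (h u v) (h e4 v))%N.
Proof.
move=> ip; have [ips LE] := isopair_shear_r s ip.
have [e3 [e4 hy]] := isopair_extend ips; exists e4; split.
  by rewrite (hypE hy).
by rewrite -LE (perpzeros_prodf v hy) !hE.
Qed.

(** Summation over the line of x and u. The plane u^perp lies in the quadric, so the point u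
    contributes t^3; the other points of the line are the x + s u. *)
Lemma prodf_count x u v : isopair x u ->
  #|isozeros (prodf u v)| =
  (t ^ 4 - 1 + (t ^ 2 - 1) * t ^ 3 +
   \sum_(s : F) #|perpzeros (prodf u v) (line x u) (x + s *: u)%R|)%N.
Proof.
move=> ip; have Ll := mem_lines ip.
have := line_sum Ll (prodf_line_vanishes v ip).
rewrite (sum_line ip) => [|c p c0]; last by rewrite perpzerosZ.
have q0 := t2B1_gt0.
rewrite -mulnDr => /eqP; rewrite eqn_pmul2l // => /eqP ->.
rewrite addnA; congr (_ + _ + _)%N.
have ip' : isopair u x by rewrite isopairC.
have [e3 [e4 hy]] := isopair_extend ip'; have H := hypE hy.
have lE : line u x = line x u by apply/setP => z; rewrite !inE andbC.
have fL : vanishes (prodf u v) (line u x) by rewrite lE prodf_line_vanishes.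
rewrite -lE (card_perpzeros (prodf_quad u v) hy fL).
by rewrite !prodf_pol /prodf !H !(mul0r, mulr0, addr0) perp_count00 // eqxx.
Qed.

Lemma t4E : (t ^ 4 - 1 = (t ^ 2 - 1) * (t ^ 2 + 1))%N.
Proof. by rewrite -[(t ^ 4)%N]/(t ^ (2 * 2))%N expnM -[1%N in LHS](exp1n 2) subn_sqr. Qed.

Lemma prodf_count_square u c : u != 0 -> h u u = 0 -> c != 0 ->
  #|isozeros (prodf u (c *: u))| = ((t ^ 2 - 1) * (t ^ 3 + t ^ 2 + 1))%N.
Proof.
move=> u0 hu c0; have [x] := isotropic_extend u0 hu.
rewrite isopairC // => ip; rewrite (prodf_count _ ip) big1 ?addn0.
  by rewrite t4E -mulnDr; congr (_ * _)%N; ring.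
move=> s _; have [e4 [e4u ->]] := perpzeros_shear (c *: u) s ip.
case/and4P: ip => _ _ /eqP hxu _.
rewrite !hE hu hxu e4u !(mulr0, addr0) mulr1 perp_count00 //.
by rewrite bar_eq0 (negbTE c0) muln0.
Qed.

(** For x orthogonal to u but not to v, every x + s u has nonzero product with v, so each of these
    t^2 residual lines avoids its point and contributes t. *)
Lemma prodf_count_perp u v : u != 0 -> h u u = 0 -> h u v = 0 -> indep u v ->
  #|isozeros (prodf u v)| = second_isozeros.
Proof.
move=> u0 hu huv ind; have [y ipy] := isotropic_extend u0 hu.
have [e3 [e4 hy]] := isopair_extend ipy; have H := hypE hy.
have hvu : h v u = 0 by rewrite -hC huv bar0.
(* Both y and e4 span lines of X with u. If both were orthogonal to v, then v would be a multiple of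
   u. *)
have [x [ip hxv]] : exists x, isopair x u /\ h x v != 0.
  case: (eqVneq (h y v) 0) => [hyv|]; last by exists y; rewrite isopairC.
  exists e4; split.
    rewrite isopairC // /isopair !H !eqxx /=; apply/indepP => a b.
    move=> /(f_equal (fun z => (h z e3, h z y))).
    by rewrite !hE !H !(mulr0, mulr1, addr0, add0r) => -[-> ->].
  rewrite h_sym0; apply: contraTneq ind => hv4; apply/negP => /andP[_ /forallP/(_ (h v e3))].
  have vE := hyp_coord v hy; move: vE.
  by rewrite hvu hv4 (h_sym hyv) bar0 !scale0r !addr0 => {1}->; rewrite eqxx.
rewrite (prodf_count _ ip) (eq_bigr (fun=> (t ^ 2 - 1) * t)%N) => [|s _].
  rewrite sum_nat_const card_F t4E /second_isozeros mulnCA -!mulnDr.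
  by congr (_ * _)%N; ring.
have [e [_ ->]] := perpzeros_shear v s ip.
by rewrite huv mulr0 addr0 perp_count1.
Qed.

(** As h u v is nonzero, exactly one point of the line of x and u is orthogonal to v, here x itself;
    the points x + s u with s nonzero contribute t each. *)
Lemma prodf_count_transverse x u v e3 e4 : hyp x u e3 e4 -> h x v = 0 -> h u v != 0 ->
  #|isozeros (prodf u v)| =
  ((t ^ 2 - 1) * (t ^ 2 + 1 + t ^ 3 + (t ^ 2 - 1) * t + perp_count 0%R (h u v) (h e4 v)))%N.
Proof.
move=> hy hxv huv; have ip := hyp_isopair hy.
rewrite (prodf_count _ ip) (bigD1 0) //= scale0r addr0 (perpzeros_prodf v hy) hxv.
rewrite (eq_bigr (fun=> (t ^ 2 - 1) * t)%N) => [|s s0].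
  rewrite sum_nat_cond_const (_ : #|[set i : F | i != 0%R]| = t ^ 2 - 1)%N;
    last exact: card_nonzero.
  rewrite t4E; move: (t ^ 2 - 1)%N => q; ring.
have [e [_ ->]] := perpzeros_shear v s ip.
by rewrite hxv add0r perp_count1 // mulf_neq0.
Qed.

(** Stands for t^2 + 1 points on a line, t^3 in u^perp, t from each of t^2 - 1 planes and t^2 from
    one plane. The subtraction comes last so that it is not truncated. *)
Definition first_isozeros := ((t ^ 2 - 1) * (2 * t ^ 3 + 2 * t ^ 2 + 1 - t))%N.

(** With b2 = h u v and b4 = h e4 v as in [prodf_count_transverse], the trace condition says that v
    is isotropic: the largest value belongs to two tangent planes of X at points not orthogonal to
    each other. *)
Lemma transverse_count_values (b2 b4 : F) : b2 != 0 ->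
  let n := ((t ^ 2 - 1) * (t ^ 2 + 1 + t ^ 3 + (t ^ 2 - 1) * t + perp_count 0%R b2 b4))%N in
  if b4 / b2 + bar (b4 / b2) == 0 then n = first_isozeros else (n < second_isozeros)%N.
Proof.
have t1 := t_gt1; have q0 := t2B1_gt0.
have E : ((t ^ 2 - 1) * t = t ^ 3 - t)%N by rewrite mulnBl mul1n -expnSr.
have t3 : (t <= t ^ 3)%N by rewrite -{1}(expn1 t) leq_exp2l.
move=> b20 n; rewrite /n perp_count0 //; case: eqP => _.
  rewrite /first_isozeros; congr (_ * _)%N; rewrite E; lia.
rewrite /second_isozeros ltn_pmul2l // E; lia.
Qed.

Lemma first_isozeros_gt : (second_isozeros < first_isozeros)%N.
Proof.
have t1 := t_gt1; have q0 := t2B1_gt0.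
rewrite /first_isozeros /second_isozeros ltn_pmul2l //.
have : (t < t ^ 2)%N by rewrite -{1}(expn1 t) ltn_exp2l.
lia.
Qed.

(** A line in the zero set lies in u^perp or in v^perp, since a vector off the first plus a vector
    off the second would be off both. But a line L of X in w^perp contains w, because L^perp = L, so
    w would be isotropic. *)
Lemma prodf_noline u v : h u u != 0 -> h v v != 0 -> noline (prodf u v).
Proof.
move=> hu hv x y ip fx fy fxy.
have fL : vanishes (prodf u v) (line x y) by apply/(vanishes_line (prodf_quad u v) ip).
have key w : h w w != 0 -> ~~ [forall z in line x y, h z w == 0].
  apply: contra => /forall_inP H; apply/eqP.
  have wL : w \in line x y by rewrite inE ![h w _ == 0]h_sym0 !H ?line_l ?line_r.
  by apply/eqP/H.
have /forall_inPn[a aL au] := key u hu; have /forall_inPn[b bL bv] := key v hv.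
have f0 z : z \in line x y -> h z u * h z v = 0 by move/vanishesP: fL; apply.
have av : h a v = 0 by have /eqP := f0 a aL; rewrite mulf_eq0 (negbTE au) => /eqP.
have bu : h b u = 0 by have /eqP := f0 b bL; rewrite mulf_eq0 (negbTE bv) orbF => /eqP.
have := f0 (1 *: a + 1 *: b); rewrite (lines_lin _ _ (mem_lines ip)) // => /(_ isT) /eqP.
by rewrite !scale1r !hE av bu addr0 add0r mulf_eq0 (negbTE au) (negbTE bv).
Qed.

Lemma prodf_iso_values u v : u != 0 -> v != 0 -> h u u = 0 ->
  [/\ (#|isozeros (prodf u v)| <= second_isozeros)%N \/ #|isozeros (prodf u v)| =
    first_isozeros
    & #|isozeros (prodf u v)| = second_isozeros <-> h u v = 0 /\ indep u v].
Proof.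
move=> u0 v0 hu; have t1 := t_gt1.
have q0 := t2B1_gt0.
have t2 : (0 < t ^ 2)%N by rewrite expn_gt0 ltnW.
case: (eqVneq (h u v) 0) => huv; last first.
  have [x0] := isotropic_extend u0 hu; rewrite isopairC // => ip0.
  (* The shear moves x0 to the point of the line orthogonal to v, as [prodf_count_transverse]
     requires. *)
  have [ip _] := isopair_shear_r (- (h x0 v / h u v)) ip0.
  set x := _ + _ in ip; have hxv : h x v = 0.
    by rewrite /x !hE mulNr divfK // subrr.
  have [e3 [e4 hy]] := isopair_extend ip.
  have := transverse_count_values (h e4 v) huv; rewrite /= -(prodf_count_transverse hy) //.
  case: eqP => _ => [->|lt].
    split; first by right.
    split=> [e|[]]; first by have := first_isozeros_gt; rewrite e ltnn.
    by move/eqP; rewrite (negbTE huv).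
  split; first by left; apply: ltnW.
  split=> [e|[]]; first by move: lt; rewrite e ltnn.
  by move/eqP; rewrite (negbTE huv).
case: (boolP (indep u v)) => [ind|nind].
  by rewrite prodf_count_perp //; split=> //; left.
have [c vE] := indepN u0 nind; have c0 : c != 0.
  by apply: contraNneq v0 => c0; rewrite vE c0 scale0r.
rewrite vE prodf_count_square // /second_isozeros.
have lt : (t ^ 3 + t ^ 2 + 1 < 2 * t ^ 3 + t ^ 2 + 1)%N.
  by have : (0 < t ^ 3)%N; [rewrite expn_gt0 ltnW | lia].
split; first by left; rewrite leq_pmul2l // ltnW.
split=> [/eqP|[_]]; first by rewrite eqn_pmul2l // (ltn_eqF lt).
by [].
Qed.

Lemma plane_values f : quad f -> hasplane f -> (exists z, f z != 0) ->
  [/\ (#|isozeros f| <= second_isozeros)%N \/ #|isozeros f| = first_isozeros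
    & #|isozeros f| = second_isozeros <->
      exists u v, [/\ f =1 prodf u v, u != 0, h u u = 0, h u v = 0 & indep u v]].
Proof.
move=> qf pf [z0 fz0].
have iso_case u v : f =1 prodf u v -> u != 0 -> v != 0 -> h u u = 0 ->
    [/\ (#|isozeros f| <= second_isozeros)%N \/ #|isozeros f| = first_isozeros
    & #|isozeros f| = second_isozeros <->
      exists u v, [/\ f =1 prodf u v, u != 0, h u u = 0, h u v = 0 & indep u v]].
  move=> fE u0 v0 hu; rewrite (isozeros_eq fE).
  have [le iff] := prodf_iso_values u0 v0 hu; split=> //; split.
    by move/iff => [huv ind]; exists u, v.
  move=> [u' [v' [fE' u'0 hu' huv' ind']]].
  by rewrite -(isozeros_eq fE) (isozeros_eq fE') prodf_count_perp.
have [u [v [u0 fE]]] := hasplane_prodf qf pf.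
have v0 : v != 0 by apply: contra fz0 => /eqP v0; rewrite fE /prodf v0 !hE mulr0.
case: (eqVneq (h u u) 0) => hu; first exact: iso_case hu.
case: (eqVneq (h v v) 0) => hv.
  by apply: (iso_case v u) => // z; rewrite fE prodfC.
have := noline_bound (prodf_quad u v) (prodf_noline hu hv).
rewrite -(isozeros_eq fE).
have t1 := t_gt1.
have lt : (2 * (t ^ 2 - 1) * (t ^ 3 + 1) < second_isozeros)%N.
  have q0 := t2B1_gt0.
  rewrite /second_isozeros mulnAC mulnC ltn_pmul2l // mulnDr muln1.
  have : (2 ^ 2 <= t ^ 2)%N by rewrite leq_exp2r.
  lia.
move=> le; have {le}lt := leq_ltn_trans le lt; split; first by left; apply: ltnW.
split=> [e|[u' [v' [fE' u'0 hu' huv' ind']]]]; first by move: lt; rewrite e ltnn.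
by move: lt; rewrite (isozeros_eq fE') prodf_count_perp // ltnn.
Qed.

Lemma noplane_noline_or_line f : quad f -> noline f \/ exists L, L \in flines f.
Proof.
move=> qf; case: (pickP (mem (flines f))) => [L LT|no]; first by right; exists L.
left=> x y ip fx fy fxy; have := no (line x y); rewrite !inE mem_lines //=.
by move/negP; apply; apply/(vanishes_line qf ip).
Qed.

Lemma quad_values f : quad f -> (exists z, f z != 0) ->
  (#|isozeros f| <= second_isozeros)%N \/ #|isozeros f| = first_isozeros.
Proof.
move=> qf f0; case: (boolP (hasplane f)) => pf; first by case: (plane_values qf pf f0).
left; case: (noplane_noline_or_line qf) => [nl|[L LT]].
  apply: leq_trans (noline_bound qf nl) _.
  have t1 := t_gt1.
  rewrite /second_isozeros mulnAC mulnC leq_mul2l; apply/orP; right; rewrite mulnDr muln1.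
  have : (2 ^ 2 <= t ^ 2)%N by rewrite leq_exp2r.
  lia.
by case: (noplane_bound qf pf LT).
Qed.

Lemma first_isozeros_attained : exists u v, #|isozeros (prodf u v)| = first_isozeros.
Proof.
have [e1 [e2 [e3 [e4 hy]]]] := hyp_exists; have H := hypE hy.
have e24 : h e2 e4 != 0 by rewrite H oner_eq0.
exists e2, e4; have := transverse_count_values (h e4 e4) e24.
have e14 : h e1 e4 = 0 by rewrite H.
by rewrite /= -(prodf_count_transverse hy e14 e24) !H mul0r bar0 addr0 eqxx.
Qed.

(** Unique factorisation. The hyperplane u^perp lies in the union of u'^perp and v'^perp, hence in
    one of them, as a vector space is not a union of two proper subspaces. That factor is a multiple
    of u, and cancelling h z u identifies the other. *)
Lemma prodf_inj u v u' v' : u != 0 -> v != 0 -> u' != 0 -> v' != 0 ->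
  prodf u v =1 prodf u' v' -> exists c, c != 0 /\
    ((u' = c *: u /\ v' = c^-1 *: v) \/ (u' = c *: v /\ v' = c^-1 *: u)).
Proof.
move=> u0 v0 u'0 v'0 e.
have key a b : a != 0 -> prodf u v =1 prodf a b ->
    (forall z, h z u = 0 -> h z a = 0) -> exists c, c != 0 /\ (a = c *: u /\ b = c^-1 *: v).
  move=> a0 ab H; have [c aE] := perp_sub u0 H.
  have c0 : c != 0 by apply: contraNneq a0 => c0; rewrite aE c0 scale0r.
  exists c; split=> //; split=> //.
  have vz z : h z u * h z (v - c *: b) = 0.
    have := ab z; rewrite aE /prodf !hE => E; rewrite mulrDr E; ring.
  have [w' w'u] := h_dual u0.
  suff: v - c *: b = 0.
    by move/eqP; rewrite subr_eq0 => /eqP ->; rewrite scalerA mulVf // scale1r.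
  apply: (h_nondeg) => z; case: (eqVneq (h z u) 0) => zu; last first.
    by apply/eqP; have /eqP := vz z; rewrite mulf_eq0 (negbTE zu).
  (* On u^perp the product gives no information; adding w', which is off u^perp, carries the
     cancellation there. *)
  have := vz (z + w'); have := vz w'; rewrite !hDl zu w'u add0r !mul1r => ->.
  by rewrite addr0.
have sub : (forall z, h z u = 0 -> h z u' = 0) \/ (forall z, h z u = 0 -> h z v' = 0).
  case: (boolP [forall z, (h z u == 0) ==> (h z u' == 0)]) => [/forallP H|].
    by left=> z zu; apply/eqP/(implyP (H z)); rewrite zu.
  move=> /forallPn[x]; rewrite negb_imply => /andP[/eqP xu xu']; right=> z zu.
  have E y : h y u = 0 -> h y u' * h y v' = 0.
    by move=> yu; rewrite -[LHS](e y) /prodf yu mul0r.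
  have /eqP := E x xu; rewrite mulf_eq0 (negbTE xu') => /eqP xv'.
  have /eqP := E z zu; rewrite mulf_eq0 => /orP[/eqP zu'|/eqP //].
  have := E (x + z); rewrite !hDl xu zu xv' zu' !addr0 add0r => /(_ erefl)/eqP.
  by rewrite mulf_eq0 (negbTE xu') => /eqP.
case: sub => H.
  by have [c [c0 E]] := key u' v' u'0 e H; exists c; split=> //; left.
have [|c [c0 [-> ->]]] := key v' u' v'0 _ H.
  by move=> z; rewrite e prodfC.
exists c^-1; rewrite invr_eq0 c0 invrK; split=> //; by right.
Qed.

Lemma prodf_scale u v c : c != 0 -> prodf (c *: u) (c^-1 *: v) =1 prodf u v.
Proof.
move=> c0 x; rewrite /prodf !hE barV; have : bar c != 0 by rewrite bar_eq0.
by move=> bc; field.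
Qed.

Lemma indep_scale (u v : V) c d : c != 0 -> d != 0 -> indep (c *: u) (d *: v) = indep u v.
Proof.
move=> c0 d0; apply/indepP/indepP => H a b.
  move=> e; have [|/eqP ha /eqP hb] := H (a / c) (b / d).
    by rewrite !scalerA !divfK.
  move: ha hb; rewrite !mulf_eq0 !invr_eq0 (negbTE c0) (negbTE d0) !orbF.
  by move/eqP=> -> /eqP ->.
rewrite !scalerA => /H[/eqP ha /eqP hb].
move: ha hb; rewrite !mulf_eq0 (negbTE c0) (negbTE d0) !orbF.
by move=> /eqP -> /eqP ->.
Qed.

(** * The number of products of second weight *)

Definition prodff (p : V * V) : {ffun V -> F} := [ffun x => prodf p.1 p.2 x].

Lemma prodff_eq p p' : prodff p = prodff p' <-> prodf p.1 p.2 =1 prodf p'.1 p'.2.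
Proof.
split=> [/ffunP e x|e]; first by have := e x; rewrite !ffunE.
by apply/ffunP => x; rewrite !ffunE e.
Qed.

(** Exactly one factor is isotropic, and it stands first. This fixes the order, whereas the pairs in
    [iso_pairs] can be swapped; hence fibres of size t^2 - 1 and 2 (t^2 - 1) respectively. *)
Definition mixed_pairs :=
  [set p : V * V | [&& p.1 != 0, h p.1 p.1 == 0, h p.2 p.1 == 0, indep p.1 p.2 & h p.2 p.2 !=
    0]].
Definition iso_pairs := [set p : V * V | isopair p.1 p.2].

Lemma card_perp u : u != 0 -> #|[set v | h v u == 0]| = (t ^ 6)%N.
Proof.
move=> u0; have [w wu] := h_dual u0.
have q0 : (0 < t ^ 2)%N by rewrite expn_gt0 (t_gt0).
apply/eqP; rewrite -(eqn_pmul2r q0) -expnD; apply/eqP.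
have <- : #|[set: V]| = (t ^ (6 + 2))%N by rewrite cardsT card_mx card_F -expnM.
rewrite -[X in (_ * X)%N]card_F -cardsT -cardsX.
apply: (card_bij (f := fun x => x.1 + x.2 *: w) (g := fun z => (z - h z u *: w, h z u))).
  move=> [z a]; rewrite !inE andbT /= => /eqP zu; rewrite !hE zu wu add0r mulr1.
  by rewrite addrK.
by move=> z _; rewrite !inE /= !hE wu mulr1 subrr eqxx subrK.
Qed.

Lemma card_perp_indep u : u != 0 -> h u u = 0 ->
  #|[set v | (h v u == 0) && indep u v]| = (t ^ 6 - t ^ 2)%N.
Proof.
move=> u0 hu; rewrite -(card_perp u0).
rewrite -(cardsID [set v | indep u v] [set v | h v u == 0]).
have -> : #|[set v | h v u == 0] :\: [set v | indep u v]| = (t ^ 2)%N.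
  rewrite -card_F -cardsT; apply/esym.
  rewrite -(card_imset _ (f := fun s => s *: u)); last first.
    move=> s s' /eqP; rewrite -subr_eq0 -scalerBl scaler_eq0 (negbTE u0) orbF.
    by rewrite subr_eq0 => /eqP.
  apply: eq_card => v; apply/imsetP/idP => [[s _ ->]|].
    rewrite !inE !hE hu mulr0 eqxx andbT; apply/negP => /andP[_ /forallP/(_ s)].
    by rewrite eqxx.
  by rewrite !inE => /andP[/(indepN u0)[s ->] _]; exists s.
by rewrite addnK; apply: eq_card => v; rewrite !inE.
Qed.

(** Among the t^6 - t^2 vectors of u^perp independent of u, the isotropic ones to be removed are
    those forming an isotropic pair with u. *)
Lemma card_mixed_pairs : #|mixed_pairs| =
  ((t ^ 4 - 1) * (t ^ 3 + 1) * (t ^ 6 - t ^ 2 - t.+1 * (t ^ 4 - t ^ 2)))%N.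
Proof.
rewrite -(card_isotropic).
rewrite -(card_pair_const (Q := fun u v => [&& h v u == 0, indep u v & h v v != 0])).
  by apply: eq_card => -[u v]; rewrite !inE /= andbA.
move=> u /andP[u0 /eqP hu].
rewrite -(card_perp_indep u0 hu) -(card_isopair_l u0 hu).
rewrite -(cardsID [set v | h v v == 0] [set v | (h v u == 0) && indep u v]).
rewrite (_ : _ :&: _ = [set v | isopair u v]); last first.
  apply/setP => v; rewrite !inE /isopair hu eqxx /= [h u v == 0]h_sym0.
  by rewrite andbC; case: (h v v == 0).
by rewrite addKn; apply: eq_card => v; rewrite !inE andbA andbC.
Qed.

Lemma mixed_fibre p : p \in mixed_pairs ->
  #|[set p' in mixed_pairs | prodff p' == prodff p]| = (t ^ 2 - 1)%N.
Proof.
case: p => u v; rewrite inE /= => /and5P[u0 hu hvu ind hv].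
have v0 := indep_neq0r ind.
rewrite -(card_nonzero); apply/esym.
rewrite -(card_imset _ (f := fun c => (c *: u, c^-1 *: v))); last first.
  move=> s s' [/eqP]; rewrite -subr_eq0 -scalerBl scaler_eq0 (negbTE u0) orbF.
  by rewrite subr_eq0 => /eqP.
apply: eq_card => -[u' v']; apply/imsetP/setIdP => [[c]|[]].
  rewrite inE => c0 [-> ->]; split; last by apply/eqP/prodff_eq/prodf_scale.
  have ci : c^-1 != 0 by rewrite invr_eq0.
  rewrite inE /= indep_scale // ind scaler_eq0 (negbTE c0) (negbTE u0) !hE.
  by rewrite (eqP hu) (eqP hvu) !mulr0 eqxx !mulf_neq0 // bar_eq0.
rewrite inE /= => /and5P[u'0 hu' hvu' ind' hv'] /eqP/prodff_eq /= e.
have [c [c0 [[-> ->]|[uE vE]]]] := prodf_inj u0 v0 u'0 (indep_neq0r ind') (fun x => esym (e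
  x)).
  by exists c; rewrite ?inE.
case/negP: hv; move: hu'; rewrite uE !hE !mulf_eq0 bar_eq0 (negbTE c0).
by [].
Qed.

Lemma iso_fibre p : p \in iso_pairs ->
  #|[set p' in iso_pairs | prodff p' == prodff p]| = (2 * (t ^ 2 - 1))%N.
Proof.
case: p => u v; rewrite inE /= => ip; case/and4P: (ip) => /eqP hu /eqP hv /eqP huv ind.
have u0 := indep_neq0l ind; have v0 := indep_neq0r ind.
pose f (x : bool * F) := if x.1 then (x.2 *: v, x.2^-1 *: u) else (x.2 *: u, x.2^-1 *: v).
have finj : {in setX [set: bool] [set s : F | s != 0] &, injective f}.
  have sinj (w : V) s s' : w != 0 -> s *: w = s' *: w -> s = s'.
    move=> w0 /eqP; rewrite -subr_eq0 -scalerBl scaler_eq0 (negbTE w0) orbF.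
    by rewrite subr_eq0 => /eqP.
  have no s s' : s != 0 -> s *: u = s' *: v -> False.
    move=> s0 e; have [|/eqP] := elimT (indepP _ _) ind s (- s').
      by rewrite e scaleNr subrr.
    by rewrite (negbTE s0).
  move=> [[] s] [[] s']; rewrite !inE /f /= => s0 s'0 [].
  - by move=> /sinj ->.
  - by move=> /esym /no -/(_ s'0).
  - by move=> /no -/(_ s0).
  - by move=> /sinj ->.
have -> : (2 * (t ^ 2 - 1) = #|setX [set: bool] [set s : F | s != 0%R]|)%N.
  by rewrite cardsX cardsT card_bool (card_nonzero).
rewrite -(card_in_imset finj).
apply: eq_card => -[u' v']; apply/setIdP/imsetP => [[]|[[b c]]]; last first.
  rewrite !inE /= => c0; have ci : c^-1 != 0 by rewrite invr_eq0.
  have ipC : isopair v u by rewrite isopairC.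
  have hvu : h v u = 0 by rewrite -hC huv bar0.
  case: b => -[-> ->]; split.
  - by rewrite /isopair indep_scale // indepC ind !hE hu hv hvu !mulr0 eqxx.
  - by apply/eqP/prodff_eq => x; rewrite /= prodf_scale // prodfC.
  - by rewrite /isopair indep_scale // ind !hE hu hv huv !mulr0 eqxx.
  by apply/eqP/prodff_eq => x; rewrite /= prodf_scale.
rewrite inE /= => ip' /eqP/prodff_eq /= e.
case/and4P: (ip') => _ _ _ ind'.
have [c [c0 [[-> ->]|[-> ->]]]] :=
  prodf_inj u0 v0 (indep_neq0l ind') (indep_neq0r ind') (fun x => esym (e x)).
  by exists (false, c); rewrite ?inE.
by exists (true, c); rewrite ?inE.
Qed.

Definition second_plane :=
  [set f : {ffun V -> F} | [&& quad f, hasplane f & #|isozeros f| == second_isozeros]].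

Lemma second_planeE : second_plane = (prodff @: mixed_pairs) :|: (prodff @: iso_pairs).
Proof.
apply/setP => f; rewrite !inE; apply/and3P/orP.
  case=> qf pf /eqP Nf; have f0 : exists z, f z != 0.
    case: (pickP (fun z => f z != 0)) => [z|no]; first by exists z.
    (* The zero function satisfies [hasplane] too, but all (t^2 + 1)(t^3 + 1) points of X are zeros
       of it, which is too many. *)
    have : isozeros f = [set z : V | (z != 0) && (h z z == 0)].
      apply/setP => z; rewrite !inE; have := no z; case: eqP => // _ _.
      by rewrite andbT.
    move/(f_equal (fun A : {set V} => #|A|)); rewrite Nf (card_isotropic).
    have t1 := t_gt1; rewrite t4E // -mulnA /second_isozeros => /eqP.
    rewrite eqn_pmul2l; last by rewrite subn_gt0 -{1}(exp1n 2) ltn_exp2r.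
    have : (2 * 2 * t ^ 3 <= t ^ 2 * t ^ 3)%N by rewrite leq_mul2r -[(2 * 2)%N]/(2 ^ 2)%N
      leq_exp2r // t1 orbT.
    have : (0 < t ^ 3)%N by rewrite expn_gt0 ltnW.
    move=> a b /eqP; nia.
  have [_ [H _]] := plane_values qf pf f0.
  have [u [v [fE u0 hu huv ind]]] := H Nf.
  have fp : f = prodff (u, v) by apply/ffunP => z; rewrite fE ffunE.
  case: (eqVneq (h v v) 0) => hv; [right|left]; rewrite fp; apply: imset_f; rewrite inE /=.
    by rewrite /isopair hu hv huv ind eqxx.
  by rewrite u0 hu h_sym0 huv ind hv eqxx.
have main u v : u != 0 -> h u u = 0 -> h u v = 0 -> indep u v ->
    [/\ quad (prodff (u, v)), hasplane (prodff (u, v)) & #|isozeros (prodff (u, v))| ==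
      second_isozeros].
  move=> u0 hu huv ind; have E : prodff (u, v) =1 prodf u v by move=> z; rewrite ffunE.
  rewrite (isozeros_eq E) prodf_count_perp // eqxx; split=> //.
    have /quadP[Q1 Q2] := prodf_quad u v.
    by apply/quadP; split=> *; rewrite /pol !E; [apply: Q1|apply: Q2].
  have /existsP[w /andP[w0 /forallP W]] := prodf_hasplane v u0.
  by apply/existsP; exists w; rewrite w0; apply/forallP => z; rewrite E.
case=> /imsetP[[u v]]; rewrite inE /=.
  case/and5P => u0 /eqP hu /eqP hvu ind _ ->; apply: main => //.
  by rewrite -hC hvu bar0.
case/and4P => /eqP hu _ /eqP huv ind ->; apply: main => //.
exact: indep_neq0l ind.
Qed.

(** Mixed products number (t^4 - 1)(t^3 + 1) t^2 (t^2 - t), products of isotropic factors half of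
    (t^4 - 1)(t^3 + 1) t^2 (t + 1); doubling avoids the division. Unique factorisation keeps the two
    kinds apart. *)
Lemma card_second_plane : (2 * #|second_plane| =
  (t ^ 4 - 1) * (t ^ 3 + 1) * t ^ 2 * (2 * t ^ 2 + 1 - t))%N.
Proof.
have t1 := t_gt1; have t0 := ltnW t1.
have q0 := t2B1_gt0.
rewrite second_planeE cardsU (_ : _ :&: _ = set0) ?cards0 ?subn0; last first.
  apply/setP => f; rewrite !inE; apply/negbTE/negP => /andP[].
  move=> /imsetP[[u v] /[!inE] /= /and5P[u0 hu hvu ind hv] ->].
  case/imsetP=> -[u' v'] /[!inE] /= /and4P[hu' hv' _ ind'] /prodff_eq /= e.
  have e' x : prodf u' v' x = prodf u v x by rewrite e.
  have [c [c0 [[uE vE]|[uE vE]]]] :=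
      prodf_inj (indep_neq0l ind') (indep_neq0r ind') u0 (indep_neq0r ind) e'.
    by case/negP: hv; rewrite vE !hE (eqP hv') !mulr0.
  by case/negP: hv; rewrite vE !hE (eqP hu') !mulr0.
have e1 := card_imset_fibres mixed_fibre; have e2 := card_imset_fibres iso_fibre.
rewrite card_mixed_pairs in e1; rewrite (card_isopairs) in e2.
have E1 : (#|prodff @: mixed_pairs| = (t ^ 4 - 1) * (t ^ 3 + 1) * (t ^ 2 * (t ^ 2 - t)))%N.
  apply/eqP; rewrite -(eqn_pmul2r q0) e1 -[X in _ == X]mulnA; apply/eqP; congr (_ * _)%N.
  have -> : (t ^ 4 = t ^ 2 * t ^ 2)%N by rewrite -expnD.
  have -> : (t ^ 6 = t ^ 2 * (t ^ 2 * t ^ 2))%N by rewrite -!expnD.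
  have [k kE] : exists k, (t ^ 2 = t + k)%N.
    by exists (t ^ 2 - t)%N; rewrite subnKC // -{1}(expn1 t) leq_exp2l.
  have q1 : (1 <= t ^ 2)%N by rewrite expn_gt0 t0.
  rewrite kE addKn; rewrite kE in q1; move: q1; clear -t0; nia.
have E2 : (2 * #|prodff @: iso_pairs| = (t ^ 4 - 1) * (t ^ 3 + 1) * (t ^ 2 * t.+1))%N.
  apply/eqP; rewrite -(eqn_pmul2r q0) -[X in X == _]mulnA [X in X == _]mulnCA e2 -[X in _ ==
    X]mulnA; apply/eqP; congr (_ * _)%N.
  have -> : (t ^ 4 = t ^ 2 * t ^ 2)%N by rewrite -expnD.
  move: (t ^ 2)%N => q; have -> : (q * q - q = q * (q - 1))%N by rewrite mulnBr muln1.
  by ring.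
rewrite mulnDr E1 E2.
have : (t <= t ^ 2)%N by rewrite -{1}(expn1 t) leq_exp2l.
move=> le; rewrite -[RHS]mulnA mulnCA -mulnDr; congr (_ * _)%N.
by rewrite mulnCA -mulnDr; congr (_ * _)%N; lia.
Qed.

(** * Forms of second weight without planes *)

(** Pairs whose ratio is fixed by [bar] or infinite: the t + 1 points of a Baer subline. *)
Lemma card_sym_pairs :
  #|[set x : F * F | (x != (0, 0)) && (x.1 * bar x.2 == x.2 * bar x.1)]| =
  (t.+1 * (t ^ 2 - 1))%N.
Proof.
pose Q (x y : F) := ((x, y) != (0, 0)) && (x * bar y == y * bar x).
rewrite [LHS](_ : _ = #|[set x | predT x.1 && Q x.1 x.2]|); last first.
  by apply: eq_card => -[x y]; rewrite !inE.
rewrite (card_pair_sum predT Q) (bigD1 0) //= (eq_bigr (fun=> t)) => [|x /= x0]; last first.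
  apply: etrans (card_fixed).
  apply: (card_bij (f := fun y => y / x) (g := fun s => s * x)) => y;
    rewrite !inE /Q xpair_eqE (negbTE x0) /=.
    move=> /eqP e; rewrite divfK //; split=> //; rewrite barM barV.
    apply/eqP; apply: (mulIf x0); apply: (@mulIf _ (bar x)); first by rewrite bar_eq0.
    rewrite divfK // -e; field; by rewrite bar_eq0 x0.
  by move=> /eqP e; rewrite mulfK // barM e; split=> //; apply/eqP; ring.
rewrite sum_nat_cond_const.
have -> : #|[set i : F | i != 0]| = (t ^ 2 - 1)%N by exact: card_nonzero.
rewrite mulSn [(t * _)%N]mulnC; congr (_ + _)%N.
rewrite -(card_nonzero); apply: eq_card => y.
by rewrite !inE /Q xpair_eqE eqxx /= bar0 mul0r mulr0 eqxx andbT.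
Qed.

(* the scalar multiples of invertible 2x2 matrices over the fixed field of bar *)
Definition subline_mx := [set x : (F * F) * (F * F) |
  [&& x.1.1 * x.2.2 - x.1.2 * x.2.1 != 0, x.1.1 * bar x.1.2 == x.1.2 * bar x.1.1,
      x.2.1 * bar x.2.2 == x.2.2 * bar x.2.1 &
      x.1.1 * bar x.2.2 - x.1.2 * bar x.2.1 == x.2.2 * bar x.1.1 - x.2.1 * bar x.1.2]].

(** The first row is a scalar times a row over the fixed field. The second must be the same scalar
    times a row over that field independent of the first, which leaves t (t - 1) choices. *)
Lemma card_subline_mx : #|subline_mx| = (t.+1 * (t ^ 2 - 1) * (t * (t - 1)))%N.
Proof.
pose P (x : F * F) := (x != (0, 0)) && (x.1 * bar x.2 == x.2 * bar x.1).
pose Q (x y : F * F) := [&& x.1 * y.2 - x.2 * y.1 != 0, y.1 * bar y.2 == y.2 * bar y.1 &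
      x.1 * bar y.2 - x.2 * bar y.1 == y.2 * bar x.1 - y.1 * bar x.2].
have PQ x y : ((x, y) \in subline_mx) = P x && Q x y.
  rewrite inE /= /P /Q; case: (eqVneq x (0, 0)) => [->|_] /=.
    by rewrite !mul0r subrr eqxx.
  by rewrite andbCA.
transitivity #|[set p | P p.1 && Q p.1 p.2]|.
  by apply: eq_card => -[x y]; rewrite PQ inE.
rewrite -card_sym_pairs; apply: (card_pair_const (P := P)) => -[a b] /andP[ab /eqP /= eab].
have key : #|setX [set s | bar s == s] [set s | (s != 0) && (bar s == s)]| = (t * (t - 1))%N.
  by rewrite cardsX (card_fixed) (card_fixed_nonzero).
rewrite -key; case: (eqVneq a 0) => a0.
  have b0 : b != 0 by move: ab; rewrite a0 xpair_eqE eqxx.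
  have bb0 : bar b != 0 by rewrite bar_eq0.
  apply: (card_bij (f := fun y => (y.2 / b, y.1 / b)) (g := fun x => (x.2 * b, x.1 * b))).
    move=> [c d]; rewrite !inE /Q /= a0 bar0 !mul0r !mulr0 !sub0r.
    rewrite oppr_eq0 mulf_eq0 negb_or eqr_opp => /and3P[/andP[_ c0] /eqP ecd /eqP ecb].
    have ec : bar c = c / b * bar b.
      by apply: (mulfI b0); rewrite ecb; field.
    have ed : bar d = d / b * bar b.
      by apply: (mulfI c0); rewrite ecd ec; field.
    rewrite !barM !barV ec ed !divfK // mulf_eq0 invr_eq0 negb_or c0 b0 !mulfK //.
    by rewrite !eqxx.
  move=> [d c]; rewrite !inE /Q /= a0 bar0 !mul0r !mulr0 !sub0r => /and3P[/eqP d1 c0 /eqP c1].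
  rewrite oppr_eq0 !mulf_neq0 //= !mulfK // !barM d1 c1; split=> //.
  by apply/andP; split; apply/eqP; ring.
have ba0 : bar a != 0 by rewrite bar_eq0.
apply: (card_bij (f := fun y => (y.1 / a, y.2 / a - b / a * (y.1 / a)))
  (g := fun x => (a * x.1, b * x.1 + a * x.2))).
  move=> [c d]; rewrite !inE /Q /= => /and3P[D0 /eqP ecd /eqP e].
  have eb : bar b = b / a * bar a by apply: (mulfI a0); rewrite eab; field.
  have eD : bar (d / a - b / a * (c / a)) = d / a - b / a * (c / a).
    rewrite !barE !barV eb.
    apply: (mulfI a0); apply: (mulfI ba0).
    have {}e : a * bar d - b * bar c = d * bar a - c * (b / a * bar a) by rewrite e eb.
    transitivity (a * bar d - b * bar c); first by field; rewrite ba0 a0.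
    by rewrite e; field.
  have DE : a * (a * (d / a - b / a * (c / a))) = a * d - b * c by field.
  have Dn0 : d / a - b / a * (c / a) != 0.
    by apply: contraNneq D0 => z; rewrite -DE z !mulr0.
  have ec : bar (c / a) = c / a.
    have dE : d = b * (c / a) + a * (d / a - b / a * (c / a)) by field.
    move: ecd; rewrite dE; set D := d / a - b / a * (c / a) in eD Dn0 *; set g := c / a.
    have cE : c = a * g by rewrite /g mulrC divfK.
    clearbody D g.
    rewrite cE !barE eD eb => ecd.
    apply/esym/(mulIf Dn0)/(mulfI a0)/(mulfI ba0).
    apply/eqP; rewrite -subr_eq0; move/eqP: ecd; rewrite -subr_eq0.
    by congr (_ == 0); field.
  rewrite ec eD Dn0 !eqxx; split=> //; congr (_, _); first by rewrite mulrC divfK.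
  by field.
move=> [g D]; rewrite !inE /Q /= => /and3P[/eqP g1 D0 /eqP D1].
have eb : bar b = b / a * bar a by apply: (mulfI a0); rewrite eab; field.
rewrite !barE g1 D1 eb; split.
  apply/and3P; split.
  - have -> : a * (b * g + a * D) - b * (a * g) = a * a * D by ring.
    by rewrite !mulf_neq0.
  - by apply/eqP; field.
  by apply/eqP; field.
congr (_, _); first by rewrite mulrC mulKf.
by field.
Qed.

(** * The graph of lines of X in V(f) *)

Section FixedForm.
Variable f : V -> F.
Hypothesis qf : quad f.

Lemma nb_sym L M : L \in flines f -> M \in nb f L -> L \in nb f M.
Proof.
move=> LT /setIdP[MT /andP[ML /existsP[p /and3P[p0 pL pM]]]].
apply/setIdP; split=> //; rewrite eq_sym ML; apply/existsP; exists p.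
by rewrite p0 pM pL.
Qed.

Lemma line_meets_perp L u : L \in lines -> exists z, [/\ z != 0, z \in L & h z u = 0].
Proof.
move=> /linesP[x [y [ip ->]]].
case: (eqVneq (h x u) 0) => [hx|hx].
  by exists x; rewrite line_l // hx; split=> //; case/and4P: ip => _ _ _ /indep_neq0l.
exists (h y u *: x + (- h x u) *: y); split; last by rewrite !hE; ring.
  case/and4P: ip => _ _ _ /indepP ind; apply/eqP => /ind[_ /eqP].
  by rewrite oppr_eq0 (negbTE hx).
by apply/(lineP _ ip); exists (h y u), (- h x u).
Qed.

(* So the isotropic lines of V(f) form a complete bipartite graph under meeting:
   with p the point of L and M, V(f) meets the plane p^perp in L and M only. *)
Lemma third_line L M K : ~~ hasplane f -> L \in flines f -> M \in nb f L ->
  K \in flines f -> K != L -> K != M -> (K \in nb f L) != (K \in nb f M).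
Proof.
move=> np LT Mnb KT KL KM; have /flinesP[Ll fL] := LT; have /flinesP[Kl fK] := KT.
have [MT /andP[ML /existsP[p /and3P[p0 pL pM]]]] := setIdP Mnb.
have /flinesP[Ml fM] := MT.
have Msec : M \in second f L p by rewrite inE MT ML.
have [y [yL ip LE]] := lines_basis Ll pL p0.
have [e3 [e4 hy]] := isopair_extend ip; have H := hypE hy.
have fL' := fL; rewrite LE in fL'.
have [f1 f2 f12] := (vanishes_line qf ip).1 fL'.
have [s [ME b1 b24 str]] : exists s, [/\ M = line p (e4 + s *: y), pol f p e4 = 0,
    s * pol f y e4 + f e4 = 0 & s + bar s = 0].
  by apply/(second_line qf M hy fL'); rewrite -LE.
(* On p^perp the form is a multiple of the product of the equations of L and M. *)
have fperp z : h z p = 0 -> f z = h z y * (h z e4 - s * h z y) * pol f y e4.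
  move=> zp; rewrite {1}(hyp_coord z hy) zp scale0r addr0 !(quadE qf) f1 f2 f12 b1.
  have -> : f e4 = - (s * pol f y e4) by apply/eqP; rewrite -addr_eq0 addrC b24.
  ring.
have b2 : pol f y e4 != 0.
  apply: contra np => /eqP b2; apply/existsP; exists p; rewrite p0; apply/forallP => z.
  by apply/implyP => /eqP /fperp ->; rewrite b2 mulr0.
have mem_nb N z : N \in flines f -> K != N -> z != 0 -> z \in N -> z \in K -> K \in nb f N.
  move=> NT KN z0 zN zK; apply/setIdP; split=> //; rewrite KN; apply/existsP; exists z.
  by rewrite z0 zN.
(* K meets p^perp in a point where f vanishes, thus on L or on M. *)
have [z [z0 zK zp]] := line_meets_perp p Kl.
have : (K \in nb f L) || (K \in nb f M).
  have /eqP := fperp z zp; move/vanishesP: fK => -> //;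
    rewrite eq_sym !mulf_eq0 (negbTE b2) orbF.
  move=> /orP[zy|zs]; apply/orP; [left; apply: (mem_nb L z) => //|right;
    apply: (mem_nb M z) => //].
    by rewrite LE inE zp eqxx zy.
  rewrite ME; apply/lineP.
    apply: (lines_isopair Ml) => //.
      by rewrite ME inE !hE !H !(mulr0, mulr1, addr0, add0r) eqxx [bar s + s]addrC str eqxx.
    apply/indepP => k l; rewrite scalerDr scalerA => /(f_equal (fun z => (h z e3, h z y))).
    by rewrite !hE !H !(mulr0, mulr1, addr0, add0r) => -[-> ->].
  exists (h z e3), (h z y); rewrite {1}(hyp_coord z hy) zp scale0r addr0.
  rewrite subr_eq0 in zs; rewrite (eqP zs) scalerDr scalerA [h z y * s]mulrC.
  by rewrite addrAC addrA.
case KnL : (K \in nb f L); case KnM : (K \in nb f M) => //= _.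
have [_ /andP[_ /existsP[z1 /and3P[z10 z1L z1K]]]] := setIdP KnL.
have [_ /andP[_ /existsP[z2 /and3P[z20 z2M z2K]]]] := setIdP KnM.
(* The point p already carries L and M, and [perpzeros_second] allows no third line through it. *)
have pK : p \notin K.
  apply/negP => pK; have Ksec : K \in second f L p by rewrite inE KT KL.
  have pL0 : p \in L :\ 0 by rewrite !inE p0.
  have [_ le] := perpzeros_second qf np LT pL0.
  have /card_le1_eqP := leq_trans le (leq_b1 _).
  by move/(_ K M Ksec Msec)/eqP; rewrite eq_sym (negbTE KM).
have z1y : h z1 y = 0 by apply: (lines_perp Ll).
have z1p0 : h z1 p = 0 by apply: (lines_perp Ll).
have z14 : h z1 e4 != 0.
  apply: contraNneq pK => e; have z1E := hyp_coord z1 hy.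
  rewrite z1p0 z1y e !scale0r !addr0 in z1E.
  have c0 : h z1 e3 != 0 by apply: contraNneq z10 => c0; rewrite z1E c0 scale0r.
  by rewrite -[p](scalerK c0) -z1E (linesZ _ Kl).
have z12 : h z1 z2 = 0 by apply: (lines_perp Kl).
have z2p0 : h z2 p = 0 by apply: (lines_perp Ml).
have z2y : h z2 y != 0.
  apply: contraNneq pK => z2y; have z2E := hyp_coord z2 hy.
  have z2L : z2 \in L by rewrite LE inE z2p0 z2y eqxx.
  have [c zE] := indepN p0 (lines_meet Ll Ml (negbT (etrans (eq_sym _ _) (negbTE ML))) pL z2L
    pM z2M).
  have c0 : c != 0 by apply: contraNneq z20 => c0; rewrite zE c0 scale0r.
  by rewrite -[p](scalerK c0) -zE (linesZ _ Kl).
(* If K meets L in z1 and M in z2, these are orthogonal as points of K; but a point of L and a point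
   of M, both different from p, never are. *)
have := z12; rewrite (hyp_coord z1 hy) z1p0 z1y !scale0r !addr0 hDl !hZl.
rewrite -(hC z2 p) -(hC z2 y) z2p0 bar0 mulr0 add0r => /eqP.
by rewrite mulf_eq0 bar_eq0 (negbTE z14) (negbTE z2y).
Qed.

End FixedForm.

Section FixedForm.
Variable f : V -> F.
Hypothesis qf : quad f.
Hypothesis np : ~~ hasplane f.
Hypothesis Nf : #|isozeros f| = second_isozeros.

Lemma card_nb L : L \in flines f -> #|nb f L| = t.+1.
Proof. by move=> LT; have [_ [[H _] _]] := noplane_bound qf np LT; exact: H. Qed.

Lemma flines_nonempty : exists L, L \in flines f.
Proof.
case: (noplane_noline_or_line qf) => // nl.
have := noline_bound qf nl; rewrite Nf.
have t1 := t_gt1; have q0 := t2B1_gt0.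
rewrite /second_isozeros mulnAC [X in (_ <= X)%N]mulnC leq_pmul2l // mulnDr muln1.
have : (2 ^ 2 <= t ^ 2)%N by rewrite leq_exp2r.
lia.
Qed.

(** In the extremal case, the other lines in the class of L in the bipartite graph. *)
Definition skew L := [set M in flines f | (M != L) && (M \notin nb f L)].

(** For a neighbour M of L, [third_line] identifies the lines skew to L with the t neighbours of M
    other than L. *)
Lemma card_skew L : L \in flines f -> #|skew L| = t.
Proof.
move=> LT; have cnb := card_nb LT.
have /card_gt0P[M Mnb] : (0 < #|nb f L|)%N by rewrite cnb.
have /setIdP[MT /andP[ML _]] := Mnb.
have LnbM := nb_sym LT Mnb.
have -> : skew L = nb f M :\ L.
  apply/setP => K; rewrite in_setD1; apply/setIdP/andP.
    move=> [KT /andP[KL Knb]]; split=> //.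
    have KM : K != M by apply: contraNneq Knb => ->.
    by have := third_line qf np LT Mnb KT KL KM; rewrite (negbTE Knb); case: (K \in nb f M).
  move=> [KL KnbM]; have /setIdP[KT /andP[KM _]] := KnbM; split=> //; rewrite KL /=.
  by have := third_line qf np LT Mnb KT KL KM; rewrite KnbM; case: (K \in nb f L).
by have := card_nb MT; rewrite (cardsD1 L) LnbM add1n => -[].
Qed.

Lemma card_flines : #|flines f| = (2 * t.+1)%N.
Proof.
have [L LT] := flines_nonempty.
rewrite (cardsD1 L) LT -(cardsID (nb f L) (flines f :\ L)).
have -> : (flines f :\ L) :&: nb f L = nb f L.
  by apply/setP => M; rewrite !inE; case: (M == L) => //=;
    rewrite ?andbF ?andbT // andbA andbb.
have -> : (flines f :\ L) :\: nb f L = skew L.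
  by apply/setP => M; rewrite in_setD in_setD1 /skew inE; case: (M \notin _); case: (M != L);
    rewrite ?andbF ?andbT.
by rewrite card_nb // card_skew //; lia.
Qed.

Definition skew_pairs :=
  [set x : {set V} * {set V} | (x.1 \in flines f) && (x.2 \in skew x.1)].

Lemma card_skew_pairs : #|skew_pairs| = (2 * t.+1 * t)%N.
Proof.
rewrite /skew_pairs (card_pair_const (P := mem (flines f)) (Q := fun L M => M \in skew L) (n
  := t)).
  by rewrite -card_flines; congr (_ * _)%N; apply: eq_card => L; rewrite inE.
by move=> L LT; rewrite -[RHS](card_skew LT); apply: eq_card => M; rewrite inE.
Qed.

Lemma skew_disjoint L M z : M \in skew L -> z \in L -> z \in M -> z = 0.
Proof.
move=> /setIdP[MT /andP[ML Mnb]] zL zM; apply/eqP; apply: contraNT Mnb => z0.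
by apply/setIdP; split=> //; rewrite ML; apply/existsP; exists z; rewrite z0 zL.
Qed.

End FixedForm.

(** * Hyperbolic bases adapted to a form *)

Lemma dual_basis e1 e2 M : isopair e1 e2 -> M \in lines ->
  (forall z, z \in line e1 e2 -> z \in M -> z = 0) ->
  exists e3 e4, hyp e1 e2 e3 e4 /\ M = line e3 e4.
Proof.
move=> ip Ml disj; have [x [y [ipM ME]]] := linesP Ml.
have ipM' := ipM; case/and4P: ipM' => _ _ _ /indepP indM.
have zero a b : a * h x e1 + b * h y e1 = 0 -> a * h x e2 + b * h y e2 = 0 -> a = 0 /\ b = 0.
  move=> z1 z2; apply: indM; apply: disj; last by rewrite ME; apply/(lineP _ ipM); exists a, b.
  by rewrite inE !hE z1 z2 eqxx.
(* The determinant of the pairing between the two lines. It is nonzero because a vector of M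
   orthogonal to e1 and e2 lies on both lines; e3 and e4 are then found by Cramer's rule. *)
set D := h x e1 * h y e2 - h x e2 * h y e1.
have D0 : D != 0.
  apply/eqP => D0.
  have E1 : h y e1 = 0 /\ - h x e1 = 0.
    by apply: zero; [ring | rewrite -[RHS]oppr0 -D0 /D; ring].
  have E2 : h y e2 = 0 /\ - h x e2 = 0.
    by apply: zero; [rewrite -[RHS]D0 /D; ring | ring].
  case: E1 E2 => _ /eqP; rewrite oppr_eq0 => /eqP x1 [_ /eqP].
  rewrite oppr_eq0 => /eqP x2.
  have [] := zero 1 0; rewrite ?x1 ?x2 ?mulr0 ?mul0r ?addr0 //.
  by move/eqP; rewrite oner_eq0.
have [e3 [e3M h31 h32]] : exists e3, [/\ e3 \in M, h e3 e1 = 1 & h e3 e2 = 0].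
  exists ((h y e2 / D) *: x + (- (h x e2 / D)) *: y); split.
  - by rewrite ME; apply/(lineP _ ipM); eexists; eexists.
  - by rewrite !hE; transitivity (D / D); [rewrite {3}/D; ring | rewrite divff].
  by rewrite !hE; ring.
have [e4 [e4M h41 h42]] : exists e4, [/\ e4 \in M, h e4 e1 = 0 & h e4 e2 = 1].
  exists ((- (h y e1 / D)) *: x + (h x e1 / D) *: y); split.
  - by rewrite ME; apply/(lineP _ ipM); eexists; eexists.
  - by rewrite !hE; ring.
  by rewrite !hE; transitivity (D / D); [rewrite {3}/D; ring | rewrite divff].
have hy : hyp e1 e2 e3 e4.
  case/and4P: ip => /eqP h11 /eqP h22 /eqP h12 _.
  rewrite /hyp h11 h22 h12 (h_sym h31) (h_sym h32) (h_sym h41) (h_sym h42).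
  by rewrite !(lines_perp Ml) // bar0 bar1 !eqxx.
exists e3, e4; split=> //; apply: lines_eq => //.
by have /hyp_isopair /and4P[] := hyp_swap hy.
Qed.

(* f is a multiple of x1 x3 + x2 x4 in the coordinates of the hyperbolic basis e *)
Definition adapted (f : V -> F) (e : (V * V) * (V * V)) :=
  [&& hyp e.1.1 e.1.2 e.2.1 e.2.2, vanishes f (line e.1.1 e.1.2), vanishes f (line e.2.1
    e.2.2),
      pol f e.1.1 e.2.2 == 0, pol f e.1.2 e.2.1 == 0 & pol f e.1.1 e.2.1 == pol f e.1.2 e.2.2].

Lemma adaptedE f e1 e2 e3 e4 x : quad f -> adapted f ((e1, e2), (e3, e4)) ->
  f x = pol f e1 e3 * (h x e3 * h x e1 + h x e4 * h x e2).
Proof.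
move=> qf /and5P[/= hy fL fM /eqP b14 /andP[/eqP b23 /eqP b24]].
have [f1 f2 f12] := (vanishes_line qf (hyp_isopair hy)).1 fL.
have [f3 f4 f34] := (vanishes_line qf (hyp_isopair (hyp_swap hy))).1 fM.
rewrite {1}(hyp_coord x hy) !(quadE qf) f1 f2 f3 f4 f12 f34 b14 b23 -b24; ring.
Qed.

(** A change of basis on the first line induces its inverse conjugate transpose on the second. *)
Lemma hyp_change e1 e2 e3 e4 a b c d : hyp e1 e2 e3 e4 -> a * d - b * c != 0 ->
  hyp (a *: e1 + b *: e2) (c *: e1 + d *: e2)
      (bar (d / (a * d - b * c)) *: e3 + bar (- (c / (a * d - b * c))) *: e4)
      (bar (- (b / (a * d - b * c))) *: e3 + bar (a / (a * d - b * c)) *: e4).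
Proof.
move=> hy D0; have H := hypE hy.
rewrite /hyp !hE !H !barK !(mulr0, mulr1, addr0, add0r) !eqxx /= andbT.
by apply/and4P; split; apply/eqP; field; exact: D0.
Qed.

Lemma hyp_unique e1 e2 e3 e4 y3 y4 : hyp e1 e2 e3 e4 -> hyp e1 e2 y3 y4 ->
  y3 \in line e3 e4 -> y4 \in line e3 e4 -> y3 = e3 /\ y4 = e4.
Proof.
move=> hy hy'; have H := hypE hy; have H' := hypE hy'.
rewrite !inE => /andP[/eqP a1 /eqP a2] /andP[/eqP b1 /eqP b2]; split.
  by rewrite [LHS](hyp_coord y3 hy) a1 a2 !H' !scale0r scale1r addr0 !add0r.
by rewrite [LHS](hyp_coord y4 hy) b1 b2 !H' !scale0r scale1r !add0r.
Qed.

(** Two adapted bases with the same lines differ by a matrix on the first line, which determines the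
    change on the second. The three conditions on [pol] then become the three equations of
    [subline_mx]. *)
Lemma card_adapted_fibre f e : quad f -> ~~ hasplane f -> adapted f e ->
  #|[set e' | [&& adapted f e', line e'.1.1 e'.1.2 == line e.1.1 e.1.2
                & line e'.2.1 e'.2.2 == line e.2.1 e.2.2]]| =
  (t.+1 * (t ^ 2 - 1) * (t * (t - 1)))%N.
Proof.
case: e => [[e1 e2] [e3 e4]] qf np ad /=; rewrite -(card_subline_mx).
have ad' := ad; move: ad' => /and5P[/= hy fL fM /eqP b14 /andP[/eqP b23 /eqP b24]].
have H := hypE hy; have ip := hyp_isopair hy.
have ip' := hyp_isopair (hyp_swap hy).
have Ll := mem_lines ip; have Ml := mem_lines ip'.
have [f1 f2 f12] := (vanishes_line qf ip).1 fL.
have [f3 f4 f34] := (vanishes_line qf ip').1 fM.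
have B0 : pol f e1 e3 != 0.
  apply: contra np => /eqP B0; apply/existsP; exists e1.
  case/and4P: ip => _ _ _ /indep_neq0l ->; apply/forallP => z; apply/implyP => _.
  by rewrite (adaptedE z qf ad) B0 mul0r.
pose D (x : (F * F) * (F * F)) := x.1.1 * x.2.2 - x.1.2 * x.2.1.
pose g (x : (F * F) * (F * F)) : (V * V) * (V * V) :=
  ((x.1.1 *: e1 + x.1.2 *: e2, x.2.1 *: e1 + x.2.2 *: e2),
   (bar (x.2.2 / D x) *: e3 + bar (- (x.2.1 / D x)) *: e4,
    bar (- (x.1.2 / D x)) *: e3 + bar (x.1.1 / D x) *: e4)).
have polg a b x y : pol f (a *: e1 + b *: e2) (x *: e3 + y *: e4) =
    pol f e1 e3 * (a * x + b * y).
  by rewrite !(quadE qf) b14 b23 -b24; ring.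
apply: (card_bij (f := fun e => ((h e.1.1 e3, h e.1.1 e4), (h e.1.2 e3, h e.1.2 e4))) (g :=
  g)).
  move=> [[y1 y2] [y3 y4]]; rewrite inE /= => /and3P[adY /eqP LE /eqP ME].
  have /and5P[/= hY fLY fMY /eqP c14 /andP[/eqP c23 /eqP c24]] := adY.
  have ipY := hyp_isopair hY.
  have := line_l ipY; rewrite LE => /(lineP _ ip)[a [b y1E]].
  have := line_r ipY; rewrite LE => /(lineP _ ip)[c [d y2E]].
  have := line_l (hyp_isopair (hyp_swap hY)).
  rewrite ME => y3M; have /(lineP _ ip')[p [q y3E]] := y3M.
  have := line_r (hyp_isopair (hyp_swap hY)).
  rewrite ME => y4M; have /(lineP _ ip')[p' [q' y4E]] := y4M.
  have HY := hypE hY.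
  (* Up to conjugation the determinants on the two lines are inverse to each other, so the first is
     nonzero. *)
  have E : (a * d - b * c) * (bar p * bar q' - bar q * bar p') = 1.
    have E13 : h y1 y3 = 1 by rewrite HY.
    have E14 : h y1 y4 = 0 by rewrite HY.
    have E23 : h y2 y3 = 0 by rewrite HY.
    have E24 : h y2 y4 = 1 by rewrite HY.
    move: E13 E14 E23 E24; rewrite y1E y2E y3E y4E !hE !H !(mulr0, mulr1, addr0, add0r).
    move=> E13 E14 E23 E24.
    transitivity (h y1 y3 * h y2 y4 - h y1 y4 * h y2 y3); last by rewrite !HY; ring.
    rewrite y1E y2E y3E y4E !hE !H; ring.
  have D0 : a * d - b * c != 0.
    by apply: contraTneq (oner_neq0 F) => D0; rewrite -E D0 mul0r eqxx.
  have y1e3 : h y1 e3 = a by rewrite y1E !hE !H !(mulr0, mulr1, addr0, add0r).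
  have y1e4 : h y1 e4 = b by rewrite y1E !hE !H !(mulr0, mulr1, addr0, add0r).
  have y2e3 : h y2 e3 = c by rewrite y2E !hE !H !(mulr0, mulr1, addr0, add0r).
  have y2e4 : h y2 e4 = d by rewrite y2E !hE !H !(mulr0, mulr1, addr0, add0r).
  have hc := hyp_change hy D0; rewrite -y1E -y2E in hc.
  have [y3U y4U] : y3 = bar (d / (a * d - b * c)) *: e3 + bar (- (c / (a * d - b * c))) *: e4
    /\
      y4 = bar (- (b / (a * d - b * c))) *: e3 + bar (a / (a * d - b * c)) *: e4.
    have LE' : line e3 e4 = line (bar (d / (a * d - b * c)) *: e3 + bar (- (c / (a * d - b *
      c))) *: e4)
      (bar (- (b / (a * d - b * c))) *: e3 + bar (a / (a * d - b * c)) *: e4).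
      apply: lines_eq => //; first by apply/(lineP _ ip'); eexists; eexists.
        by apply/(lineP _ ip'); eexists; eexists.
      by have /hyp_isopair /and4P[] := hyp_swap hc.
    by apply: (hyp_unique hc hY); rewrite -LE'.
  rewrite /g /D /= y1e3 y1e4 y2e3 y2e4; split; last by rewrite -y1E -y2E -y3U -y4U.
  have bD0 : bar (a * d - b * c) != 0 by rewrite bar_eq0.
  rewrite inE /= D0 /=.
  move: c14 c23 c24; rewrite y1E y2E y3U y4U !polg !barM !barV !barN !barM !barV => c14 c23
    c24.
  apply/and3P; split; apply/eqP; apply: (mulfI B0); apply: (mulIf (invr_neq0 bD0)).
  - apply/eqP; rewrite -subr_eq0; apply/eqP; rewrite -[RHS]oppr0 -c14; ring.
  - apply/eqP; rewrite -subr_eq0; apply/eqP; rewrite -c23; ring.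
  transitivity (pol f e1 e3 * (a * (bar d * (bar (a * d - b * c))^-1) + b * - (bar c * (bar
    (a * d - b * c))^-1))).
    by ring.
  by rewrite c24; ring.
move=> [[a b] [c d]]; rewrite [_ \in subline_mx]inE /= => /and4P[D0 /eqP eab /eqP ecd /eqP
  ead].
have hc := hyp_change hy D0.
have bD0 : bar (a * d - b * c) != 0 by rewrite bar_eq0.
rewrite /g /D /= !hE !H !(mulr0, mulr1, addr0, add0r); split=> //.
rewrite inE /= /adapted /= hc.
have <- : line e1 e2 = line (a *: e1 + b *: e2) (c *: e1 + d *: e2).
  apply: lines_eq => //; try by apply/(lineP _ ip); eexists; eexists.
  by have /hyp_isopair /and4P[] := hc.
have <- : line e3 e4 = line (bar (d / (a * d - b * c)) *: e3 + bar (- (c / (a * d - b * c)))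
  *: e4)
      (bar (- (b / (a * d - b * c))) *: e3 + bar (a / (a * d - b * c)) *: e4).
  apply: lines_eq => //; try by apply/(lineP _ ip'); eexists; eexists.
  by have /hyp_isopair /and4P[] := hyp_swap hc.
rewrite fL fM !eqxx !andbT /= !polg !barM !barV !barN !barM !barV.
apply/and3P; split; apply/eqP.
- transitivity (pol f e1 e3 / bar (a * d - b * c) * (b * bar a - a * bar b)); first by ring.
  by rewrite eab subrr mulr0.
- transitivity (pol f e1 e3 / bar (a * d - b * c) * (c * bar d - d * bar c)); first by ring.
  by rewrite ecd subrr mulr0.
transitivity (pol f e1 e3 / bar (a * d - b * c) * (a * bar d - b * bar c)); first by ring.
by rewrite ead; ring.
Qed.

Lemma tangZ f c p : quad f -> c != 0 -> tang f (c *: p) = tang f p.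
Proof.
move=> qf c0; apply: eq_forallb => z.
by rewrite !hE mulf_eq0 bar_eq0 (negbTE c0) (polZl qf) mulf_eq0 (negbTE c0).
Qed.

Definition multiples (p : V) := [set c *: p | c in [set c : F | c != 0]].

Lemma card_multiples p : p != 0 -> #|multiples p| = (t ^ 2 - 1)%N.
Proof.
move=> p0; rewrite card_imset ?(card_nonzero) // => s s' /eqP.
by rewrite -subr_eq0 -scalerBl scaler_eq0 (negbTE p0) orbF subr_eq0 => /eqP.
Qed.

Lemma indep_multiples p q : p != 0 -> q != 0 -> q \notin multiples p -> indep p q.
Proof.
move=> p0 q0; apply: contraNT => /(indepN p0)[c qE]; apply/imsetP; exists c => //.
by rewrite inE; apply: contra q0 => /eqP c0; rewrite qE c0 scale0r.
Qed.

(** Two directions account for only 2 (t^2 - 1) nonzero vectors, so a larger set contains a vector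
    of a third. *)
Lemma three_directions (R : {set V}) : (2 * (t ^ 2 - 1) < #|R|)%N -> 0 \notin R ->
  exists p q r, [/\ p \in R, q \in R, r \in R, indep p q & indep p r /\ indep q r].
Proof.
move=> cR R0; have nz p : p \in R -> p != 0 by move=> pR; apply: contraNneq R0 => <-.
have pick (A : {set V}) : (#|A| <= 2 * (t ^ 2 - 1))%N -> exists2 p, p \in R & p \notin A.
  move=> cA; have /card_gt0P[p] : (0 < #|R :\: A|)%N.
    rewrite cardsD subn_gt0 (leq_ltn_trans _ cR) // (leq_trans _ cA) //.
    by rewrite subset_leq_card // subsetIr.
  by rewrite in_setD => /andP[pA pR]; exists p.
have [|p pR _] := pick set0; first by rewrite cards0.
have [|q qR qp] := pick (multiples p).
  by rewrite card_multiples ?nz // mul2n -addnn leq_addr.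
have [|r rR] := pick (multiples p :|: multiples q).
  rewrite cardsU (leq_trans (leq_subr _ _)) // !card_multiples ?nz //.
  by rewrite mul2n addnn.
rewrite in_setU negb_or => /andP[rp rq]; exists p, q, r.
by split=> //; try split; apply: indep_multiples; rewrite ?nz.
Qed.

(** L has t + 1 >= 3 tangent points. Scale two of them to e1 and e2 so that the third is e1 + e2;
    the tangency equation at (1, 0), (0, 1) and (1, 1) gives exactly the conditions of [adapted] on
    [pol]. *)
Lemma adapted_exists (f : V -> F) L M : quad f -> ~~ hasplane f -> #|isozeros f| =
  second_isozeros ->
  (L, M) \in skew_pairs f ->
  exists e1 e2 e3 e4, [/\ adapted f ((e1, e2), (e3, e4)), L = line e1 e2 & M = line e3 e4].
Proof.
move=> qf np Nf; rewrite inE /= => /andP[LT LM].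
have [_ [_ cR]] := noplane_bound qf np LT.
have {}cR := cR (card_nb qf np Nf LT).
have /flinesP[Ll fL] := LT.
have /setIdP[/flinesP[Ml fM] _] := LM.
have disj z : z \in L -> z \in M -> z = 0 by apply: (skew_disjoint LM).
have t1 := t_gt1; have q0 := t2B1_gt0.
have [||p [q [r [pR qR rR ipq [ipr iqr]]]]] := @three_directions [set p in L :\ 0 | tang f p].
- by rewrite cR ltn_pmul2r.
- by rewrite !inE eqxx.
have [/setD1P[p0 pL] tp] := setIdP pR; have [/setD1P[q0' qL] tq] := setIdP qR.
have [/setD1P[r0 rL] tr] := setIdP rR.
have LE := lines_eq Ll pL qL ipq; have ip := lines_isopair Ll pL qL ipq.
have /(lineP _ ip)[a [b rE]] : r \in line p q by rewrite -LE.
have a0 : a != 0.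
  apply/eqP => a0; move: iqr => /andP[_ /forallP/(_ b)].
  by rewrite rE a0 scale0r add0r eqxx.
have b0 : b != 0.
  apply/eqP => b0; move: ipr => /andP[_ /forallP/(_ a)].
  by rewrite rE b0 scale0r addr0 eqxx.
have ind : indep (a *: p) (b *: q) by rewrite indep_scale.
have aL : a *: p \in L by apply: linesZ Ll pL.
have bL : b *: q \in L by apply: linesZ Ll qL.
have ip' := lines_isopair Ll aL bL ind; have LE' := lines_eq Ll aL bL ind.
have [|e3 [e4 [hy ME]]] := dual_basis ip' Ml.
  by move=> z; rewrite -LE'; apply: disj.
exists (a *: p), (b *: q), e3, e4; split=> //.
have fL' : vanishes f (line (a *: p) (b *: q)) by rewrite -LE'.
have one0 : (1, 0) != (0, 0) :> F * F by rewrite xpair_eqE oner_eq0.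
have zero1 : (0, 1) != (0, 0) :> F * F by rewrite xpair_eqE oner_eq0 andbF.
have one1 : (1, 1) != (0, 0) :> F * F by rewrite xpair_eqE oner_eq0.
have := tang_sesqui qf hy fL' one0; have := tang_sesqui qf hy fL' zero1.
have := tang_sesqui qf hy fL' one1.
rewrite !scale1r !scale0r addr0 add0r -rE !tangZ // tp tq tr bar0 bar1.
rewrite !(mulr0, mul0r, mulr1, addr0, add0r) => /esym/eqP e11 /esym/eqP e01 /esym/eqP e10.
apply/and5P; split=> //=; first by rewrite -ME.
  by rewrite e10.
apply/andP; split; first by rewrite -oppr_eq0 e01.
move/eqP: e11; rewrite e10 e01 add0r addr0 addrC subr_eq0 eq_sym => /eqP ->.
by [].
Qed.

(** Each adapted basis determines an ordered pair of skew lines of V(f), and each such pair arises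
    from equally many bases. *)
Lemma card_adapted f : quad f -> ~~ hasplane f -> #|isozeros f| = second_isozeros ->
  #|[set e | adapted f e]| =
  (2 * t.+1 * t * (t.+1 * (t ^ 2 - 1) * (t * (t - 1))))%N.
Proof.
move=> qf np Nf; rewrite -(card_skew_pairs qf np Nf).
pose Q (x : {set V} * {set V}) e := [&& adapted f e, line e.1.1 e.1.2 == x.1
                & line e.2.1 e.2.2 == x.2].
pose Q' (e : (V * V) * (V * V)) (x : {set V} * {set V}) :=
  x == (line e.1.1 e.1.2, line e.2.1 e.2.2).
have := @double_count _ _ (mem (skew_pairs f)) Q (adapted f) Q'
  (t.+1 * (t ^ 2 - 1) * (t * (t - 1)))%N 1%N.
rewrite muln1 => <-.
- by congr (_ * _)%N; apply: eq_card => x; rewrite inE.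
- move=> [L M] [[e1 e2] [e3 e4]]; rewrite /Q /Q' /= xpair_eqE [L == _]eq_sym [M == _]eq_sym.
  case ad: (adapted _ _); rewrite ?andbF //=.
  case: eqP => [LE|]; last by rewrite andbF.
  case: eqP => [ME|]; rewrite ?andbF ?andbT //.
  have /and5P[/= hy fL fM _ _] := ad.
  have Ll := mem_lines (hyp_isopair hy).
  have Ml := mem_lines (hyp_isopair (hyp_swap hy)).
  rewrite LE in fL Ll; rewrite ME in fM Ml.
  have disj z : z \in L -> z \in M -> z = 0.
    rewrite -LE -ME !inE => /andP[/eqP a1 /eqP a2] /andP[/eqP a3 /eqP a4].
    by rewrite (hyp_coord z hy) a1 a2 a3 a4 !scale0r !addr0.
  rewrite inE /= inE Ll fL /=; apply/setIdP; split; first by apply/flinesP.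
  apply/andP; split; last first.
    apply/negP => /setIdP[_ /andP[_ /existsP[z /and3P[z0 zL zM]]]].
    by case/eqP: z0; apply: disj.
  apply/eqP => E; have ip := hyp_isopair hy.
  have e1L : e1 \in L by rewrite -LE line_l.
  have e10 : e1 = 0 by apply: disj; rewrite ?E.
  by move: ip; rewrite e10 => /and4P[_ _ _ /indep_neq0l]; rewrite eqxx.
- move=> [L M] /(adapted_exists qf np Nf)[e1 [e2 [e3 [e4 [ad -> ->]]]]].
  by rewrite -(card_adapted_fibre qf np ad).
by move=> e _; rewrite /Q' (_ : [set x | _] = [set (line e.1.1 e.1.2, line e.2.1 e.2.2)])
  ?cards1 //;
  apply/setP => x; rewrite !inE.
Qed.

(** * The normal form and the number of such forms *)

Definition normal_form e b : {ffun V -> F} :=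
  [ffun x => b * (h x e.2.1 * h x e.1.1 + h x e.2.2 * h x e.1.2)].

Lemma normal_form_pol (e : (V * V) * (V * V)) b x y : pol (normal_form e b) x y =
  b * (h x e.2.1 * h y e.1.1 + h y e.2.1 * h x e.1.1 +
       (h x e.2.2 * h y e.1.2 + h y e.2.2 * h x e.1.2)).
Proof. by rewrite /pol !ffunE !hE; ring. Qed.

Lemma normal_form_quad e b : quad (normal_form e b).
Proof.
apply/quadP; split=> [a x|a x y z]; first by rewrite !ffunE !hE; ring.
by rewrite !normal_form_pol !hE; ring.
Qed.

Lemma normal_form_adapted e1 e2 e3 e4 b : hyp e1 e2 e3 e4 -> adapted (normal_form ((e1, e2),
  (e3, e4)) b) ((e1, e2), (e3, e4)).
Proof.
move=> hy; have H := hypE hy; apply/and5P; split=> //=.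
- apply/(vanishes_line (normal_form_quad _ _) (hyp_isopair hy)).
  by rewrite normal_form_pol !ffunE /= !H; split; ring.
- apply/(vanishes_line (normal_form_quad _ _) (hyp_isopair (hyp_swap hy))).
  by rewrite normal_form_pol !ffunE /= !H; split; ring.
- by rewrite normal_form_pol /= !H; apply/eqP; ring.
by rewrite !normal_form_pol /= !H; apply/andP; split; apply/eqP; ring.
Qed.

(** Suppose f is the product given by u and v. Since f e1 = 0 and pol f e1 e3 is nonzero, exactly
    one factor vanishes at e1, say that of v. Then pol f e1 y is a nonzero multiple of h y v, so v
    is orthogonal to e2 and e4, although pol f e2 e4 is nonzero. *)
Lemma adapted_noplane f e1 e2 e3 e4 : quad f -> adapted f ((e1, e2), (e3, e4)) ->
  pol f e1 e3 != 0 -> ~~ hasplane f.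
Proof.
move=> qf ad b0; apply/negP => pf.
have /and5P[/= hy fL fM /eqP b14 /andP[/eqP b23 /eqP b24]] := ad.
have [f1 f2 f12] := (vanishes_line qf (hyp_isopair hy)).1 fL.
have [f3 f4 f34] := (vanishes_line qf (hyp_isopair (hyp_swap hy))).1 fM.
have [u [v [_ fE]]] := hasplane_prodf qf pf.
have B x y : h x u * h y v + h y u * h x v = pol f x y.
  by rewrite -prodf_pol /pol !fE.
have Z x : f x = 0 -> (h x u == 0) || (h x v == 0).
  by rewrite fE -mulf_eq0 => /eqP.
have b24' : pol f e2 e4 != 0 by rewrite -b24.
wlog u1 : u v fE B Z / h e1 u != 0 => [W|].
  case/orP: (Z _ f1) => u1; last first.
    case: (eqVneq (h e1 u) 0) => u1'; last exact: (W u v).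
    by move: b0; rewrite -B u1' (eqP u1) !(mulr0, mul0r) addr0 eqxx.
  case: (eqVneq (h e1 v) 0) => v1.
    by move: b0; rewrite -B v1 (eqP u1) !(mulr0, mul0r) addr0 eqxx.
  apply: (W v u) => //; first by move=> x; rewrite fE prodfC.
    by move=> x y; rewrite -B addrC mulrC [X in _ + X]mulrC.
  by move=> x /Z; rewrite orbC.
have v1 : h e1 v = 0 by case/orP: (Z _ f1) => /eqP //; move/eqP: u1.
have K y : pol f e1 y = 0 -> h y v = 0.
  by rewrite -B v1 mulr0 addr0 => /eqP; rewrite mulf_eq0 (negbTE u1) => /eqP.
by move: b24'; rewrite -B (K e2) // (K e4) // !mulr0 addr0 eqxx.
Qed.

(** The tangent points a e1 + b e2 are those with a bar b = b bar a, the t + 1 points of a Baer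
    subline. Each carries a second line, so the line of e1 and e2 has t + 1 neighbours, the case of
    equality in [noplane_bound]. *)
Lemma adapted_second f e1 e2 e3 e4 : quad f -> adapted f ((e1, e2), (e3, e4)) ->
  ~~ hasplane f -> #|isozeros f| = second_isozeros.
Proof.
move=> qf ad np; have /and5P[/= hy fL fM /eqP b14 /andP[/eqP b23 /eqP b24]] := ad.
have [f3 f4 f34] := (vanishes_line qf (hyp_isopair (hyp_swap hy))).1 fM.
have H := hypE hy; have ip := hyp_isopair hy; have Ll := mem_lines ip.
have LT : line e1 e2 \in flines f by apply/flinesP.
have t1 := t_gt1; have q0 := t2B1_gt0.
have B0 : pol f e1 e3 != 0.
  apply: contra np => /eqP B0; apply/existsP; exists e1.
  case/and4P: ip => _ _ _ /indep_neq0l ->; apply/forallP => z; apply/implyP => _.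
  by rewrite (adaptedE z qf ad) B0 mul0r.
have tE a b : (a, b) != (0, 0) -> tang f (a *: e1 + b *: e2) = (a * bar b == b * bar a).
  move=> ab; rewrite (tang_sesqui qf hy fL ab) b14 b23 -b24 oppr0 !mul0r addr0 add0r.
  rewrite -[X in X == 0](_ : pol f e1 e3 * (b * bar a - a * bar b) = _); last by ring.
  by rewrite mulf_eq0 (negbTE B0) subr_eq0 eq_sym.
have [_ [[_ nbH] _]] := noplane_bound qf np LT; apply: nbH.
apply/eqP; rewrite -(eqn_pmul2l q0) -(sum_second LT) [X in _ == X]mulnC -(card_sym_pairs).
have -> : (\sum_(p in line e1 e2 :\ 0%R) #|second f (line e1 e2) p| =
    #|[set p in line e1 e2 :\ 0%R | tang f p]|)%N.
  rewrite -sum1dep_card big_mkcondr; apply: eq_bigr => p pL.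
  have [_ le] := perpzeros_second qf np LT pL.
  move: le; case tp: (tang f p) => /= le; last by apply/eqP; rewrite -leqn0.
  apply/eqP; rewrite eqn_leq le /=; apply/card_gt0P.
  have /setD1P[p0 /(lineP _ ip)[a [b pE]]] := pL.
  have ab : (a, b) != (0, 0).
    by apply: contra p0 => /eqP[a0 b0]; rewrite pE a0 b0 !scale0r addr0.
  move: tp; rewrite pE tE // => /eqP eab.
  (* The vector of the opposite line orthogonal to p. As pol f p q is a multiple of b bar a - a bar
     b, f vanishes on the span of p and q. *)
  pose q := - bar b *: e3 + bar a *: e4.
  have pp : h p p = 0 by apply: (lines_perp Ll); apply/(lineP _ ip); exists a, b.
  have ipq : isopair p q.
    rewrite /isopair pp eqxx /= pE /q !hE !H !(mulr0, mulr1, addr0, add0r) eqxx /=.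
    apply/andP; split; first by rewrite barN barK barK; apply/eqP; ring.
    apply/indepP => k l E.
    have := (f_equal (h^~ e1) E, f_equal (h^~ e2) E, f_equal (h^~ e3) E, f_equal (h^~ e4) E).
    rewrite !hE !H !(mulr0, mulr1, addr0, add0r) => -[[[E1 E2] E3] E4].
    move: ab; rewrite xpair_eqE negb_and => /orP[a0|b0].
      move/eqP: E2; rewrite mulf_eq0 bar_eq0 (negbTE a0) orbF => /eqP l0.
      by move/eqP: E3; rewrite mulf_eq0 (negbTE a0) orbF => /eqP.
    move/eqP: E1; rewrite mulf_eq0 oppr_eq0 bar_eq0 (negbTE b0) orbF => /eqP l0.
    by move/eqP: E4; rewrite mulf_eq0 (negbTE b0) orbF => /eqP.
  exists (line p q); rewrite inE -pE line_l // andbT; apply/andP; split.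
    apply/flinesP; split; first exact: mem_lines.
    apply/(vanishes_line qf ipq); split.
    - by apply: (vanishesP _ _ fL); apply/(lineP _ ip); exists a, b.
    - by rewrite /q !(quadE qf) f3 f4 f34 !mulr0 !addr0.
    rewrite pE /q !(quadE qf) b14 b23 -b24.
    transitivity (pol f e1 e3 * (b * bar a - a * bar b)); first by ring.
    by rewrite eab subrr mulr0.
  apply/eqP => LE; have : q \in line e1 e2 by rewrite -LE line_r.
  rewrite inE /q !hE !H !(mulr0, mulr1, addr0, add0r) oppr_eq0 !bar_eq0 => /andP[bz az].
  by move: ab; rewrite xpair_eqE az bz.
apply/eqP/(card_bij (f := fun p => (h p e3, h p e4)) (g := fun x => x.1 *: e1 + x.2 *: e2)).
  move=> p /setIdP[/setD1P[p0 /(lineP _ ip)[a [b pE]]]].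
  have ab : (a, b) != (0, 0).
    by apply: contra p0 => /eqP[a0 b0]; rewrite pE a0 b0 !scale0r addr0.
  rewrite pE tE // !hE !H !(mulr0, mulr1, addr0, add0r) => e.
  by rewrite inE ab.
move=> [a b]; rewrite inE /= => /andP[ab e].
rewrite !hE !H !(mulr0, mulr1, addr0, add0r); split=> //.
rewrite inE tE // e andbT; apply/setD1P; split; last by apply/(lineP _ ip); exists a, b.
apply: contra ab => /eqP.
by case/and4P: ip => _ _ _ /indepP ind /ind[-> ->].
Qed.

Definition second_noplane :=
  [set f : {ffun V -> F} | [&& quad f, ~~ hasplane f & #|isozeros f| == second_isozeros]].

Lemma card_adapted_forms e1 e2 e3 e4 : hyp e1 e2 e3 e4 ->
  #|[set f in second_noplane | adapted f ((e1, e2), (e3, e4))]| = (t ^ 2 - 1)%N.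
Proof.
move=> hy; have H := hypE hy; rewrite -(card_nonzero).
apply: (card_bij (f := fun f : {ffun V -> F} => pol f e1 e3) (g := normal_form ((e1, e2),
  (e3, e4)))).
  move=> f /setIdP[]; rewrite inE => /and3P[qf np _] ad.
  split; last by apply/ffunP => x; rewrite ffunE (adaptedE x qf ad).
  rewrite inE; apply: contra np => /eqP B0; apply/existsP; exists e1.
  case/and4P: (hyp_isopair hy) => _ _ _ /indep_neq0l ->; apply/forallP => z; apply/implyP => _.
  by rewrite (adaptedE z qf ad) B0 mul0r.
move=> b bS; have b0 : b != 0 by move: bS; rewrite inE.
have ad := normal_form_adapted b hy; have qf := normal_form_quad ((e1, e2), (e3, e4)) b.
have bE : pol (normal_form ((e1, e2), (e3, e4)) b) e1 e3 = b by rewrite normal_form_pol /=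
  !H; ring.
split=> //; rewrite inE ad andbT inE qf.
have np := adapted_noplane qf ad; rewrite bE in np; have {}np := np b0.
by rewrite np (adapted_second qf ad np) eqxx.
Qed.

(** Each isotropic pair has t^4 completions to a hyperbolic basis, and each basis is adapted to t^2
    - 1 forms, against 2 (t + 1) t times (t + 1)(t^2 - 1) t (t - 1) bases for each form. *)
Lemma card_second_noplane :
  (2 * #|second_noplane| = (t ^ 4 - 1) * (t ^ 3 + 1) * t ^ 4)%N.
Proof.
have t1 := t_gt1; have q0 := t2B1_gt0.
pose hypq (e : (V * V) * (V * V)) := hyp e.1.1 e.1.2 e.2.1 e.2.2.
have E : (#|[set f | mem second_noplane f]| *
    (2 * t.+1 * t * (t.+1 * (t ^ 2 - 1) * (t * (t - 1)))) =
    #|[set e | hypq e]| * (t ^ 2 - 1))%N.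
  apply: (double_count (Q := fun f : {ffun V -> F} => adapted f)
    (Q' := fun e (f : {ffun V -> F}) => (f \in second_noplane) && adapted f e)).
  - move=> f e; rewrite /hypq /=; case ad: (adapted f e); rewrite ?andbF ?andbT //=.
    by have /and5P[-> _ _ _ _] := ad.
  - by move=> f; rewrite /= inE => /and3P[qf np /eqP Nf]; apply: card_adapted.
  - move=> [[e1 e2] [e3 e4]] /(card_adapted_forms) <-.
    by apply: eq_card => f; rewrite !inE.
have cE : #|[set e | hypq e]| = ((t ^ 4 - 1) * (t ^ 3 + 1) * (t.+1 * (t ^ 4 - t ^ 2)) * t ^
  4)%N.
  rewrite -(card_isopairs).
  rewrite -(card_pair_const (Q := fun (x y : V * V) => hyp x.1 x.2 y.1 y.2)).
    apply: eq_card => -[[e1 e2] [e3 e4]]; rewrite !inE /hypq /=.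
    by case hy: (hyp _ _ _ _); rewrite ?andbF // (hyp_isopair hy).
  by move=> [x y] /= ip; apply: card_hyp_completions.
have cS : #|[set f | mem second_noplane f]| = #|second_noplane|.
  by apply: eq_card => f; rewrite inE.
move: E; rewrite cE cS; move: #|second_noplane| => n.
have E1 : (t ^ 4 - t ^ 2 = t * t * (t ^ 2 - 1))%N.
  by rewrite mulnBr muln1 mulnn -expnD.
have E2 : (t ^ 2 - 1 = t.+1 * (t - 1))%N.
  by rewrite -[1%N in LHS](exp1n 2) subn_sqr addn1 mulnC.
move=> E; apply/eqP.
have c0 : (0 < t.+1 * t * t * (t ^ 2 - 1) * (t ^ 2 - 1))%N by rewrite !muln_gt0 q0 (ltnW t1).
rewrite -(eqn_pmul2r c0); apply/eqP.
transitivity (n * (2 * t.+1 * t * (t.+1 * (t ^ 2 - 1) * (t * (t - 1)))))%N.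
  by rewrite {2}E2; ring.
by rewrite E E1; ring.
Qed.

(** * The code *)

Lemma normalize (v : V) : v != 0 -> exists c, c != 0 /\ normalized (c *: v).
Proof.
move=> v0; have [i vi min] : exists2 i, v 0 i != 0 & forall j : 'I_4, (j < i)%N -> v 0 j = 0.
  have [i0 vi0] : exists i0, v 0 i0 != 0.
    case: (pickP (fun i => v 0 i != 0)) => [i|no]; first by exists i.
    by case/eqP: v0; apply/rowP => i; rewrite mxE; apply/eqP/negbFE/no.
  have [i vi le] := @arg_minnP _ i0 (fun i => v 0 i != 0) (fun i => i : nat) vi0.
  exists i => // j ji; apply/eqP; apply: contraTT ji => vj.
  by rewrite -leqNgt le.
exists (v 0 i)^-1; rewrite invr_eq0; split=> //; apply/existsP; exists i.
rewrite mxE mulVf // eqxx; apply/forallP => j; apply/implyP => ji.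
by rewrite mxE (min j ji) mulr0.
Qed.

Lemma normalized_unique (v : V) c : normalized v -> normalized (c *: v) -> c = 1.
Proof.
case/existsP => i /andP[/eqP vi /forallP mi] /existsP[j /andP[]].
rewrite mxE => /eqP cvj /forallP mj.
case: (ltngtP i j) => ij.
- move: (implyP (mj i) ij); rewrite mxE vi mulr1 => /eqP c0.
  by move: cvj; rewrite c0 mul0r => /eqP; rewrite eq_sym oner_eq0.
- move: (implyP (mi j) ij) => /eqP vj.
  by move: cvj; rewrite vj mulr0 => /eqP; rewrite eq_sym oner_eq0.
by move: cvj; rewrite -(val_inj ij) vi mulr1.
Qed.

Lemma normalized_neq0 (v : V) : normalized v -> v != 0.
Proof.
case/existsP => i /andP[/eqP vi _]; apply/eqP => v0.
by move: vi; rewrite v0 mxE => /eqP; rewrite eq_sym oner_eq0.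
Qed.

Local Notation X := (hermitian_surface F t).

Lemma mem_surface (x : proj_point F 3) : (x \in X) = (h (val x) (val x) == 0).
Proof.
rewrite inE /h; congr (_ == 0); apply: eq_bigr => i _; exact: exprS.
Qed.

(** Each nonzero vector is a nonzero scalar times a unique normalized vector, and both isotropy and
    f = 0 are invariant under scalars. *)
Lemma card_isozeros_proj f : quad f ->
  #|isozeros f| = ((t ^ 2 - 1) * #|[set x in X | f (val x) == 0%R]|)%N.
Proof.
move=> qf; rewrite -(card_nonzero) -cardsX.
rewrite -(card_in_imset (f := fun y : F * proj_point F 3 => y.1 *: val y.2)).
  apply: eq_card => z; apply/idP/imsetP.
    rewrite !inE => /and3P[z0 /eqP hz /eqP fz]; have [c [c0 nz]] := normalize z0.
    have [y yE] : exists y : proj_point F 3, val y = c *: z.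
      by exists (Sub (c *: z) nz); rewrite SubK.
    exists (c^-1, y); last by rewrite /= yE scalerA mulVf // scale1r.
    rewrite in_setX inE invr_eq0 c0 /=; apply/setIdP; rewrite mem_surface.
    by rewrite !yE !hE hz !mulr0 (quadZ qf) fz mulr0 eqxx.
  move=> [[c x]]; rewrite in_setX inE /= => /andP[c0 /setIdP[xX /eqP fx]] ->.
  rewrite mem_surface in xX.
  rewrite !inE scaler_eq0 negb_or c0 normalized_neq0 ?(valP x) //.
  by rewrite !hE (eqP xX) !mulr0 (quadZ qf) fx mulr0 eqxx.
move=> [c x] [d y]; rewrite !in_setX /= !inE => /andP[c0 _] /andP[d0 _] e.
have yE : val y = (d^-1 * c) *: val x by rewrite -scalerA e scalerA mulVf // scale1r.
have cd : d^-1 * c = 1 by apply: (normalized_unique (valP x)); rewrite -yE (valP y).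
have xy : x = y by apply: val_inj; rewrite yE cd scale1r.
by congr (_, _) => //; rewrite -[c]mul1r -(mulfV d0) -mulrA cd mulr1.
Qed.

Definition word (f : V -> F) : {ffun {x : proj_point F 3 | x \in X} -> F^o} :=
  [ffun x => f (val (val x)) : F^o].

Lemma hweight_word f : hweight (word f) = (#|X| - #|[set x in X | f (val x) == 0%R]|)%N.
Proof.
rewrite -(cardsID [set x | f (val x) == 0] X) (_ : _ :&: _ = [set x in X | f (val x) == 0]).
  rewrite addKn /hweight -(card_imset _ val_inj); apply: eq_card => x.
  apply/imsetP/idP => [[y]|]; rewrite !inE ?ffunE.
    by move=> fy ->; rewrite fy; move: (valP y); rewrite inE.
  move=> /andP[fx xX]; have xX' : x \in X by rewrite inE.
  by exists (Sub x xX'); rewrite ?inE ?ffunE SubK.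
by apply/setP => x; rewrite !inE.
Qed.

(** * Forms of degree 2 as quadratic functions *)

Lemma quad_mulvar i j : quad (fun v : V => v 0 i * v 0 j).
Proof.
apply/quadP; split=> [a x|a x y z]; first by rewrite !mxE; ring.
by rewrite /pol !mxE; ring.
Qed.

Lemma quad_eq (f g : V -> F) : f =1 g -> quad g -> quad f.
Proof.
by move=> e /quadP[Q1 Q2]; apply/quadP; split=> *; rewrite /pol !e; [apply: Q1|apply: Q2].
Qed.

Lemma quad_lin (f g : V -> F) a : quad f -> quad g -> quad (fun v => a * f v + g v).
Proof.
move=> qf qg; apply/quadP; split=> [b x|b x y z].
  by rewrite (quadZ qf) (quadZ qg); ring.
have e u v : pol (fun v => a * f v + g v) u v = a * pol f u v + pol g u v.
  by rewrite /pol; ring.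
by rewrite !e (polDl qf) (polDl qg) (polZl qf) (polZl qg); ring.
Qed.

Lemma quad_const0 : quad (fun _ : V => 0 : F).
Proof. by apply/quadP; split=> *; rewrite /pol; ring. Qed.

(** A monomial of degree 2 is a product of two variables, and quadratic functions are closed under
    linear combinations. *)
Lemma quad_meval (p : {mpoly F[4]}) : p \is 2.-homog ->
  quad (fun v : V => p.@[fun i => v 0 i]).
Proof.
move=> /dhomogP hp.
have : quad (fun v : V => \sum_(m <- msupp p) p@_m * ('X_[m] : {mpoly F[4]}).@[fun i => v 0
  i]).
  have : {in msupp p, forall m, mdeg m = 2%N} by exact: hp.
  elim: (msupp p : seq _) => [|m s IH] H.
    by apply: quad_eq quad_const0 => v; rewrite big_nil.
  apply: (@quad_eq _ (fun v => p@_m * ('X_[m] : {mpoly F[4]}).@[fun i => v 0 i] +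
     \sum_(m <- s) p@_m * ('X_[m] : {mpoly F[4]}).@[fun i => v 0 i])).
    by move=> v; rewrite big_cons.
  apply: quad_lin; last by apply: IH => m' ms; apply: H; rewrite inE ms orbT.
  have mE : mdeg m = 2%N by apply: H; rewrite inE eqxx.
  have [i mi] : exists i, (0 < m i)%N.
    case: (pickP (fun i => (0 < m i)%N)) => [i|no]; first by exists i.
    suff : mdeg m = 0%N by rewrite mE.
    by rewrite mdegE big1 // => i _; apply/eqP; rewrite -leqn0 leqNgt no.
  have mU : (U_(i) <= m)%MM by rewrite lep1mP -lt0n.
  have : mdeg (m - U_(i))%MM == 1%N.
    by have := mdegD (m - U_(i))%MM U_(i)%MM; rewrite submK // mE mdeg1 addn1 => -[<-].
  case/mdeg1P => j /eqP mj.
  apply: quad_eq (quad_mulvar j i) => v.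
  by rewrite -(submK mU) mj mpolyXD mevalM !mevalXU.
apply: quad_eq => v; rewrite {1}[p]mpolyE raddf_sum /=.
by apply: eq_bigr => m _; rewrite mevalZ.
Qed.

(** A product of two distinct variables gets its whole coefficient at i < j and nothing at j < i, so
    that no division by 2 occurs. *)
Definition quad_coef (f : V -> F) (i j : 'I_4) : F :=
  if (i < j)%N then pol f (delta_mx 0 i) (delta_mx 0 j) else
  if i == j then f (delta_mx 0 i) else 0.

Definition quad_poly (f : V -> F) : {mpoly F[4]} :=
  \sum_(i < 4) \sum_(j < 4) quad_coef f i j *: ('X_i * 'X_j).

Lemma quad_poly_homog f : quad_poly f \is 2.-homog.
Proof.
apply: rpred_sum => i _; apply: rpred_sum => j _; apply: rpredZ.
by rewrite -mpolyXD dhomogX /= mdegD !mdeg1.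
Qed.

Lemma meval_quad_poly f (v : V) : quad f -> (quad_poly f).@[fun i => v 0 i] = f v.
Proof.
move=> qf; rewrite /quad_poly raddf_sum /= [in RHS](matrix_sum_delta v) big_ord1.
rewrite (eq_bigr (fun i => \sum_(j < 4) quad_coef f i j * (v 0 i * v 0 j))) => [|i _];
  last first.
  by rewrite raddf_sum /=; apply: eq_bigr => j _; rewrite mevalZ mevalM !mevalXU.
rewrite !big_ord_recl !big_ord0 /quad_coef /= !addr0 !(quadE qf).
by ring.
Qed.

(** Forms of degree 2 and quadratic functions have the same evaluations, so the code can be handled
    through [quad] alone. *)
Lemma mem_code w : reflect (exists f : {ffun V -> F}, quad f /\ w = word f)
  (w \in functional_code 2 X).
Proof.
apply: (iffP memv_imgP) => [[p _ ->]|[f [qf ->]]].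
  exists [ffun v : V => (mpoly_of_dhomog p).@[fun i => v 0 i]]; split.
    apply: quad_eq (quad_meval (dhomog_is_dhomog p)) => v.
    by rewrite ffunE.
  by apply/ffunP => x; rewrite lfunE /= !ffunE.
exists (DHomog (quad_poly_homog f)); first exact: memvf.
by apply/ffunP => x; rewrite lfunE /= !ffunE /= meval_quad_poly.
Qed.

(** * Weights of the code *)

Definition zeros f := #|[set x in X | f (val x) == 0 :> F]|.

Lemma card_surface : #|X| = ((t ^ 2 + 1) * (t ^ 3 + 1))%N.
Proof.
apply/eqP; rewrite -(eqn_pmul2l t2B1_gt0) mulnA -t4E -card_isotropic.
have -> : #|X| = zeros (fun _ => 0).
  by apply: eq_card => x; rewrite !inE eqxx andbT.
rewrite -card_isozeros_proj ?quad_const0 //; apply/eqP.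
by apply: eq_card => z; rewrite !inE eqxx andbT.
Qed.

Lemma zeros_secondE f : quad f ->
  (#|isozeros f| == second_isozeros) = (zeros f == 2 * t ^ 3 + t ^ 2 + 1)%N.
Proof. by move=> qf; rewrite card_isozeros_proj // (eqn_pmul2l t2B1_gt0). Qed.

Lemma zeros_values f : quad f -> (exists z, f z != 0) ->
  (zeros f <= 2 * t ^ 3 + t ^ 2 + 1)%N \/ zeros f = (2 * t ^ 3 + 2 * t ^ 2 + 1 - t)%N.
Proof.
move=> qf f0; have := quad_values qf f0.
rewrite card_isozeros_proj // (leq_pmul2l t2B1_gt0).
case=> [le|/eqP]; first by left.
by rewrite (eqn_pmul2l t2B1_gt0) => /eqP; right.
Qed.

Definition weight_min := (#|X| - (2 * t ^ 3 + 2 * t ^ 2 + 1 - t))%N.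
Definition weight_second := (#|X| - (2 * t ^ 3 + t ^ 2 + 1))%N.

Lemma surface_large : (2 * t ^ 3 + 2 * t ^ 2 + 1 - t < #|X|)%N.
Proof.
have t1 := t_gt1; rewrite card_surface.
have : (2 * 2 * t ^ 3 <= t ^ 2 * t ^ 3)%N by rewrite leq_mul2r -[(2 * 2)%N]/(2 ^ 2)%N
  leq_exp2r // t1 orbT.
have : (t ^ 2 <= t ^ 3)%N by rewrite leq_exp2l.
move=> a b; nia.
Qed.

Lemma weights_ordered : (0 < weight_min)%N /\ (weight_min < weight_second)%N.
Proof.
have lt := surface_large; have t1 := t_gt1.
have : (t < t ^ 2)%N by rewrite -{1}(expn1 t) ltn_exp2l.
rewrite /weight_min /weight_second; lia.
Qed.

Lemma hweight_values f : quad f -> (exists z, f z != 0) ->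
  hweight (word f) = weight_min \/ (weight_second <= hweight (word f))%N.
Proof.
move=> qf f0; rewrite hweight_word; case: (zeros_values qf f0) => H; last by left;
  rewrite /weight_min -H.
by right; apply: leq_sub2l.
Qed.

Lemma hweight_second f : quad f -> (hweight (word f) == weight_second) = (#|isozeros f| ==
  second_isozeros).
Proof.
move=> qf; rewrite zeros_secondE // hweight_word -/(zeros f).
have le : (zeros f <= #|X|)%N.
  by apply: subset_leq_card; apply/subsetP => x; rewrite inE => /andP[].
have := weights_ordered; rewrite /weight_second; move: le;
  move: (zeros f) #|X| (2 * t ^ 3 + t ^ 2 + 1)%N => a b c.
move=> le [w1 w2]; apply/eqP/eqP; lia.
Qed.

(** The difference vanishes on all of X, whereas a nonzero quadratic function has at most 2 t^3 + 2
    t^2 - t + 1 zeros there, fewer than the points of X. *)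
Lemma word_inj (f g : {ffun V -> F}) : quad f -> quad g -> word f = word g -> f = g.
Proof.
move=> qf qg e; have qd := quad_lin (-1) qg qf.
apply/ffunP => z; apply/eqP; rewrite -subr_eq0.
case: (eqVneq (-1 * g z + f z) 0) => [<-|dz]; first by rewrite mulN1r addrC eqxx.
have zd : zeros (fun v => -1 * g v + f v) = #|X|.
  apply: eq_card => x; rewrite !inE; case xX: (_ == 0) => //=.
  have xX' : x \in X by rewrite inE.
  have /ffunP/(_ (Sub x xX')) := e; rewrite !ffunE SubK => ->.
  by rewrite mulN1r addNr eqxx.
have lt := surface_large; have t1 := t_gt1.
have : (t <= t ^ 2)%N by rewrite -{1}(expn1 t) leq_exp2l.
case: (zeros_values qd); first (by exists z); rewrite zd; lia.
Qed.

Lemma word_nonzero (f : V -> F) : (0 < hweight (word f))%N -> exists z, f z != 0.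
Proof.
case: (pickP (fun z => f z != 0)) => [z|no]; first by exists z.
suff -> : hweight (word f) = 0%N by [].
by apply: eq_card0 => x; rewrite inE ffunE no.
Qed.

Lemma code_weightsP n : reflect
  (exists f : {ffun V -> F}, [/\ quad f, (exists z, f z != 0) & n = hweight (word f)])
  (n \in undup [seq hweight w | w : {ffun {x : proj_point F 3 | x \in X} -> F^o}
     in [pred w | (w \in functional_code 2 X) && (w != 0)]]).
Proof.
rewrite mem_undup; apply: (iffP imageP) => [[w]|[f [qf f0 ->]]].
  rewrite inE => /andP[/mem_code[f [qf ->]] w0] ->; exists f; split=> //.
  case: (pickP (fun z => f z != 0)) => [z|no]; first by exists z.
  by case/eqP: w0; apply/ffunP => x; rewrite !ffunE; apply/eqP/negbFE/no.
exists (word f) => //; rewrite inE; apply/andP; split; first by apply/mem_code; exists f.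
apply/eqP => w0; case: f0 => z fz.
have e : f = [ffun _ => 0].
  apply: word_inj => //.
    by apply: quad_eq quad_const0 => v; rewrite ffunE.
  by rewrite w0; apply/ffunP => x; rewrite !ffunE.
by move: fz; rewrite e ffunE eqxx.
Qed.

(** Both weights occur: the smallest for the tangent planes at e2 and e4, where h e2 e4 = 1, and the
    next for those at the orthogonal points e1 and e2. *)
Lemma code_second_weight : (1 < size (code_weights (functional_code 2 X)))%N /\
  second_weight (functional_code 2 X) = weight_second.
Proof.
have [w1 w2] := weights_ordered.
have quad_ff (u v : V) : quad (prodff (u, v)).
  by apply: (@quad_eq _ (prodf u v)) => [z|]; rewrite ?ffunE //; apply: prodf_quad.
have ff_iso (u v : V) : isozeros (prodff (u, v)) = isozeros (prodf u v).
  by apply: isozeros_eq => z; rewrite ffunE.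
apply: (@second_smallest _ weight_min weight_second); first exact: undup_uniq.
- have [u [v e]] := first_isozeros_attained.
  have wE : hweight (word (prodff (u, v))) = weight_min.
    rewrite hweight_word; congr (_ - _)%N; apply/eqP; rewrite -(eqn_pmul2l t2B1_gt0).
    by rewrite -card_isozeros_proj // ff_iso e.
  apply/code_weightsP; exists (prodff (u, v)); split=> //.
  by apply: word_nonzero; rewrite wE.
- have [e1 [e2 [e3 [e4 /hyp_isopair ip]]]] := hyp_exists.
  case/and4P: ip => /eqP h1 _ /eqP h12 ind.
  have wE : hweight (word (prodff (e1, e2))) = weight_second.
    apply/eqP; rewrite hweight_second // ff_iso; apply/eqP.
    by apply: prodf_count_perp => //; apply: indep_neq0l ind.
  apply/code_weightsP; exists (prodff (e1, e2)); split=> //.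
  by apply: word_nonzero; rewrite wE (ltn_trans w1).
- exact: w2.
move=> n /code_weightsP[f [qf f0 ->]]; exact: hweight_values.
Qed.

(** Over the common factor (t^4 - 1)(t^3 + 1) t^2, products contribute 2 t^2 - t + 1 and the
    remaining forms t^2. *)
Lemma card_second_weight_words :
  (2 * #|second_weight_words (functional_code 2 X)| =
   (t ^ 4 - 1) * (t ^ 3 + 1) * t ^ 2 * (3 * t ^ 2 + 1 - t))%N.
Proof.
have [_ sw] := code_second_weight; have [w1 w2] := weights_ordered.
have -> : second_weight_words (functional_code 2 X) =
    [set word (f : {ffun V -> F}) | f in second_plane :|: second_noplane].
  apply/setP => w; rewrite inE sw; apply/andP/imsetP => [[/mem_code[f [qf ->]]]|[f]].
    rewrite hweight_second // => Nf; exists f => //; rewrite !inE qf Nf /=.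
    by rewrite !andbT orbN.
  rewrite !inE => fS ->; have [qf Nf] : quad f /\ #|isozeros f| == second_isozeros.
    by case/orP: fS => /and3P[].
  by split; [apply/mem_code; exists f | rewrite hweight_second].
rewrite card_in_imset; last first.
  by move=> f g; rewrite !inE => /orP[] /and3P[qf _ _] /orP[] /and3P[qg _ _]; apply: word_inj.
rewrite cardsU (_ : _ :&: _ = set0) ?cards0 ?subn0; last first.
  by apply/setP => f; rewrite !inE; case: (hasplane f); rewrite ?andbF.
rewrite mulnDr (card_second_plane) (card_second_noplane).
have t1 := t_gt1; have : (t <= t ^ 2)%N by rewrite -{1}(expn1 t) leq_exp2l // ltnW.
have -> : (t ^ 4 = t ^ 2 * t ^ 2)%N by rewrite -expnD.
move=> le; rewrite [((_ - 1) * _ * (_ * _))%N]mulnA -mulnDr; congr (_ * _)%N; lia.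
Qed.

End HermitianSurface.

Theorem theorem3p6 (t : nat) (F : finFieldType)
    (t_pp : prime_power t) (card_F : #|F| = (t ^ 2)%N) :
  let C := functional_code 2 (hermitian_surface F t) in
  (1 < size (code_weights C))%N /\
  (#|second_weight_words C|%:R : rat) =
    1 / 2%:R * (t%:R ^+ 2 - 1) * (t%:R ^+ 5 + t%:R ^+ 3 + t%:R ^+ 2 + 1)
      * (3%:R * t%:R ^+ 2 - t%:R + 1) * t%:R ^+ 2.
Proof.
move=> C; split; first by case: (code_second_weight t_pp card_F).
have t1 := t_gt1 t_pp.
(* These bounds let the natural subtractions pass to the rationals. There t^4 - 1 is (t^2 - 1)(t^2 +
   1), and (t^2 + 1)(t^3 + 1) is the factor of degree 5. *)
have le1 : (1 <= t ^ 4)%N by rewrite expn_gt0 ltnW.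
have le2 : (t <= 3 * t ^ 2 + 1)%N.
  have : (t <= t ^ 2)%N by rewrite -{1}(expn1 t) leq_exp2l.
  lia.
have := card_second_weight_words t_pp card_F; rewrite -/C => /(f_equal (fun n => n%:R : rat)).
rewrite !natrM (natrB _ le1) (natrB _ le2) !natrD !natrM => e.
have -> : (#|second_weight_words C|%:R : rat) = 2%:R * #|second_weight_words C|%:R / 2%:R by
  field.
by rewrite e; field.
Qed.
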